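(* Let $p\in(0,1)$ and fix $x,y\in(0,\infty)$ with $p<y/x<p^{-1}$. Then there exist finite constants $N_0$ and $C=C(x,y,p)$ such that, for all $b\ge C$, $N\ge N_0$ and any $0<\alpha<1$, $$\mathbb{P}\big\{|G_{(1,1),(\lfloor Nx\rfloor,\lfloor Ny\rfloor)}-Ng_{pp}(x,y)|\ge bN^{1/3}\big\}\le Cb^{-3\alpha/2}.$$ In particular, for $N>N_0$ and $1\le r<3\alpha/2$ one has the moment bound $$\mathbb{E}\Bigg[\bigg|\frac{G_{(1,1),(\lfloor Nx\rfloor,\lfloor Ny\rfloor)}-Ng_{pp}(x,y)}{N^{1/3}}\bigg|^r\Bigg]\le C(x,y,p,r)<\infty,$$ where the constant $C(x,y,p,r)$ does not depend on $N$.
   Context: Notation: $e_1=(1,0)$, $e_2=(0,1)$. The environment is $\{\omega_v\}_{v\in\mathbb{N}^2}$, i.i.d. $\mathrm{Ber}(p)$ under $\mathbb{P}$ (no boundary weights). An admissible path from $(1,1)$ to $(m,n)$ (with $m,n\ge1$) is a finite sequence of sites from $(1,1)$ to $(m,n)$ with all steps in $\{e_1,e_2,e_1+e_2\}$; a diagonal step $e_1+e_2$ into a site $v$ collects $\omega_v$, and horizontal and vertical steps collect $0$. $G_{(1,1),(m,n)}$ is the maximum, over all admissible paths from $(1,1)$ to $(m,n)$, of the total collected weight. The shape function is $$g_{pp}(s,t)=\begin{cases}s,& t\ge s/p,\\ \frac{1}{1-p}\big(2\sqrt{pst}-p(t+s)\big),& ps\le t<s/p,\\ t,& t\le ps.\end{cases}$$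 *)

(* Defs.v *)
From mathcomp Require Import all_boot all_order all_algebra.
From mathcomp Require Import all_classical all_reals all_analysis.
Set Implicit Arguments.
Unset Strict Implicit.
Unset Printing Implicit Defensive.
Import Order.TTheory GRing.Theory Num.Theory.
Import numFieldNormedType.Exports.
Local Open Scope classical_set_scope.
Local Open Scope ring_scope.

Definition site : Type := (nat * nat)%type.

(* The lattice N^2 with N = {1, 2, ...}, as a subset of nat * nat; nothing is
   assumed about variables indexed by sites outside it. *)
Definition lattice : set site := [set v | (0 < v.1)%N /\ (0 < v.2)%N].

(* Product rule over every finite subfamily of the X i, i in D. *)
Definition mutually_independent (I : eqType) (D : set I)
    (d d' : measure_display) (T : measurableType d) (T' : measurableType d')
    (R : realType) (P : probability T R) (X : I -> {RV P >-> T'}) : Prop :=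
  forall (s : seq I) (B : I -> set T'),
    uniq s -> (forall i, i \in s -> D i) -> (forall i, measurable (B i)) ->
    P (\bigcap_(i in [set j | j \in s]) X i @^-1` B i)
    = (\prod_(i <- s) P (X i @^-1` B i))%E.

Definition iid_bernoulli (d : measure_display) (T : measurableType d)
    (R : realType) (P : probability T R) (p : R)
    (omega : site -> {RV P >-> bool}) : Prop :=
  (forall v, lattice v -> distribution P (omega v) =1 bernoulli_prob p)
  /\ mutually_independent lattice omega.

Definition right_of (u : site) : site := (u.1.+1, u.2).
Definition above_of (u : site) : site := (u.1, u.2.+1).
Definition diag_of (u : site) : site := (u.1.+1, u.2.+1).

Definition step : rel site :=
  [rel u v | [|| v == right_of u, v == above_of u | v == diag_of u]].

(* A path is represented by the sites s following its initial site u. *)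
Definition admissible (u v : site) (s : seq site) : Prop :=
  path step u s /\ last u s = v.

Definition step_weight (w : site -> bool) (u v : site) : nat :=
  if v == diag_of u then w v : nat else 0%N.

Definition path_weight (w : site -> bool) (u : site) (s : seq site) : nat :=
  sumn (pairmap (step_weight w) u s).

(* There are finitely many admissible paths from u to v, so for
   coordinatewise u <= v the supremum is a maximum. *)
Definition last_passage (R : realType) (w : site -> bool) (u v : site) : R :=
  sup [set (path_weight w u s)%:R | s in admissible u v].

Definition g_pp (R : realType) (p s t : R) : R :=
  if s / p <= t then s
  else if p * s <= t then
    (1 - p)^-1 * (2 * Num.sqrt (p * s * t) - p * (t + s))
  else t.

(* G_{(1,1),(floor(N x), floor(N y))} - N g_pp(x,y), for x, y >= 0. *)
Definition centered_last_passage (R : realType) (p x y : R) (N : nat)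
    (w : site -> bool) : R :=
  last_passage R w (1%N, 1%N) (Num.truncn (N%:R * x), Num.truncn (N%:R * y))
  - N%:R * g_pp p x y.

(* Main.v *)
(* Put independent Bernoulli weights of parameters u on the horizontal and v on
   the vertical axis. If u v = (1 - u)(1 - v) p, the increments of the resulting
   last-passage time L along any down-right path are again independent Bernoulli
   variables of parameters u and v (Burke property). These pairs form a curve
   rho |-> (u, v) = (rho / (1 + rho), p / (p + rho)). Tilting the law of the
   vertical boundary moves v along this curve and gives, in closed form, the
   moment generating function of L when u and v belong to nearby values of rho.

   Right tail: L dominates the bulk time G, so Markov's exponential inequality at
   the density rho for which (x, y) is characteristic, with exponent of order
   N^(-1/3), gives P(G - N g >= b N^(1/3)) <= C exp(- c b).

   Left tail: write L = L_H or L = L_V according to the axis along which the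
   optimal path starts. By Cauchy-Schwarz and monotonicity in u,
   P(L = L_H)^2 is bounded by a product of moment generating functions, which is
   small as soon as (m, n) is off-characteristic; together with the stationarity
   of the increments this makes exit points beyond N^(2/3) s unlikely. If the
   path exits earlier, then L - G is at most the fluctuation over a window of
   length N^(2/3) s of the difference between the boundary walk and the gain of
   the (reversed) bulk time, and planarity compares the latter with a stationary
   walk of slightly different density. Hence G is close to L, whose lower tail is
   again controlled by its moment generating function. All errors are O(b^-3) in
   b = |G - N g| / N^(1/3), so b^-3 bounds the tail and the moments of order
   r < 3/2 follow from the second moment. *)
Require Import Defs.
From mathcomp Require Import all_boot all_order all_algebra.
From mathcomp Require Import all_classical all_reals all_analysis.
From mathcomp Require Import measurable_realfun.
From mathcomp Require Import zify ring lra.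
Set Implicit Arguments.
Unset Strict Implicit.
Unset Printing Implicit Defensive.
Import Order.TTheory GRing.Theory Num.Theory.
Import numFieldNormedType.Exports.
Local Open Scope classical_set_scope.
Local Open Scope nat_scope.

(** The obstacle in the left tail is that three estimates must hold under one boundary law: the
    lower tail of L and late exits along each axis. With h = N^(-1/3), that law takes u at density
    rho e^h and v at density rho e^-h, so both axes carry slightly more weight than at density rho.
    The pair is off the Burke curve, but tilting the stationary pair at rho e^h leads exactly to it,
    so the lower exponential moment is explicit. Since extra weight on one axis only discourages a
    late exit along the other, both exit estimates reduce to stationary models, of density rho e^h
    for one axis and rho e^-h for the other.

    The exponent N^(-1/3) comes from the symmetry of rho e^h and rho e^-h about rho: the logarithm
    of the moment generating function has no h^2 term, and its h^3 errors, summed over order N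
    sites, stay bounded.

    All probabilities are finite weighted sums over bits, so Burke, Cauchy-Schwarz and the maximal
    inequality become algebra and induction; the probability space enters only at the end. *)

(** * Last-passage times with boundary weights *)

(* [lpp h k w j i], row first, is the last-passage time to [(i, j)] with boundary
   values [h] on the horizontal axis and [k] on the vertical one ([k 0] is
   ignored); [w i j] is collected by the step from [(i, j)] to [(i.+1, j.+1)]. *)
Fixpoint lpp (h k : nat -> nat) (w : nat -> nat -> bool) (j : nat) : nat -> nat :=
  if j is j'.+1 then
    fix row i :=
      if i is i'.+1
      then maxn (maxn (row i') (lpp h k w j' i)) (lpp h k w j' i' + w i' j')
      else k j
  else h.

Lemma lppSS h k w j i : lpp h k w j.+1 i.+1 =
  maxn (maxn (lpp h k w j.+1 i) (lpp h k w j i.+1)) (lpp h k w j i + w i j).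
Proof. by []. Qed.

Lemma lppS0 h k w j : lpp h k w j.+1 0 = k j.+1.
Proof. by []. Qed.

Lemma lpp0 h k w i : lpp h k w 0 i = h i.
Proof. by []. Qed.

Lemma lpp_eq h k w h' k' w' m n :
  (forall i, i <= m -> h i = h' i) -> (forall j, j <= n -> k j = k' j) ->
  (forall i j, i < m -> j < n -> w i j = w' i j) ->
  forall j i, j <= n -> i <= m -> lpp h k w j i = lpp h' k' w' j i.
Proof.
move=> eh ek ew; elim=> [|j IHj] i; first by move=> _ /eh.
elim: i => [|i IHi] jn im; first by rewrite !lppS0 ek.
by rewrite !lppSS IHi ?IHj ?ew //; lia.
Qed.

(** The recursion uses only maxima and additions of constants, hence commutes with maxima of
    boundary data. For [lppHV] this separates the paths that start along either axis. *)
Lemma lpp_max h k h' k' w j i :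
  lpp (fun i => maxn (h i) (h' i)) (fun j => maxn (k j) (k' j)) w j i
  = maxn (lpp h k w j i) (lpp h' k' w j i).
Proof.
elim: j i => [|j IHj] //; elim=> [|i IHi] //.
by rewrite !lppSS IHi !IHj; lia.
Qed.

Lemma leq_lpp h k h' k' w j i :
  (forall i, h i <= h' i) -> (forall j, k j <= k' j) ->
  lpp h k w j i <= lpp h' k' w j i.
Proof.
move=> hh kk; elim: j i => [|j IHj]; first exact: hh.
elim=> [|i IHi]; first exact: kk.
by rewrite !lppSS; have := IHj i; have := IHj i.+1; lia.
Qed.

Lemma lpp_transpose h k w j i : h 0 = k 0 ->
  lpp h k w j i = lpp k h (fun i j => w j i) i j.
Proof.
move=> hk; elim: j i => [|j IHj]; first by case.
elim=> [|i IHi] //.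
by rewrite !lppSS IHi !IHj; lia.
Qed.

Lemma lpp_add c h k w j i :
  lpp (fun i => c + h i) (fun j => c + k j) w j i = c + lpp h k w j i.
Proof.
elim: j i => [|j IHj] //; elim=> [|i IHi] //.
by rewrite !lppSS IHi !IHj; lia.
Qed.

Lemma lpp_leq_row h k w j i : (forall i, h i <= h i.+1) ->
  lpp h k w j i <= lpp h k w j i.+1.
Proof. by move=> hh; case: j => // j; rewrite lppSS; lia. Qed.

Lemma lpp_leq_col h k w j i : h 0 <= k 1 -> (forall j, k j <= k j.+1) ->
  lpp h k w j i <= lpp h k w j.+1 i.
Proof.
move=> hk kk; case: i => [|i]; last by rewrite lppSS; lia.
by case: j => [|j]; [exact: hk | exact: kk].
Qed.

(* A cell with incoming increments [I] (bottom), [J] (left) and weight [w] has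
   outgoing increments [top_inc] (top) and [right_inc] (right). *)
Definition top_inc (I J w : bool) := ~~ J && (I || w).
Definition right_inc (I J w : bool) := ~~ I && (J || w).

Lemma lpp_cell h k w j i (I J : bool) :
  lpp h k w j i.+1 = lpp h k w j i + I -> lpp h k w j.+1 i = lpp h k w j i + J ->
  lpp h k w j.+1 i.+1 = lpp h k w j.+1 i + top_inc I J (w i j) /\
  lpp h k w j.+1 i.+1 = lpp h k w j i.+1 + right_inc I J (w i j).
Proof.
rewrite lppSS => -> ->.
by split; case: I; case: J; case: (w i j); rewrite /top_inc /right_inc /=; lia.
Qed.

(* Planarity: less horizontal and more vertical boundary weight lowers the
   horizontal increments and raises the vertical ones. *)
Lemma lpp_crossing h k h' k' w :
  h 0 = k 0 -> h' 0 = k' 0 ->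
  (forall i, h i <= h i.+1) -> (forall j, k' j <= k' j.+1) ->
  (forall i, h i.+1 + h' i <= h i + h' i.+1) ->
  (forall j, k j + k' j.+1 <= k j.+1 + k' j) ->
  forall j i,
  lpp h k w j i.+1 + lpp h' k' w j i <= lpp h k w j i + lpp h' k' w j i.+1 /\
  lpp h k w j i + lpp h' k' w j.+1 i <= lpp h k w j.+1 i + lpp h' k' w j i.
Proof.
move=> hk hk' hm km hh kk j i.
have [n] := ubnP (j + i); elim: n j i => // n IH j i lt_n; split.
- case: j => [|j] in lt_n *; first exact: hh.
  have [] := IH j i; first by lia.
  rewrite !lppSS => A B.
  have := lpp_leq_row k w j i hm.
  have h'm i' : h' i' <= h' i'.+1 by have := hm i'; have := hh i'; lia.
  have := lpp_leq_row k' w j i h'm.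
  have := @lpp_leq_col h' k' w j i; rewrite hk' => /(_ (km 0) km).
  by lia.
- case: i => [|i] in lt_n *.
    by have := kk j; case: j {lt_n} => [|j]; rewrite ?lppS0 ?lpp0 ?hk ?hk'.
  have [] := IH j i; first by lia.
  rewrite !lppSS => A B.
  have := lpp_leq_row k w j i hm.
  have h'm i' : h' i' <= h' i'.+1 by have := hm i'; have := hh i'; lia.
  have := lpp_leq_row k' w j i h'm.
  have := @lpp_leq_col h' k' w j i; rewrite hk' => /(_ (km 0) km).
  by lia.
Qed.

Lemma lpp_shift h k w z j i : lpp h k w j (z + i) =
  lpp (fun i => h (z + i)) (fun j => lpp h k w j z) (fun i => w (z + i)) j i.
Proof.
elim: j i => [|j IHj] //; elim=> [|i IHi]; first by rewrite addn0.
by rewrite addnS !lppSS IHi -addnS !IHj.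
Qed.

(* [minn i z]: the weights beyond [z] are switched off. *)
Lemma lpp_truncate h k w z j i : (forall i, h i <= h i.+1) -> h 0 = k 0 ->
  (forall j, k j <= k j.+1) ->
  lpp h k w j (z + i) <=
  maxn (lpp (fun i => h (minn i z)) k w j (z + i))
       (lpp (fun i => h (z + i)) (fun=> h z) (fun i => w (z + i)) j i).
Proof.
move=> hm hk km; elim: j i => [|j IHj]; first by move=> i /=; lia.
elim=> [|i IHi].
  rewrite addn0 (@lpp_eq h k w (fun i => h (minn i z)) k w z j.+1) //; first lia.
  by move=> i iz; congr h; lia.
rewrite addnS !lppSS.
by have := IHj i; have := IHj i.+1; rewrite addnS; lia.
Qed.

(* Decomposition of a path by the point [k] at which it leaves the axis. *)
Lemma lpp_exit h w j i : (forall i, h i <= h i.+1) -> exists2 k, k <= i &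
  lpp h (fun=> h 0) w j i <=
  h k + lpp (fun=> 0) (fun=> 0) (fun i => w (k + i)) j (i - k).
Proof.
move=> hm; elim: j i => [|j IHj] i; first by exists i; rewrite //= addn0.
elim: i => [|i [k ki IHi]]; first by exists 0; rewrite ?addn0.
have [k1 k1i E1] := IHj i; have [k2 k2i E2] := IHj i.+1.
have rowm k' j' := lpp_leq_row (fun=> 0) (fun i => w (k' + i)) j' (i - k')
  (fun=> leqnn 0).
have colm k' j' i' :=
  @lpp_leq_col (fun=> 0) (fun=> 0) (fun i => w (k' + i)) j' i' isT (fun=> isT).
rewrite lppSS.
have [|le_A] := leqP (maxn (lpp h (fun=> h 0) w j i.+1)
  (lpp h (fun=> h 0) w j i + w i j)) (lpp h (fun=> h 0) w j.+1 i).
  exists k; first lia.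
  by have := rowm k j.+1; rewrite -subSn //; lia.
have [|lt_B] := leqP (lpp h (fun=> h 0) w j i + w i j)
   (lpp h (fun=> h 0) w j i.+1).
  by exists k2; first lia; have := colm k2 j (i.+1 - k2); lia.
exists k1; first lia.
rewrite subSn // lppSS subnKC //.
by move: E1 le_A lt_B; lia.
Qed.

(** The cells where a path collects weight form such a strictly increasing chain, and every chain
    comes from a path. Unlike the recursion, this description does not single out the origin among
    the two corners. *)
Definition is_chain (w : nat -> nat -> bool) (s : seq (nat * nat)) :=
  all (fun c => w c.1 c.2) s &&
  pairwise (fun c d => (c.1 < d.1) && (c.2 < d.2)) s.

Definition chain_in (w : nat -> nat -> bool) (m n : nat) (s : seq (nat * nat)) :=
  is_chain w s && all (fun c => (c.1 < m) && (c.2 < n)) s.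

Notation bulk_lpp := (lpp (fun=> 0) (fun=> 0)).

Lemma size_chain w m n s : chain_in w m n s -> size s <= bulk_lpp w n m.
Proof.
elim/last_ind: s m n => [|s [i j] IH] // m n.
rewrite /chain_in /is_chain all_rcons pairwise_rcons all_rcons /=.
move=> /andP[/andP[/andP[wij ws] /andP[sij sp]] /andP[/andP[im jn] sm]].
have : size s <= bulk_lpp w j i by apply: IH; rewrite /chain_in /is_chain ws sp.
rewrite size_rcons => les.
have : (size s).+1 <= bulk_lpp w j.+1 i.+1 by rewrite lppSS wij; lia.
move=> /leq_trans; apply.
have mono : forall a b a' b', a <= a' -> b <= b' ->
    bulk_lpp w b a <= bulk_lpp w b' a'.
  move=> a b a' b' aa bb; apply: (@leq_trans (bulk_lpp w b a')).
    apply: (@homo_leq _ (fun a => bulk_lpp w b a) leq) => //.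
      by move=> ? ? ?; apply: leq_trans.
    by move=> a0; apply: lpp_leq_row.
  apply: (@homo_leq _ (fun b => bulk_lpp w b a') leq) => //.
    by move=> ? ? ?; apply: leq_trans.
  by move=> b0; apply: lpp_leq_col.
exact: mono.
Qed.

Lemma chain_exists w n m :
  exists2 s, chain_in w m n s & size s = bulk_lpp w n m.
Proof.
elim: n m => [|n IHn] m; first by exists [::].
elim: m => [|m IHm]; first by exists [::].
have widen m1 n1 m2 n2 s : m1 <= m2 -> n1 <= n2 ->
    chain_in w m1 n1 s -> chain_in w m2 n2 s.
  move=> mm nn /andP[cs /allP al]; rewrite /chain_in cs.
  by apply/allP => c /al; lia.
rewrite lppSS; set A := bulk_lpp w n.+1 m; set B := bulk_lpp w n m.+1.
have [leA|ltA] := leqP (maxn B (bulk_lpp w n m + w m n)) A.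
  have [s cs ss] := IHm; exists s; first exact: widen cs.
  by rewrite ss -/A; move: leA; lia.
have [leB|ltB] := leqP (bulk_lpp w n m + w m n) B.
  have [s cs ss] := IHn m.+1; exists s; first exact: widen cs.
  by rewrite ss -/B; move: leB ltA; lia.
have [s cs ss] := IHn m.
(* The diagonal term beats [B], which is already at least [bulk_lpp w n m]; so the cell must carry
   weight. *)
have wmn : w m n.
  have := @lpp_leq_row (fun=> 0) (fun=> 0) w n m (fun=> isT).
  by move: ltB; rewrite /B; case: (w m n) => //; lia.
exists (rcons s (m, n)); last first.
  by rewrite size_rcons ss; move: ltA ltB; rewrite wmn; lia.
move: cs => /andP[/andP[ws sp] sm].
rewrite /chain_in /is_chain all_rcons wmn ws pairwise_rcons sp all_rcons sm /=.
by rewrite !ltnSn /=; apply/allP => c /(allP sm) /=; lia.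
Qed.

(* Last-passage times see chains, and chains can be read backwards. *)
Lemma bulk_lpp_reverse w w' m n :
  (forall i j, i < m -> j < n -> w i j = w' (m.-1 - i) (n.-1 - j)) ->
  bulk_lpp w n m = bulk_lpp w' n m.
Proof.
have key v v' : (forall i j, i < m -> j < n ->
    v i j = v' (m.-1 - i) (n.-1 - j)) -> bulk_lpp v n m <= bulk_lpp v' n m.
  move=> vv'; have [s /andP[/andP[ws sp] sm] <-] := chain_exists v n m.
  pose f (c : nat * nat) := (m.-1 - c.1, n.-1 - c.2).
  rewrite -(size_map f) -size_rev; apply: size_chain.
  rewrite /chain_in /is_chain !all_rev !all_map -map_rev pairwise_map.
  apply/andP; split; last by apply/allP => c /(allP sm) /=; lia.
  apply/andP; split.
    apply/allP => c cs /=; move: (allP sm c cs) (allP ws c cs) => /andP[cm cn].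
    by rewrite vv'.
  move: sp sm {ws}; elim: s => //= c s IH /andP[cs sp] /andP[c1 sm].
  rewrite rev_cons pairwise_rcons IH // andbT all_rev.
  by apply/allP => d ds /=; move: (allP cs d ds) (allP sm d ds) => /=; lia.
move=> ww'; apply/eqP; rewrite eqn_leq !key // => i j im jn.
by rewrite ww' ?subKn //; lia.
Qed.

Local Open Scope ring_scope.

(** * Products of Bernoulli laws *)

Definition upd (I : eqType) (w : I -> bool) (i : I) (b : bool) : I -> bool :=
  fun j => if j == i then b else w j.

Lemma updE (I : eqType) (w : I -> bool) i b j :
  upd w i b j = if j == i then b else w j.
Proof. by []. Qed.

Lemma updC (I : eqType) (w : I -> bool) i j b c : i != j ->
  upd (upd w i b) j c = upd (upd w j c) i b.
Proof.
move=> ij; apply/funext => k; rewrite !updE; case: (eqVneq k j) => // ->.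
by rewrite eq_sym (negbTE ij).
Qed.

Lemma upd_upd (I : eqType) (w : I -> bool) i b c :
  upd (upd w i b) i c = upd w i c.
Proof. by apply/funext => k; rewrite !updE; case: eqP. Qed.

(* Expectation of [f] when the bits [w i], [i] in [s], are resampled as
   independent Bernoulli variables with parameters [q i]. *)
Fixpoint Ex (R : numDomainType) (I : eqType) (q : I -> R) (s : seq I)
    (f : (I -> bool) -> R) (w : I -> bool) : R :=
  if s is i :: s' then
    q i * Ex q s' f (upd w i true) + (1 - q i) * Ex q s' f (upd w i false)
  else f w.

Definition unit_interval_on (R : numDomainType) (I : eqType) (q : I -> R)
  (s : seq I) := forall i, i \in s -> 0 <= q i <= 1.

Section Expectation.
Context (R : realDomainType) (I : eqType).
Implicit Types (q : I -> R) (s : seq I) (f g : (I -> bool) -> R) (w : I -> bool).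

Lemma Ex_cons q i s f w : Ex q (i :: s) f w =
  q i * Ex q s f (upd w i true) + (1 - q i) * Ex q s f (upd w i false).
Proof. by []. Qed.

Lemma Ex_cat q s1 s2 f w : Ex q (s1 ++ s2) f w = Ex q s1 (Ex q s2 f) w.
Proof. by elim: s1 w => //= i s1 IH w; rewrite !IH. Qed.

Lemma le_Ex q s f g w : unit_interval_on q s ->
  (forall w', (forall j, j \notin s -> w' j = w j) -> f w' <= g w') ->
  Ex q s f w <= Ex q s g w.
Proof.
elim: s w => [|i s IH] w qs fg /=; first exact: fg.
have /andP[q0 q1] := qs i (mem_head _ _).
have IH' b : Ex q s f (upd w i b) <= Ex q s g (upd w i b).
  apply: IH => [j js|w' ww']; first by apply: qs; rewrite inE js orbT.
  apply: fg => j; rewrite inE negb_or => /andP[ji js].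
  by rewrite ww' // updE (negbTE ji).
by apply: lerD; apply: ler_wpM2l => //; rewrite subr_ge0.
Qed.

Lemma eq_Ex q s f g w :
  (forall w', (forall j, j \notin s -> w' j = w j) -> f w' = g w') ->
  Ex q s f w = Ex q s g w.
Proof.
elim: s w => [|i s IH] w fg /=; first exact: fg.
have IH' b : Ex q s f (upd w i b) = Ex q s g (upd w i b).
  apply: IH => w' ww'; apply: fg => j; rewrite inE negb_or => /andP[ji js].
  by rewrite ww' // updE (negbTE ji).
by rewrite !IH'.
Qed.

Lemma eq_Ex_param q q' s f w : {in s, q =1 q'} -> Ex q s f w = Ex q' s f w.
Proof.
elim: s w => //= i s IH w qq'; rewrite qq' ?mem_head // !IH //.
- by move=> j js; apply: qq'; rewrite inE js orbT.
- by move=> j js; apply: qq'; rewrite inE js orbT.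
Qed.

Lemma ExD q s f g w : Ex q s (fun w => f w + g w) w = Ex q s f w + Ex q s g w.
Proof. by elim: s w => //= i s IH w; rewrite !IH; ring. Qed.

Lemma ExZ q s c f w : Ex q s (fun w => c * f w) w = c * Ex q s f w.
Proof. by elim: s w => //= i s IH w; rewrite !IH; ring. Qed.

Lemma ExB q s f g w : Ex q s (fun w => f w - g w) w = Ex q s f w - Ex q s g w.
Proof. by elim: s w => //= i s IH w; rewrite !IH; ring. Qed.

Lemma Ex_cst q s c w : Ex q s (fun=> c) w = c.
Proof. by elim: s w => //= i s IH w; rewrite !IH; ring. Qed.

Lemma Ex_ge0 q s f w : unit_interval_on q s -> (forall w, 0 <= f w) ->
  0 <= Ex q s f w.
Proof. by move=> qs f0; rewrite -(Ex_cst q s 0 w); apply: le_Ex. Qed.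

Lemma Ex_comp_upd q s f w i b : i \notin s ->
  Ex q s (fun w => f (upd w i b)) w = Ex q s f (upd w i b).
Proof.
elim: s w => //= j s IH w; rewrite inE negb_or => /andP[ij si].
by rewrite !IH // !(updC _ _ _ ij).
Qed.

Definition blind f i := forall w b, f (upd w i b) = f w.

Lemma Ex_blind_upd q s f w i b : blind f i -> Ex q s f (upd w i b) = Ex q s f w.
Proof.
move=> fi; elim: s w => [|j s IH] w /=; first exact: fi.
have [<-|ij] := eqVneq i j; first by rewrite !upd_upd.
by rewrite !(updC _ _ _ ij) !IH.
Qed.

Lemma Ex_blind1 q i s f w : blind f i -> Ex q (i :: s) f w = Ex q s f w.
Proof. by move=> fi /=; rewrite !Ex_blind_upd //; ring. Qed.

Lemma Ex_blind q s1 s2 f w : (forall i, i \in s1 -> blind f i) ->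
  Ex q (s1 ++ s2) f w = Ex q s2 f w.
Proof.
elim: s1 => // i s IH fb; rewrite cat_cons Ex_blind1; last exact/fb/mem_head.
by apply: IH => j js; apply: fb; rewrite inE js orbT.
Qed.

Lemma Ex_front q i s f w : uniq s -> i \in s ->
  Ex q s f w = Ex q (i :: rem i s) f w.
Proof.
elim: s w => // j s IH w /= /andP[js us]; rewrite inE.
have [->|ij] := eqVneq i j; first by rewrite ?eqxx.
rewrite /= => si.
rewrite !(IH _ us si) /= !(updC _ _ _ ij).
ring.
Qed.

Lemma Ex_perm q s s' f w : uniq s -> perm_eq s s' -> Ex q s f w = Ex q s' f w.
Proof.
elim: s s' w => [|i s IH] s' w us ss'.
  by rewrite perm_sym in ss'; move/perm_nilP: ss' => ->.
have us' : uniq s' by rewrite -(perm_uniq ss').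
have is' : i \in s' by rewrite -(perm_mem ss') mem_head.
have /IH E : perm_eq s (rem i s').
  by rewrite -(perm_cons i); apply: perm_trans ss' _; exact: perm_to_rem.
by rewrite (Ex_front _ _ _ us' is') /= !E //; case/andP: us.
Qed.

Lemma Ex_indep q s1 s2 f g w :
  (forall i, i \in s1 -> blind g i) -> (forall i, i \in s2 -> blind f i) ->
  Ex q (s1 ++ s2) (fun w => f w * g w) w = Ex q s1 f w * Ex q s2 g w.
Proof.
move=> gb fb; rewrite Ex_cat.
have E1 w0 : Ex q s2 (fun w => f w * g w) w0 = f w0 * Ex q s2 g w0.
  elim: s2 fb w0 => // i s2 IH fb w0 /=.
  have fi : blind f i by apply/fb/mem_head.
  rewrite !IH; try by move=> j js; apply: fb; rewrite inE js orbT.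
  by rewrite !fi; ring.
have -> : Ex q s2 (fun w => f w * g w) = (fun w => f w * Ex q s2 g w).
  exact/funext.
move=> {E1 fb}.
elim: s1 gb w => // i s1 IH gb w /=.
have gi : blind g i by apply/gb/mem_head.
rewrite !IH; try by move=> j js; apply: gb; rewrite inE js orbT.
by rewrite !(Ex_blind_upd _ _ _ _ gi); ring.
Qed.

Lemma Ex_support q s0 s f w : uniq s0 -> uniq s -> {subset s0 <= s} ->
  (forall i, i \in s -> i \notin s0 -> blind f i) ->
  Ex q s f w = Ex q s0 f w.
Proof.
move=> us0 us sub fb.
rewrite (@Ex_perm q s ([seq i <- s | i \notin s0] ++ s0)) //.
  by apply: Ex_blind => i; rewrite mem_filter => /andP[is0 si]; apply: fb.
rewrite -(perm_filterC (mem s0) s) perm_catC perm_cat //.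
apply: uniq_perm; rewrite ?filter_uniq // => i.
by rewrite mem_filter inE; case: (boolP (i \in s0)) => // /sub.
Qed.

(** The expectation is affine in each parameter, with slope the mean difference between setting the
    bit to [true] and to [false]. So [f] may increase in some bits and decrease in others. *)
Lemma Ex_monotone q q' s f w :
  unit_interval_on q s -> unit_interval_on q' s ->
  (forall i w, i \in s ->
    0 <= (q' i - q i) * (f (upd w i true) - f (upd w i false))) ->
  Ex q s f w <= Ex q' s f w.
Proof.
elim: s w => //= i s IH w qs qs' qq'.
have sub j : j \in s -> j \in i :: s by move=> js; rewrite inE js orbT.
have /andP[q0 q1] := qs i (mem_head _ _).
have /andP[q'0 q'1] := qs' i (mem_head _ _).
have IH' b : Ex q s f (upd w i b) <= Ex q' s f (upd w i b).
  apply: IH => [j js|j js|j w' js]; [apply: qs|apply: qs'|apply: qq'];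
    exact: sub.
have : 0 <= (q' i - q i) *
    (Ex q' s f (upd w i true) - Ex q' s f (upd w i false)).
  (* If [i] occurs again in [s], its bit is resampled later and the difference vanishes. *)
  have [is_|is_] := boolP (i \in s).
    have E (b : bool) : Ex q' s f (upd w i b) = Ex q' s f w.
      elim: s {IH qs qs' qq' sub IH'} w is_ => //= j s IH w.
      rewrite inE; have [->|ij] := eqVneq i j; first by rewrite !upd_upd.
      by move=> /= is_; rewrite !(updC _ _ _ ij) !IH.
    by rewrite !E subrr mulr0.
  rewrite -!Ex_comp_upd // -ExB -ExZ.
  apply: Ex_ge0 => [j js|w']; first by apply: qs'; apply: sub.
  by apply: qq'; rewrite mem_head.
have := ler_wpM2l q0 (IH' true).
have /ler_wpM2l/(_ _ _ (IH' false)) : 0 <= 1 - q i by rewrite subr_ge0.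
nra.
Qed.

(** Change of measure bit by bit: [q' i] is the parameter after weighting [true] by [tau] and
    normalizing, written without division. *)
Lemma Ex_tilt q q' s f tau w : uniq s ->
  (forall i, i \in s -> q' i * (1 - q i + q i * tau) = q i * tau) ->
  Ex q s (fun w => f w * \prod_(i <- s) (if w i then tau else 1)) w =
  \prod_(i <- s) (1 - q i + q i * tau) * Ex q' s f w.
Proof.
elim: s w => [|i s IH] w; first by rewrite /= !big_nil mulr1 mul1r.
move=> /= /andP[is_ us] qq'.
have E b : Ex q s (fun w => f w * \prod_(j <- i :: s) (if w j then tau else 1))
    (upd w i b) = (if b then tau else 1) *
    (\prod_(i <- s) (1 - q i + q i * tau) * Ex q' s f (upd w i b)).
  rewrite -IH // -?ExZ; last by move=> j js; apply: qq'; rewrite inE js orbT.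
  apply: eq_Ex => w' ww'; rewrite big_cons (ww' _ is_) updE eqxx; ring.
rewrite !E big_cons /=; set P := \prod_(_ <- _) _.
have Q := qq' i (mem_head _ _).
have Q' : (1 - q' i) * (1 - q i + q i * tau) = 1 - q i.
  by rewrite mulrBl Q; ring.
set X := Ex _ _ _ (upd w i true); set Y := Ex _ _ _ (upd w i false).
transitivity (P * (q' i * (1 - q i + q i * tau)) * X +
              P * ((1 - q' i) * (1 - q i + q i * tau)) * Y); last by ring.
by rewrite Q Q'; ring.
Qed.

End Expectation.

Lemma Ex_relabel (R : realDomainType) (I J : eqType) (q : J -> R) (s : seq I)
    (sg : I -> J) (g : (I -> bool) -> R) (w : J -> bool) : injective sg ->
  Ex q (map sg s) (fun w => g (w \o sg)) w = Ex (q \o sg) s g (w \o sg).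
Proof.
move=> inj; elim: s w => //= i s IH w; rewrite !IH.
have E b : upd w (sg i) b \o sg = upd (w \o sg) i b.
  by apply/funext => k; rewrite /= !updE (inj_eq inj).
by rewrite !E.
Qed.

Local Open Scope nat_scope.

(** * The Burke property *)

(* An environment [w] stores the horizontal boundary weights at the sites
   [(i.+1, 0)], the vertical ones at [(0, j.+1)], and the weight of the cell
   with lower left corner [(i, j)] at [(i.+1, j.+1)]. *)
Definition env := (nat * nat -> bool)%type.

Definition hsites m : seq (nat * nat) := [seq (i.+1, 0) | i <- iota 0 m].
Definition vsites n : seq (nat * nat) := [seq (0, j.+1) | j <- iota 0 n].
Definition bsites m n : seq (nat * nat) :=
  [seq (i.+1, j.+1) | i <- iota 0 m, j <- iota 0 n].
Definition sites m n := hsites m ++ (vsites n ++ bsites m n).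

Definition bulk (w : env) (i j : nat) : bool := w (i.+1, j.+1).
Definition hsum (w : env) (i : nat) : nat := \sum_(k < i) w (k.+1, 0).
Definition vsum (w : env) (j : nat) : nat := \sum_(k < j) w (0, k.+1).

Definition lppG (w : env) := bulk_lpp (bulk w).
Definition lppH (w : env) := lpp (hsum w) (fun=> 0) (bulk w).
Definition lppV (w : env) := lpp (fun=> 0) (vsum w) (bulk w).
Definition lppHV (w : env) := lpp (hsum w) (vsum w) (bulk w).

Lemma hsumS w i : hsum w i.+1 = (hsum w i + w (i.+1, 0))%N.
Proof. exact: big_ord_recr. Qed.

Lemma vsumS w j : vsum w j.+1 = (vsum w j + w (0, j.+1))%N.
Proof. exact: big_ord_recr. Qed.

Lemma hsum0 w : hsum w 0 = 0%N. Proof. exact: big_ord0. Qed.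
Lemma vsum0 w : vsum w 0 = 0%N. Proof. exact: big_ord0. Qed.

Lemma leq_hsum w i : (hsum w i <= hsum w i.+1)%N.
Proof. by rewrite hsumS leq_addr. Qed.

Lemma leq_vsum w j : (vsum w j <= vsum w j.+1)%N.
Proof. by rewrite vsumS leq_addr. Qed.

Lemma lppHV_max w n m : lppHV w n m = maxn (lppH w n m) (lppV w n m).
Proof.
rewrite -lpp_max; apply: (@lpp_eq _ _ _ _ _ _ m n) => //= i _.
by rewrite max0n.
Qed.

Lemma mem_hsites m i j : ((i, j) \in hsites m) = (0 < i <= m)%N && (j == 0)%N.
Proof.
apply/mapP/idP => [[k]|/andP[im /eqP->]].
  by rewrite mem_iota => km [-> ->]; lia.
by exists i.-1; rewrite ?mem_iota; [lia | congr pair; lia].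
Qed.

Lemma mem_vsites n i j : ((i, j) \in vsites n) = (0 < j <= n)%N && (i == 0)%N.
Proof.
apply/mapP/idP => [[k]|/andP[im /eqP->]].
  by rewrite mem_iota => km [-> ->]; lia.
by exists j.-1; rewrite ?mem_iota; [lia | congr pair; lia].
Qed.

Lemma mem_bsites m n i j :
  ((i, j) \in bsites m n) = (0 < i <= m)%N && (0 < j <= n)%N.
Proof.
apply/allpairsP/idP => [[[k l] /=]|].
  by rewrite !mem_iota => -[km ln [-> ->]]; lia.
move=> /andP[im jn]; exists (i.-1, j.-1); rewrite /= !mem_iota.
by split; [lia | lia | congr pair; lia].
Qed.

Lemma mem_sites m n i j : ((i, j) \in sites m n) =
  [&& i <= m, j <= n & (0 < i) || (0 < j)]%N.
Proof. by rewrite !mem_cat mem_hsites mem_vsites mem_bsites; lia. Qed.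

Lemma uniq_hsites m : uniq (hsites m).
Proof. by rewrite map_inj_uniq ?iota_uniq // => i j []. Qed.

Lemma uniq_vsites n : uniq (vsites n).
Proof. by rewrite map_inj_uniq ?iota_uniq // => i j []. Qed.

Lemma uniq_bsites m n : uniq (bsites m n).
Proof.
by apply: allpairs_uniq; rewrite ?iota_uniq // => -[i j] [k l] _ _ [-> ->].
Qed.

Lemma uniq_sites m n : uniq (sites m n).
Proof.
rewrite !cat_uniq uniq_hsites uniq_vsites uniq_bsites !andbT /=.
apply/andP; split; apply/hasPn => -[i j].
  by rewrite mem_cat mem_hsites mem_vsites mem_bsites; lia.
by rewrite mem_vsites mem_bsites; lia.
Qed.

Definition param (R : numDomainType) (u v p : R) (c : nat * nat) : R :=
  if c.2 == 0%N then u else if c.1 == 0%N then v else p.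

Lemma unit_interval_param (R : numDomainType) (u v p : R) s :
  (0 <= u <= 1)%R -> (0 <= v <= 1)%R -> (0 <= p <= 1)%R ->
  unit_interval_on (param u v p) s.
Proof. by move=> u01 v01 p01 i _; rewrite /param; case: ifP => //; case: ifP. Qed.

(** The outgoing increments overwrite the incoming ones, so a down-right path advances over the cell
    while staying stored at the axis sites. *)
Definition cell_map (i j : nat) (w : env) : env :=
  upd (upd w (i.+1, 0) (top_inc (w (i.+1, 0)) (w (0, j.+1)) (w (i.+1, j.+1))))
    (0, j.+1) (right_inc (w (i.+1, 0)) (w (0, j.+1)) (w (i.+1, j.+1))).

(* On the curve [u * v = (1 - u) * (1 - v) * p] the outgoing increments of a cell
   have the same law as the incoming ones. *)
Lemma Ex_cell_map (R : realDomainType) (u v p : R) i j s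
    (F : env -> R) (w : env) :
  (u * v = (1 - u) * (1 - v) * p)%R -> uniq s ->
  (i.+1, 0) \in s -> (0, j.+1) \in s -> (i.+1, j.+1) \in s ->
  blind F (i.+1, j.+1) ->
  Ex (param u v p) s (F \o cell_map i j) w = Ex (param u v p) s F w.
Proof.
move=> uv us hs vs bs Fb.
set a := (i.+1, 0) in hs *; set b := (0, j.+1) in vs *.
set c := (i.+1, j.+1) in bs Fb *.
have [ab ac bc] : [/\ a != b, a != c & b != c] by split; apply/eqP => -[].
pose s' := rem c (rem b (rem a s)).
have us1 : uniq (rem a s) by exact: rem_uniq.
have us2 : uniq (rem b (rem a s)) by exact: rem_uniq.
have bs1 : b \in rem a s by rewrite mem_rem_uniq // inE eq_sym ab.
have cs1 : c \in rem a s by rewrite mem_rem_uniq // inE eq_sym ac.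
have cs2 : c \in rem b (rem a s).
  by rewrite mem_rem_uniq // inE eq_sym bc.
have front G : Ex (param u v p) s G w = Ex (param u v p) [:: a, b, c & s'] G w.
  by rewrite (Ex_front _ _ _ us hs) /= !(Ex_front _ _ _ us1 bs1) /=
     !(Ex_front _ _ _ us2 cs2).
have cs' : c \notin s' by rewrite mem_rem_uniqF.
have bs' : b \notin s' by apply: contraFN (mem_rem_uniqF b us1) => /mem_rem.
have as' : a \notin s'.
  by apply: contraFN (mem_rem_uniqF a us) => /mem_rem /mem_rem.
have step (I J B : bool) :
    Ex (param u v p) s' (F \o cell_map i j) (upd (upd (upd w a I) b J) c B) =
    Ex (param u v p) s' F (upd (upd w a (top_inc I J B)) b (right_inc I J B)).
  transitivity (Ex (param u v p) s' (fun w =>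
     F (upd (upd w a (top_inc I J B)) b (right_inc I J B)))
       (upd (upd (upd w a I) b J) c B)).
    apply: eq_Ex => w' ww' /=; rewrite /cell_map -/a -/b -/c.
    rewrite !ww' // !updE !eqxx [b == c](negbTE bc) [a == c](negbTE ac).
    by rewrite [a == b](negbTE ab).
  rewrite (Ex_comp_upd _ (fun w => F (upd w b (right_inc I J B)))) //.
  rewrite (Ex_comp_upd _ F) // [upd (upd _ c _) a _]updC 1?eq_sym //.
  rewrite [upd (upd _ c _) b _]updC 1?eq_sym // Ex_blind_upd //.
  by rewrite [upd (upd _ b _) a _]updC 1?eq_sym // !upd_upd.
rewrite !front /= !step /top_inc /right_inc /= !(Ex_blind_upd _ _ _ _ Fb).
rewrite /param /=.
set X11 := Ex _ _ _ (upd (upd w a true) b true).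
set X10 := Ex _ _ _ (upd (upd w a true) b false).
set X01 := Ex _ _ _ (upd (upd w a false) b true).
set X00 := Ex _ _ _ (upd (upd w a false) b false).
(* Increments [(1,0)] and [(0,1)] are preserved, [(1,1)] becomes [(0,0)], and [(0,0)] becomes
   [(1,1)] exactly when the cell has weight. The law is kept because the masses of these two
   exchanges agree. *)
transitivity ((1 - u) * (1 - v) * p * (X11 - X00) +
   u * (1 - v) * X10 + (1 - u) * v * X01 + (1 - u) * (1 - v) * X00
   + u * v * X00)%R; first by ring.
by rewrite -uv; ring.
Qed.

Fixpoint row_map (j i : nat) (w : env) : env :=
  if i is i'.+1 then cell_map i' j (row_map j i' w) else w.

(* After [sweep m n] the sites [(i.+1, 0)], [i < m], store the horizontal
   increments along the top, and [(0, j.+1)], [j < n], the vertical increments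
   along the right side of the [m] by [n] rectangle. *)
Fixpoint sweep (m n : nat) (w : env) : env :=
  if n is n'.+1 then row_map n' m (sweep m n' w) else w.

(** The induction peels off the last cell: composing with its map makes [F] depend on that weight,
    but leaves it blind to the cells swept earlier. *)
Lemma Ex_sweep (R : realDomainType) (u v p : R) m n s (F : env -> R) w :
  (u * v = (1 - u) * (1 - v) * p)%R -> uniq s -> {subset sites m n <= s} ->
  (forall c, c \in bsites m n -> blind F c) ->
  Ex (param u v p) s (F \o sweep m n) w = Ex (param u v p) s F w.
Proof.
move=> uv us sub Fb.
have cell_blind i j (G : env -> R) c : (0 < c.1)%N -> (0 < c.2)%N ->
    blind G c -> c != (i.+1, j.+1) -> blind (G \o cell_map i j) c.
  move=> c1 c2 Gc cij w' b /=; rewrite -[RHS](Gc _ b); congr G.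
  have ch : c != (i.+1, 0) by apply: contraTneq c2 => ->.
  have cv : c != (0, j.+1) by apply: contraTneq c1 => ->.
  rewrite /cell_map !updE ![_ == c]eq_sym (negbTE ch) (negbTE cv) (negbTE cij).
  by rewrite (updC _ _ _ ch) (updC _ _ _ cv).
have row_blind i j (G : env -> R) c : (0 < c.1)%N -> (0 < c.2)%N ->
    c.2 != j.+1 -> blind G c -> blind (G \o row_map j i) c.
  move=> c1 c2 cj; elim: i G => [|i IH] G Gc //=.
  apply: (IH (G \o cell_map i j)); apply: cell_blind => //.
  by apply: contraNneq cj => ->.
have row i j (G : env -> R) : (j < n)%N -> (i <= m)%N ->
   (forall k, (k < i)%N -> blind G (k.+1, j.+1)) ->
   Ex (param u v p) s (G \o row_map j i) w = Ex (param u v p) s G w.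
  move=> jn; elim: i G => [|i IH] G im Gb //.
  rewrite (IH (G \o cell_map i j)); last 2 first.
  - exact: ltnW.
  - move=> k ki; apply: cell_blind => //; first by apply: Gb; lia.
    by apply/eqP => -[]; lia.
  by apply: Ex_cell_map => //; try apply: sub; rewrite ?mem_sites; [lia..|exact: Gb].
elim: n F sub Fb row => [|n IH] F sub Fb row //.
rewrite (IH (F \o row_map n m)).
- by apply: row => // k km; apply: Fb; rewrite mem_bsites; lia.
- by move=> [i j] ij; apply: sub; move: ij; rewrite !mem_sites; lia.
- move=> [i j]; rewrite mem_bsites => ij; apply: row_blind => /=; try lia.
  by apply: Fb; rewrite mem_bsites; lia.
- by move=> i j G jn; apply: row; lia.
Qed.

Lemma sweep_spec w m n : let w' := sweep m n w in
  [/\ forall i j, (m <= i)%N -> w' (i.+1, j) = w (i.+1, j),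
      forall i j, w' (i.+1, j.+1) = w (i.+1, j.+1),
      forall j, (n <= j)%N -> w' (0, j.+1) = w (0, j.+1),
      forall i, (i < m)%N ->
        lppHV w n i.+1 = (lppHV w n i + w' (i.+1, 0))%N &
      forall j, (j < n)%N ->
        lppHV w j.+1 m = (lppHV w j m + w' (0, j.+1))%N].
Proof.
elim: n => [|n [A B C D E]].
  by split => // i im; rewrite /lppHV /= hsumS.
set w1 := sweep m n w in A B C D E.
have row i : (i <= m)%N -> let w' := row_map n i w1 in
  [/\ forall k j, (i <= k)%N -> w' (k.+1, j) = w1 (k.+1, j),
      forall k j, w' (k.+1, j.+1) = w1 (k.+1, j.+1),
      forall j, j != n -> w' (0, j.+1) = w1 (0, j.+1),
      forall k, (k < i)%N ->
        lppHV w n.+1 k.+1 = (lppHV w n.+1 k + w' (k.+1, 0))%N &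
      lppHV w n.+1 i = (lppHV w n i + w' (0, n.+1))%N].
  elim: i => [|i IH] im.
    split => //=; rewrite C // /lppHV lppS0 vsumS.
    by case: (n) => [|n'] //=; rewrite vsum0 hsum0.
  have [A' B' C' D' E'] := IH (ltnW im).
  set w2 := row_map n i w1 in A' B' C' D' E'.
  have Hi : lppHV w n i.+1 = (lppHV w n i + w2 (i.+1, 0))%N.
    by rewrite A' // D.
  have [T1 T2] := lpp_cell Hi E'.
  have w2b : bulk w i n = w2 (i.+1, n.+1) by rewrite B' B.
  rewrite /= -/w2 /cell_map; split.
  - move=> k j ik; rewrite -A'; last lia.
    by rewrite !updE !xpair_eqE /= ifF //; lia.
  - by move=> k j; rewrite -B' !updE !xpair_eqE /= andbF.
  - by move=> j jn; rewrite -C' // !updE !xpair_eqE /= eqSS (negbTE jn).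
  - move=> k ki; rewrite !updE !xpair_eqE /= andbT eqSS.
    have [->|ki'] := eqVneq k i; first by rewrite -w2b.
    by apply: D'; lia.
  - by rewrite updE eqxx -w2b.
have [A' B' C' D' E'] := row m (leqnn m).
split => //=.
- by move=> i j mi; rewrite A' // A.
- by move=> i j; rewrite B' B.
- by move=> j nj; rewrite C' ?C //; lia.
- move=> j; rewrite ltnS leq_eqVlt => /predU1P[->//|jn].
  by rewrite C' ?E //; lia.
Qed.

Lemma lppHV_top w m n k : (k <= m)%N ->
  lppHV w n m = (lppHV w n (m - k) +
    \sum_(i < k) sweep m n w ((m - i.+1).+1, 0))%N.
Proof.
have [_ _ _ D _] := sweep_spec w m n.
elim: k => [|k IH] km; first by rewrite big_ord0 subn0 addn0.
rewrite IH ?(ltnW km) // big_ord_recr /= addnCA addnA.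
have -> : (m - k = (m - k.+1).+1)%N by lia.
rewrite D; lia.
Qed.

Lemma lppHV_vsum_top w m n :
  lppHV w n m = (vsum w n + hsum (sweep m n w) m)%N.
Proof.
have [_ _ _ D _] := sweep_spec w m n.
have -> : vsum w n = lppHV w n 0.
  by case: n {D} => [|n]; rewrite /lppHV ?lppS0 //= hsum0 vsum0.
have : forall i, (i <= m)%N ->
    lppHV w n i = (lppHV w n 0 + hsum (sweep m n w) i)%N.
  elim=> [|i IH] im; first by rewrite hsum0 addn0.
  by rewrite D // IH ?hsumS ?addnA //; lia.
exact.
Qed.

Local Open Scope ring_scope.

(** * Probabilities and exponential moments in the stationary model *)

Definition Pr (R : numDomainType) (I : eqType) (q : I -> R) (s : seq I)
  (A : (I -> bool) -> bool) (w : I -> bool) : R := Ex q s (fun w => (A w)%:R) w.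

Section Probability.
Context (R : realDomainType) (I : eqType) (q : I -> R) (s : seq I).
Hypothesis q01 : unit_interval_on q s.
Implicit Types (A B : (I -> bool) -> bool) (w : I -> bool).

Lemma Pr_ge0 A w : 0 <= Pr q s A w.
Proof. by apply: Ex_ge0 => // w'; rewrite ler0n. Qed.

Lemma Pr_le1 A w : Pr q s A w <= 1.
Proof.
rewrite -[leRHS](Ex_cst q s 1 w); apply: le_Ex => // w' _.
by case: (A w').
Qed.

Lemma le_Pr A B w : (forall w, A w -> B w) -> Pr q s A w <= Pr q s B w.
Proof.
move=> AB; apply: le_Ex => // w' _.
by case: (boolP (A w')) => [/AB ->|_] //; rewrite ler0n.
Qed.

Lemma Pr_union A B C w : (forall w, A w -> B w || C w) ->
  Pr q s A w <= Pr q s B w + Pr q s C w.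
Proof.
move=> ABC; rewrite -ExD; apply: le_Ex => // w' _; rewrite -natrD ler_nat.
by have := ABC w'; case: (A w') (B w') (C w') => [[] []|[] []] //= /(_ isT).
Qed.

End Probability.

Lemma prod_hsites (R : numDomainType) (t : R) (w : env) m :
  \prod_(c <- hsites m) (if w c then t else 1) = t ^+ hsum w m.
Proof.
have -> : hsites m = [seq (i.+1, 0%N) | i <- index_iota 0 m].
  by rewrite /index_iota subn0.
rewrite big_map big_mkord /hsum expr_sum.
by apply: eq_bigr => i _; case: (w _); rewrite ?expr1 ?expr0.
Qed.

Lemma prod_vsites (R : numDomainType) (t : R) (w : env) n :
  \prod_(c <- vsites n) (if w c then t else 1) = t ^+ vsum w n.
Proof.
have -> : vsites n = [seq (0%N, i.+1) | i <- index_iota 0 n].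
  by rewrite /index_iota subn0.
rewrite big_map big_mkord /vsum expr_sum.
by apply: eq_bigr => i _; case: (w _); rewrite ?expr1 ?expr0.
Qed.

Lemma hsum_upd (w : env) c b m : c \notin hsites m ->
  hsum (upd w c b) m = hsum w m.
Proof.
move=> cm; apply: eq_bigr => i _; rewrite updE ifF //.
apply: contraNF cm => /eqP <-; rewrite mem_hsites; have := ltn_ord i; lia.
Qed.

Lemma vsum_upd (w : env) c b n : c \notin vsites n ->
  vsum (upd w c b) n = vsum w n.
Proof.
move=> cn; apply: eq_bigr => i _; rewrite updE ifF //.
apply: contraNF cn => /eqP <-; rewrite mem_vsites; have := ltn_ord i; lia.
Qed.

Lemma bulk_upd (w : env) c b i j : c != (i.+1, j.+1) ->
  bulk (upd w c b) i j = bulk w i j.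
Proof. by rewrite /bulk updE eq_sym => /negbTE ->. Qed.

Lemma lppH_upd (w : env) c b n m : c.1 = 0%N ->
  lppH (upd w c b) n m = lppH w n m.
Proof.
by case: c => c1 c2 /= ->; apply: (@lpp_eq _ _ _ _ _ _ m n).
Qed.

Lemma lppV_upd (w : env) c b n m : c.2 = 0%N ->
  lppV (upd w c b) n m = lppV w n m.
Proof.
case: c => c1 c2 /= ->; apply: (@lpp_eq _ _ _ _ _ _ m n) => // [i _|i j _ _].
  by apply: vsum_upd; rewrite mem_vsites.
by apply: bulk_upd; apply/eqP => -[].
Qed.

Lemma lppG_upd (w : env) c b n m : (c.1 == 0%N) || (c.2 == 0%N) ->
  lppG (upd w c b) n m = lppG w n m.
Proof.
case: c => c1 c2 /= c0; apply: (@lpp_eq _ _ _ _ _ _ m n) => // i j _ _.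
by apply: bulk_upd; apply/eqP => -[E1 E2]; move: c0; rewrite E1 E2.
Qed.

Lemma mgf_gt0 (R : realFieldType) (a t : R) : 0 <= a <= 1 -> 0 < t ->
  0 < 1 - a + a * t.
Proof.
case/andP=> a0 a1 t0; have [->|an1] := eqVneq a 1; first by rewrite subrr add0r mul1r.
by apply: ltr_pwDl; [rewrite subr_gt0 lt_neqAle an1|rewrite mulr_ge0 // ltW].
Qed.

Lemma Ex_prod (R : realFieldType) (I : eqType) (q : I -> R) (s : seq I) t w :
  unit_interval_on q s -> uniq s -> 0 < t ->
  Ex q s (fun w => \prod_(i <- s) (if w i then t else 1)) w =
  \prod_(i <- s) (1 - q i + q i * t).
Proof.
move=> q01 us t0; rewrite -[RHS]mulr1.
rewrite -[X in _ * X](Ex_cst (fun i => q i * t / (1 - q i + q i * t)) s 1 w).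
rewrite -Ex_tilt //; first by apply: eq_Ex => w' _; rewrite mul1r.
move=> i si; have := mgf_gt0 (q01 i si) t0; set d := _ + _ * t => d0.
by rewrite mulfVK // gt_eqF.
Qed.

Lemma prod_param_h (R : numDomainType) (u v p : R) (f : R -> R) m :
  \prod_(c <- hsites m) f (param u v p c) = f u ^+ m.
Proof.
rewrite big_map (eq_bigr (fun=> f u)) // big_const_seq count_predT size_iota.
by rewrite iter_mulr_1.
Qed.

Lemma prod_param_v (R : numDomainType) (u v p : R) (f : R -> R) n :
  \prod_(c <- vsites n) f (param u v p c) = f v ^+ n.
Proof.
rewrite big_map (eq_bigr (fun=> f v)) // big_const_seq count_predT size_iota.
by rewrite iter_mulr_1.
Qed.

Lemma perm_sites_v m n : perm_eq (sites m n) (vsites n ++ (hsites m ++ bsites m n)).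
Proof. by rewrite /sites perm_catCA. Qed.

Section Stationary.
Context (R : realFieldType) (u v p : R) (m n : nat).
Hypotheses (u01 : 0 <= u <= 1) (v01 : 0 <= v <= 1) (p01 : 0 <= p <= 1).
Let q := param u v p.

Let q01 s : unit_interval_on q s. Proof. exact: unit_interval_param. Qed.

Lemma Ex_hsum t w : 0 < t ->
  Ex q (sites m n) (fun w => t ^+ hsum w m) w = (1 - u + u * t) ^+ m.
Proof.
move=> t0; rewrite (Ex_perm _ _ _ (uniq_sites m n) (permEl (perm_catC _ _))).
rewrite Ex_blind; last first.
  move=> [i j] ij w' b; rewrite hsum_upd // mem_hsites.
  by move: ij; rewrite mem_cat mem_vsites mem_bsites; lia.
under [X in Ex _ _ X]funext => w' do rewrite -prod_hsites.
by rewrite Ex_prod ?uniq_hsites // (prod_param_h u v p (fun a => 1 - a + a * t)).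
Qed.

Lemma Ex_vsum t w : 0 < t ->
  Ex q (vsites n) (fun w => t ^+ vsum w n) w = (1 - v + v * t) ^+ n.
Proof.
move=> t0; under [X in Ex _ _ X]funext => w' do rewrite -prod_vsites.
by rewrite Ex_prod ?uniq_vsites // (prod_param_v u v p (fun a => 1 - a + a * t)).
Qed.

Hypothesis uv : u * v = (1 - u) * (1 - v) * p.

(** Going up the left side and along the top, [lppHV] minus [vsum] is the sum of the top increments,
    which by the Burke property are independent of parameter [u]. The two parts are correlated, so
    this alone does not give the moments of [lppHV]. *)
Lemma Ex_lppHV_vsum t w : 0 < t ->
  Ex q (sites m n) (fun w => t ^+ lppHV w n m * t^-1 ^+ vsum w n) w =
  (1 - u + u * t) ^+ m.
Proof.
move=> t0; rewrite -(Ex_hsum w t0).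
rewrite -(@Ex_sweep _ u v p m n _ (fun w => t ^+ hsum w m)) ?uniq_sites //.
  apply: eq_Ex => w' _ /=; rewrite lppHV_vsum_top exprD mulrAC -exprMn.
  by rewrite divff ?gt_eqF // expr1n mul1r.
move=> [i j]; rewrite mem_bsites => ij w' b.
by rewrite hsum_upd // mem_hsites; lia.
Qed.

(** As [lppH] does not see the vertical boundary, it is independent of [vsum]; the product of the
    two expectations is one expectation, in which [lppH] is bounded by [lppHV]. *)
Lemma Ex_lppH_le t w : 1 <= t ->
  Ex q (sites m n) (fun w => t ^+ lppH w n m) w * (1 - v + v * t^-1) ^+ n
  <= (1 - u + u * t) ^+ m.
Proof.
move=> t1; have t0 : 0 < t by apply: lt_le_trans t1.
rewrite -(Ex_lppHV_vsum w t0) -(@Ex_vsum _ w) ?invr_gt0 //.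
have us := uniq_sites m n.
rewrite 2!(Ex_perm _ _ _ us (perm_sites_v m n)).
rewrite Ex_blind; last first.
  move=> [i j]; rewrite mem_vsites => ij w' b.
  by rewrite lppH_upd //=; lia.
rewrite mulrC -Ex_indep.
- apply: le_Ex => // w' _; rewrite mulrC ler_wpM2r ?exprn_ge0 ?invr_ge0 ?(ltW t0) //.
  by apply: ler_weXn2l => //; rewrite lppHV_max leq_maxl.
- move=> [i j]; rewrite mem_vsites => ij w' b.
  by rewrite lppH_upd //=; lia.
- move=> [i j] ij w' b; rewrite vsum_upd // mem_vsites.
  by move: ij; rewrite mem_cat mem_hsites mem_bsites; lia.
Qed.

(* Raising the vertical parameter to [v'] is an exponential tilt by the
   vertical boundary weights, which turns [lppHV] into the sum of the
   increments along the top. *)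
Lemma Ex_lppHV_tilt v' t w : 0 < t -> v' * (1 - v + v * t) = v * t ->
  Ex (param u v' p) (sites m n) (fun w => t^-1 ^+ lppHV w n m) w *
    (1 - v + v * t) ^+ n = (1 - u + u * t^-1) ^+ m.
Proof.
move=> t0 vv'; rewrite -(Ex_lppHV_vsum w (t := t^-1)) ?invr_gt0 // invrK.
have us := uniq_sites m n.
rewrite 2!(Ex_perm _ _ _ us (perm_sites_v m n)) !Ex_cat.
rewrite -(prod_param_v u v p (fun a => 1 - a + a * t)) mulrC -Ex_tilt.
- apply: eq_Ex => w' _; rewrite prod_vsites mulrC.
  rewrite (@eq_Ex_param _ _ _ q); last first.
    move=> [i j]; rewrite mem_cat mem_hsites mem_bsites /q /param /= => ij.
    by case: i j ij => [|i] [|j].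
  rewrite -ExZ; apply: eq_Ex => w2 ww2; rewrite mulrC; congr (_ * _ ^+ _).
  apply: eq_bigr => k _; rewrite ww2 // mem_cat mem_hsites mem_bsites; lia.
- exact: uniq_vsites.
- by move=> [i [|j]]; rewrite mem_vsites /q /param // => /andP[_ /= ->].
Qed.

End Stationary.

(** * Monotonicity and exit points *)

Lemma hsum_monotone (w : env) c i :
  (hsum (upd w c false) i <= hsum (upd w c true) i)%N.
Proof. by apply: leq_sum => k _; rewrite !updE; case: eqP. Qed.

Lemma vsum_monotone (w : env) c j :
  (vsum (upd w c false) j <= vsum (upd w c true) j)%N.
Proof. by apply: leq_sum => k _; rewrite !updE; case: eqP. Qed.

Lemma bulk_upd_axis (w : env) c b : (c.1 == 0)%N || (c.2 == 0)%N ->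
  bulk (upd w c b) = bulk w.
Proof.
move=> c0; apply/funext => i; apply/funext => j; apply: bulk_upd.
by apply: contraTneq c0 => ->.
Qed.

(** The choice [l = P / X] turns a family of linear bounds into Cauchy-Schwarz. *)
Lemma le_of_amgm (R : realFieldType) (P X Y : R) : 0 <= P -> 0 < X -> 0 <= Y ->
  (forall l, 0 < l -> 2 * P <= l * X + l^-1 * Y) -> P ^+ 2 <= X * Y.
Proof.
move=> P0 X0 Y0 H; have [->|Pn0] := eqVneq P 0.
  by rewrite expr0n /= mulr_ge0 // ltW.
have Pp : 0 < P by rewrite lt_neqAle eq_sym Pn0.
have /H := divr_gt0 Pp X0; rewrite divfK ?gt_eqF // invf_div => le_P.
rewrite expr2 -ler_pdivlMr //.
have -> : X * Y / P = X / P * Y by ring.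
lra.
Qed.

(* The event is [lppHV = lppH], where the geometric mean of [t^-1 ^+ lppHV] and
   [t ^+ lppH] equals [1]; the second factor does not depend on the vertical
   boundary. *)
Lemma exit_bound (R : realFieldType) (u u' v v' p t : R) m n (w : env) :
  0 <= u <= 1 -> 0 <= u' <= u -> 0 <= v <= 1 -> 0 <= v' <= 1 -> 0 <= p <= 1 ->
  1 <= t -> u * v = (1 - u) * (1 - v) * p -> v' * (1 - v + v * t) = v * t ->
  Pr (param u' v' p) (sites m n) (fun w => (lppHV w n m <= lppH w n m)%N) w ^+ 2
    * ((1 - v + v * t) * (1 - v + v * t^-1)) ^+ n
  <= ((1 - u + u * t) * (1 - u + u * t^-1)) ^+ m.
Proof.
move=> u01 /andP[u'0 u'u] v01 v'01 p01 t1 uv vv'.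
have t0 : 0 < t by apply: lt_le_trans t1.
have u'01 : 0 <= u' <= 1.
  by rewrite u'0 (le_trans u'u) //; case/andP: u01.
pose A (w : env) := (lppHV w n m <= lppH w n m)%N.
have qs q1 q2 s : 0 <= q1 <= 1 -> 0 <= q2 <= 1 ->
    unit_interval_on (param q1 q2 p) s by move=> *; apply: unit_interval_param.
(* The event says [lppV <= lppH]; horizontal weights raise [lppH] and leave [lppV] alone. *)
have le_P : Pr (param u' v' p) (sites m n) A w <=
            Pr (param u v' p) (sites m n) A w.
  apply: Ex_monotone; try exact: qs.
  move=> [i j] w' _; rewrite /param /=.
  have [->|j0] := eqVneq j 0%N; last by rewrite subrr mul0r.
  apply: mulr_ge0; first by rewrite subr_ge0.
  rewrite subr_ge0 ler_nat /A !lppHV_max !geq_max !leqnn /= !lppV_upd //.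
  have imp (a b : bool) : (a -> b) -> (a <= b)%N by case: a b => [] [] //= /(_ isT).
  apply: imp => /leq_trans; apply.
  rewrite /lppH !bulk_upd_axis ?orbT //.
  by apply: leq_lpp => // k; apply: hsum_monotone.
pose X := Ex (param u v' p) (sites m n) (fun w => t^-1 ^+ lppHV w n m) w.
pose Y := Ex (param u v' p) (sites m n) (fun w => t ^+ lppH w n m) w.
have EX : X * (1 - v + v * t) ^+ n = (1 - u + u * t^-1) ^+ m.
  exact: Ex_lppHV_tilt.
have EY : Y * (1 - v + v * t^-1) ^+ n <= (1 - u + u * t) ^+ m.
  suff -> : Y = Ex (param u v p) (sites m n) (fun w => t ^+ lppH w n m) w.
    exact: Ex_lppH_le.
  rewrite /Y !(Ex_perm _ _ _ (uniq_sites m n) (perm_sites_v m n)).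
  have blH c : c \in vsites n -> blind (fun w => t ^+ lppH w n m) c.
    by case: c => i j; rewrite mem_vsites => /andP[_ /eqP->] w' b; rewrite lppH_upd.
  rewrite [LHS]Ex_blind // [RHS]Ex_blind //; apply: eq_Ex_param => -[i j]; rewrite mem_cat mem_hsites mem_bsites.
  by case: i j => [|i] [|j].
have v1 := mgf_gt0 v01 t0; have tV0 : 0 < t^-1 by rewrite invr_gt0.
have v2 := mgf_gt0 v01 tV0.
have u1 := mgf_gt0 u01 t0; have u2 := mgf_gt0 u01 tV0.
have P0 : 0 <= Pr (param u v' p) (sites m n) A w by apply/Pr_ge0/qs.
have PXY : Pr (param u v' p) (sites m n) A w ^+ 2 <= X * Y.
  apply: le_of_amgm => //.
  - by rewrite -(pmulr_lgt0 _ (exprn_gt0 n v1)) EX exprn_gt0.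
  - by apply: Ex_ge0 => [|w']; [apply: qs|rewrite exprn_ge0 // ltW].
  move=> l l0; rewrite /Pr -!ExZ -ExD; apply: le_Ex; first exact: qs.
  move=> w' _; case: (boolP (A w')); last first.
    move=> _; rewrite mulr0 addr_ge0 // mulr_ge0 ?exprn_ge0 ?invr_ge0 ?ltW //.
  rewrite /A => le_HV; have -> : lppHV w' n m = lppH w' n m.
    by apply/eqP; rewrite eqn_leq le_HV lppHV_max leq_maxl.
  have Z0 := exprn_gt0 (lppH w' n m) t0.
  rewrite exprVn mulr1; set Z := t ^+ _ in Z0 *.
  suff : 0 <= l * Z^-1 + l^-1 * Z - 2 by rewrite subr_ge0.
  have -> : l * Z^-1 + l^-1 * Z - 2 = (l - Z) ^+ 2 / (l * Z).
    by field; rewrite !gt_eqF.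
  by rewrite divr_ge0 ?sqr_ge0 // mulr_ge0 ?ltW.
apply: (@le_trans _ _ ((X * (1 - v + v * t) ^+ n) *
                       (Y * (1 - v + v * t^-1) ^+ n))).
  rewrite [leRHS]mulrACA -exprMn; apply: ler_wpM2r => //.
    by apply: exprn_ge0; rewrite ltW // mulr_gt0.
  by apply: le_trans PXY; rewrite !expr2 ler_pM //; apply/Pr_ge0/qs.
rewrite EX mulrC exprMn; apply: ler_wpM2r => //.
by apply: exprn_ge0; rewrite ltW.
Qed.

(** Sites on the vertical axis stay fixed: after [sweep z n] they hold the increments along column
    [z], which becomes the new axis. *)
Definition shift_site (z : nat) (c : nat * nat) : nat * nat :=
  if c.1 is i.+1 then ((z + i).+1, c.2)%N else c.

Lemma shift_site_inj z : injective (shift_site z).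
Proof. by move=> [[|i] j] [[|k] l] //= [] // /addnI -> ->. Qed.

(* The path leaves the horizontal axis to the right of [z]. *)
Definition exit_after (z n m : nat) (w : env) : bool :=
  (lppHV w n m <= hsum w z + lppH (w \o shift_site z) n (m - z))%N.

Lemma hsum_shift w z i :
  hsum w (z + i) = (hsum w z + hsum (w \o shift_site z) i)%N.
Proof.
elim: i => [|i IH]; first by rewrite addn0 hsum0 addn0.
by rewrite addnS !hsumS IH addnA.
Qed.

(* Seen from the column [z] the increments along this column are again a
   stationary vertical boundary. *)
Lemma Pr_exit_after (R : realFieldType) (u v p : R) z m n (w : env) :
  0 <= u <= 1 -> 0 <= v <= 1 -> 0 <= p <= 1 ->
  u * v = (1 - u) * (1 - v) * p -> (z <= m)%N ->
  Pr (param u v p) (sites m n) (exit_after z n m) w =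
  Pr (param u v p) (sites (m - z) n)
    (fun w => (lppHV w n (m - z) <= lppH w n (m - z))%N) (w \o shift_site z).
Proof.
move=> u01 v01 p01 uv zm.
pose F (w : env) : R := ((lppHV w n (m - z) <= lppH w n (m - z))%N)%:R.
have blindF c : c \in hsites z ++ bsites z n ->
    blind (fun w => F (w \o shift_site z)) c.
  move=> cz w' b; rewrite (_ : upd w' c b \o shift_site z = w' \o shift_site z) //.
  apply/funext => -[i j] /=; rewrite updE ifF //; apply: contraTF cz => /eqP <-.
  by case: i => [|i] /=; rewrite mem_cat mem_hsites mem_bsites; lia.
transitivity (Ex (param u v p) (sites m n)
   ((fun w => F (w \o shift_site z)) \o sweep z n) w).
  apply: eq_Ex => w' _ /=; rewrite /exit_after /F; congr (nat_of_bool _)%:R.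
  have [A B _ _ E] := sweep_spec w' z n.
  set w1 := sweep z n w' in A B E.
  have Ehs : hsum (w1 \o shift_site z) =1 hsum (w' \o shift_site z).
    by move=> i; apply: eq_bigr => k _ /=; rewrite A // leq_addr.
  have Ebulk i j : bulk (w1 \o shift_site z) i j = bulk w' (z + i) j.
    exact: B.
  have Ecol j : (j <= n)%N -> lppHV w' j z = (hsum w' z + vsum w1 j)%N.
    elim: j => [|j IH] jn; first by rewrite vsum0 addn0.
    by rewrite E // IH ?vsumS ?addnA // ltnW.
  have EL : lppHV w' n m = (hsum w' z + lppHV (w1 \o shift_site z) n (m - z))%N.
    rewrite -{1}(subnKC zm) /lppHV lpp_shift -lpp_add.
    apply: (@lpp_eq _ _ _ _ _ _ (m - z) n) => // i _.
    by rewrite hsum_shift Ehs.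
  rewrite EL leq_add2l; congr (_ <= _)%N.
  by apply: (@lpp_eq _ _ _ _ _ _ (m - z) n) => // i _; rewrite Ehs.
rewrite Ex_sweep ?uniq_sites //; last 2 first.
- by move=> [i j]; rewrite !mem_sites; lia.
- by move=> c cz; apply: blindF; rewrite mem_cat cz orbT.
rewrite (@Ex_support _ _ _ [seq shift_site z c | c <- sites (m - z) n]).
- rewrite Ex_relabel; last exact: shift_site_inj.
  by apply: eq_Ex_param => -[[|i] j].
- by rewrite map_inj_uniq ?uniq_sites //; apply: shift_site_inj.
- exact: uniq_sites.
- move=> [i j] /mapP[[k l]]; rewrite mem_sites => kl ->.
  by case: k kl => [|k] kl; rewrite /shift_site /= mem_sites; lia.
- move=> [i j] ij ij'; apply: blindF.
  rewrite mem_sites in ij; rewrite mem_cat mem_hsites mem_bsites.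
  suff : ~~ ((z < i)%N || (i == 0)%N && (0 < j <= n)%N) by lia.
  apply: contra ij' => ij'; apply/mapP.
  exists (if i is 0%N then 0%N else i - z, j)%N; last first.
    case: (i) ij' => [|i'] ij' //=; rewrite subSn; last by lia.
    by rewrite /shift_site /=; congr pair; lia.
  by move: ij ij'; rewrite mem_sites; case: (i) => [|i']; lia.
Qed.

(* Some partial sum [\sum (w i - a)] over a prefix of [s], multiplied by
   [th], reaches [y]. *)
Fixpoint crosses (R : realDomainType) (I : eqType) (th a : R) (s : seq I)
    (y : R) (w : I -> bool) : bool :=
  (y <= 0) ||
  if s is i :: s' then crosses th a s' (y - th * ((w i)%:R - a)) w else false.

Lemma crosses_upd (R : realDomainType) (I : eqType) (th a : R) (s : seq I) y (w : I -> bool) i b :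
  i \notin s -> crosses th a s y (upd w i b) = crosses th a s y w.
Proof.
elim: s y => //= j s IH y; rewrite inE negb_or => /andP[ij si].
by rewrite IH // updE eq_sym (negbTE ij).
Qed.

Lemma crossesP (R : realDomainType) (I : eqType) (th a : R) (s : seq I) y (w : I -> bool) k :
  (k <= size s)%N ->
  y <= th * ((\sum_(i <- take k s) w i)%N%:R - k%:R * a) -> crosses th a s y w.
Proof.
elim: s k y => [|i s IH] [|k] y //=.
- by rewrite big_nil mul0r subrr mulr0 => _ ->.
- by rewrite big_nil mul0r subrr mulr0 => _ ->.
rewrite ltnS big_cons => ks le_y; apply/orP; right; apply: (IH k) => //.
by move: le_y; rewrite natrD -natr1; lra.
Qed.

(** Only the bulk is reflected. Boundary sites are fixed, so the law with parameters [u], [v], [p]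
    is preserved. *)
Definition point_flip (m n : nat) (c : nat * nat) : nat * nat :=
  if (0 < c.1 <= m)%N && (0 < c.2 <= n)%N then (m.+1 - c.1, n.+1 - c.2)%N else c.

Lemma point_flipK m n : involutive (point_flip m n).
Proof.
move=> [i j]; rewrite /point_flip /=.
case: (boolP ((0 < i <= m) && (0 < j <= n))%N) => /= [ij|/negbTE ->] //.
by rewrite ifT; [congr pair|]; lia.
Qed.

Lemma perm_flip m n : perm_eq (sites m n) [seq point_flip m n c | c <- sites m n].
Proof.
apply: uniq_perm; first exact: uniq_sites.
  by rewrite map_inj_uniq ?uniq_sites //; apply: can_inj (@point_flipK m n).
move=> [i j]; rewrite -[(i, j) in RHS](point_flipK m n) mem_map; last first.
  exact: can_inj (@point_flipK m n).
rewrite /point_flip; case: ifP => //=; rewrite !mem_sites /=; lia.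
Qed.

Lemma lppG_flip (w : env) k m n : (k <= m)%N ->
  bulk_lpp (fun i => bulk w (k + i)) n (m - k) =
  lppG (w \o point_flip m n) n (m - k).
Proof.
move=> km; apply: bulk_lpp_reverse => i j im jn.
rewrite /bulk /= /point_flip /= ifT; last lia.
by congr (w (_, _)); lia.
Qed.

Definition swap_site (c : nat * nat) : nat * nat := (c.2, c.1).

Lemma swap_siteK : involutive swap_site. Proof. by case. Qed.

Lemma perm_swap m n : perm_eq (sites m n) [seq swap_site c | c <- sites n m].
Proof.
apply: uniq_perm; first exact: uniq_sites.
  by rewrite map_inj_uniq ?uniq_sites //; apply: can_inj swap_siteK.
move=> [i j]; rewrite -[(i, j) in RHS]swap_siteK mem_map; last first.
  exact: can_inj swap_siteK.
by rewrite /swap_site /= !mem_sites; lia.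
Qed.

Lemma lppHV_swap (w : env) n m : lppHV (w \o swap_site) m n = lppHV w n m.
Proof. by rewrite [RHS]lpp_transpose // hsum0 vsum0. Qed.

Lemma lppG_swap (w : env) n m : lppG (w \o swap_site) m n = lppG w n m.
Proof. by rewrite [RHS]lpp_transpose. Qed.

Lemma Pr_swap (R : realDomainType) (u v p : R) m n A (w : env) :
  Pr (param u v p) (sites m n) (fun w => A (w \o swap_site)) w =
  Pr (param v u p) (sites n m) A (w \o swap_site).
Proof.
rewrite /Pr (Ex_perm _ _ _ (uniq_sites m n) (perm_swap m n)).
rewrite (Ex_relabel _ _ (fun w => (A w)%:R)); last exact: can_inj swap_siteK.
by apply: eq_Ex_param => -[i j]; rewrite mem_sites; case: i j => [|i] [|j].
Qed.

(** * A maximal inequality for Bernoulli walks *)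

Lemma expR_le_quadratic (R : realType) (x : R) : x <= 1 ->
  expR x <= 1 + x + 2 * x ^+ 2.
Proof.
move=> x1; have h : 1 - x / 2 <= expR (- x / 2).
  by have := expR_ge1Dx (- x / 2); rewrite mulNr.
have E : expR x * expR (- x / 2) ^+ 2 = 1.
  by rewrite expr2 -!expRD (_ : _ + _ = 0) ?expR0 //; lra.
have h2 : (1 - x / 2) ^+ 2 <= expR (- x / 2) ^+ 2.
  by rewrite ler_pXn2r ?nnegrE ?expR_ge0 //; lra.
(* The remainder factorizes with a factor [1 - x]; this is where [x <= 1] enters. *)
have h3 : 1 <= (1 + x + 2 * x ^+ 2) * (1 - x / 2) ^+ 2.
  suff : 0 <= x ^+ 2 * ((1 - x) * (5 / 2 - x)) / 2 by nra.
  by rewrite divr_ge0 // mulr_ge0 ?sqr_ge0 // mulr_ge0; lra.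
have x0 : 0 < 1 - x / 2 by lra.
have Ex := expR_gt0 x.
have q0 : 0 <= 1 + x + 2 * x ^+ 2 by nra.
rewrite -[leLHS]mulr1; apply: (@le_trans _ _
  (expR x * ((1 + x + 2 * x ^+ 2) * expR (- x / 2) ^+ 2))).
  apply: ler_wpM2l; first exact: ltW.
  by apply: le_trans h3 _; apply: ler_wpM2l.
by rewrite mulrCA E mulr1.
Qed.

Lemma bernoulli_mgf_le (R : realType) (a th : R) : 0 <= a <= 1 -> `|th| <= 1 ->
  a * expR (th * (1 - a)) + (1 - a) * expR (- th * a) <= expR (2 * th ^+ 2).
Proof.
move=> /andP[a0 a1]; rewrite ler_norml => /andP[th0 th1].
apply: le_trans (expR_ge1Dx _).
have /(ler_wpM2l a0) : expR (th * (1 - a)) <=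
    1 + th * (1 - a) + 2 * (th * (1 - a)) ^+ 2 by apply: expR_le_quadratic; nra.
have /ler_wpM2l : expR (- th * a) <= 1 + - th * a + 2 * (- th * a) ^+ 2.
  by apply: expR_le_quadratic; nra.
move=> /(_ (1 - a)); rewrite subr_ge0 => /(_ a1) A B.
apply: le_trans (lerD B A) _.
rewrite -subr_ge0.
have -> : 1 + 2 * th ^+ 2 - (a * (1 + th * (1 - a) + 2 * (th * (1 - a)) ^+ 2) +
   (1 - a) * (1 + - th * a + 2 * (- th * a) ^+ 2)) =
   2 * th ^+ 2 * (1 - a * (1 - a)) by ring.
by apply: mulr_ge0; [rewrite mulr_ge0 // sqr_ge0 | nra].
Qed.

(** The right side is a supermartingale bound that is at least [1] once [y <= 0]. Since [crosses]
    recurses as [Ex] does, optional stopping becomes an induction on [s]. *)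
Lemma Pr_crosses (R : realType) (I : eqType) (q : I -> R) (a th : R)
    (s : seq I) y w : 0 <= a <= 1 -> `|th| <= 1 -> uniq s ->
  (forall i, i \in s -> q i = a) ->
  Pr q s (crosses th a s y) w <= expR (2 * th ^+ 2 * (size s)%:R - y).
Proof.
move=> a01 th1; have /andP[a0 a1] := a01.
have q01 s' : (forall i, i \in s' -> q i = a) -> unit_interval_on q s'.
  by move=> qa i /qa ->.
elim: s y w => [|i s IH] y w us qa.
  rewrite /Pr /= orbF mulr0 sub0r; case: (leP y 0) => y0; last exact: expR_ge0.
  by apply: le_trans (expR_ge1Dx _); rewrite /= lerDl oppr_ge0.
have /= [y0|y0] := leP y 0.
  apply: le_trans (Pr_le1 (q01 _ qa) _ _) _.
  apply: le_trans (expR_ge1Dx _).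
  rewrite lerDl; apply: addr_ge0; last by rewrite oppr_ge0.
  by apply: mulr_ge0 => //; apply: mulr_ge0 => //; apply: sqr_ge0.
move: us => /= /andP[is_ us].
have qa' j : j \in s -> q j = a by move=> js; apply: qa; rewrite inE js orbT.
have E (b : bool) :
    Ex q s (fun w => (crosses th a s (y - th * ((w i)%:R - a)) w)%:R) (upd w i b)
    <= expR (2 * th ^+ 2 * (size s)%:R - (y - th * (b%:R - a))).
  apply: le_trans (IH (y - th * (b%:R - a)) (upd w i b) us qa').
  rewrite le_eqVlt; apply/orP; left; apply/eqP; apply: eq_Ex => w' ww' /=.
  by rewrite ww' // updE eqxx.
rewrite /Pr Ex_cons qa ?mem_head //.
have a1' : 0 <= 1 - a by rewrite subr_ge0.
have := lerD (ler_wpM2l a0 (E true)) (ler_wpM2l a1' (E false)).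
move=> /le_trans; apply.
set c := 2 * th ^+ 2 * (size s)%:R - y.
have -> : 2 * th ^+ 2 * (size s)%:R - (y - th * (true%:R - a)) =
  th * (1 - a) + c by rewrite /c (_ : true%:R = 1) //; ring.
have -> : 2 * th ^+ 2 * (size s)%:R - (y - th * (false%:R - a)) =
  - th * a + c by rewrite /c (_ : false%:R = 0) //; ring.
have -> : 2 * th ^+ 2 * (size s).+1%:R - y = 2 * th ^+ 2 + c.
  by rewrite /c -natr1; ring.
move: c => c; rewrite !expRD; move: (expR c) (expR_ge0 c) => e e0.
rewrite [a * (_ * _)]mulrA [(1 - a) * (_ * _)]mulrA -mulrDl.
apply: ler_wpM2r => //; exact: bernoulli_mgf_le.
Qed.

Lemma Pr_walk_up (R : realType) (u v p th y : R) z m n w :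
  0 <= u <= 1 -> 0 <= v <= 1 -> 0 <= p <= 1 -> 0 <= th <= 1 -> (z <= m)%N ->
  Pr (param u v p) (sites m n)
    (fun w => has (fun k => k%:R * u + y <= (hsum w k)%:R) (iota 0 z.+1)) w
  <= expR (2 * th ^+ 2 * z%:R - th * y).
Proof.
move=> u01 v01 p01 /andP[th0 th1] zm.
have sz : size (hsites z) = z by rewrite size_map size_iota.
apply: (@le_trans _ _ (Pr (param u v p) (sites m n)
  (crosses th u (hsites z) (th * y)) w)).
  apply: le_Pr; first exact: unit_interval_param.
  move=> w' /hasP[k]; rewrite mem_iota => kz le_y.
  apply: (@crossesP _ _ _ _ _ _ _ k); first by rewrite sz; lia.
  apply: ler_wpM2l => //.
  have -> : (\sum_(i <- take k (hsites z)) w' i)%N = hsum w' k.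
    rewrite -map_take take_iota (minn_idPl _); last by lia.
    by rewrite big_map /hsum -[iota 0 k]/(iota 0 k) -{1}[k]subn0 big_mkord.
  by lra.
rewrite /Pr (@Ex_support _ _ _ (hsites z)) ?uniq_sites ?uniq_hsites //.
- rewrite -[in leRHS]sz; apply: Pr_crosses; rewrite ?uniq_hsites ?ger0_norm //.
  by move=> [i j]; rewrite mem_hsites /param /= => /andP[_ ->].
- by move=> [i j]; rewrite mem_hsites mem_sites; lia.
- by move=> c _ cz w' b; rewrite crosses_upd.
Qed.

(** The walk is read leftwards from [(m, 0)]: after [sweep] these sites hold the top increments,
    counted back from the corner. *)
Lemma Pr_walk_down (R : realType) (u v p th y : R) z m n w :
  0 <= u <= 1 -> 0 <= v <= 1 -> 0 <= p <= 1 -> 0 <= th <= 1 -> (z <= m)%N ->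
  Pr (param u v p) (sites m n)
    (fun w => has (fun k => (\sum_(i < k) w ((m - i.+1).+1, 0%N))%N%:R <=
                            k%:R * u - y) (iota 0 z.+1)) w
  <= expR (2 * th ^+ 2 * z%:R - th * y).
Proof.
move=> u01 v01 p01 /andP[th0 th1] zm.
pose s0 := [seq ((m - i.+1).+1, 0%N) | i <- iota 0 z].
have sz : size s0 = z by rewrite size_map size_iota.
have us0 : uniq s0.
  rewrite map_inj_in_uniq ?iota_uniq // => i j.
  rewrite !mem_iota => iz jz [E]; clear - iz jz E zm; lia.
have s0h c : c \in s0 -> c.2 = 0%N /\ (0 < c.1 <= m)%N.
  move=> /mapP[i]; rewrite mem_iota => iz -> /=; clear - iz zm; lia.
apply: (@le_trans _ _ (Pr (param u v p) (sites m n)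
  (crosses (- th) u s0 (th * y)) w)).
  apply: le_Pr; first exact: unit_interval_param.
  move=> w' /hasP[k]; rewrite mem_iota => kz le_y.
  apply: (@crossesP _ _ _ _ _ _ _ k); first by rewrite sz; lia.
  rewrite mulNr -mulrN; apply: ler_wpM2l => //.
  have -> : (\sum_(i <- take k s0) w' i)%N =
      (\sum_(i < k) w' ((m - i.+1).+1, 0%N))%N.
    rewrite -map_take take_iota (minn_idPl _); last by clear - kz; lia.
    by rewrite big_map -{1}[k]subn0 big_mkord.
  by lra.
rewrite /Pr (@Ex_support _ _ _ s0) ?uniq_sites //.
- rewrite -sqrrN -[in leRHS]sz; apply: Pr_crosses; rewrite ?normrN ?ger0_norm //.
  by move=> c /s0h [c2 _]; rewrite /param c2.
- by move=> [i j] /s0h /= [-> im]; rewrite mem_sites; clear - im; lia.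
- by move=> c _ cz w' b; rewrite crosses_upd.
Qed.

(** Vertical boundary weight pulls paths to the left and lowers the gain from each further column;
    [lpp_crossing] is summed over the last [k] columns. *)
Lemma lppV_lppG_increment (w : env) n m k : (k <= m)%N ->
  (lppV w n m + lppG w n (m - k) <= lppV w n (m - k) + lppG w n m)%N.
Proof.
elim: k => [|k IH] km; first by rewrite subn0.
have := IH (ltnW km); have -> : (m - k = (m - k.+1).+1)%N by lia.
have [] := @lpp_crossing (fun=> 0%N) (vsum w) (fun=> 0%N) (fun=> 0%N) (bulk w)
  _ _ _ _ _ _ n (m - k.+1) => //.
- by rewrite vsum0.
- by move=> j; have := leq_vsum w j; lia.
- by rewrite /lppV /lppG; lia.
Qed.

Definition slow_gain (R : realType) (a y : R) (z n m : nat) (w : env) : bool :=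
  has (fun k => (lppG w n m)%:R - (lppG w n (m - k))%:R <= k%:R * a - y)
    (iota 0 z.+1).

Lemma slow_gain_upd (R : realType) (a y : R) z n m w c b :
  (c.1 == 0%N) || (c.2 == 0%N) ->
  slow_gain a y z n m (upd w c b) = slow_gain a y z n m w.
Proof. by move=> c0; apply: eq_has => k; rewrite !lppG_upd. Qed.

Lemma mem_sites_axis m n c : c \in sites m n -> c \notin bsites m n ->
  (c.1 == 0%N) || (c.2 == 0%N).
Proof. by case: c => i j; rewrite mem_sites mem_bsites /=; lia. Qed.

Lemma Ex_bulk (R : realDomainType) (u v u' v' p : R) m n (f : env -> R) w :
  (forall c, (c.1 == 0%N) || (c.2 == 0%N) -> blind f c) ->
  Ex (param u v p) (sites m n) f w = Ex (param u' v' p) (sites m n) f w.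
Proof.
move=> fb; have sub : {subset bsites m n <= sites m n}.
  by move=> [i j]; rewrite mem_sites mem_bsites; lia.
rewrite !(@Ex_support _ _ _ (bsites m n)) ?uniq_sites ?uniq_bsites //.
- apply: eq_Ex_param => -[i j]; rewrite mem_bsites.
  by case: i j => [|i] [|j]; rewrite ?andbF.
- by move=> c cs cb; apply: fb; apply: mem_sites_axis cb.
- by move=> c cs cb; apply: fb; apply: mem_sites_axis cb.
Qed.

(** * Comparison of the bulk time with the boundary walk *)

Section Gap.
Context (R : realType) (p : R).
Hypothesis p01 : 0 <= p <= 1.

(* The gain of [lppG] dominates the stationary one as long as the stationary
   path leaves through the vertical axis. *)
Lemma Pr_slow_gain (u v u2 v2 a y y' th : R) z m n w :
  0 <= u2 <= 1 -> 0 <= v2 <= 1 -> u2 * v2 = (1 - u2) * (1 - v2) * p ->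
  0 <= th <= 1 -> (z <= m)%N -> u2 <= a -> z%:R * (a - u2) <= y' ->
  Pr (param u v p) (sites m n) (slow_gain a (y + y') z n m) w <=
  Pr (param u2 v2 p) (sites m n) (fun w => (lppHV w n m <= lppH w n m)%N) w
  + expR (2 * th ^+ 2 * z%:R - th * y).
Proof.
move=> u201 v201 st th01 zm u2a ya.
rewrite /Pr (@Ex_bulk _ u v u2 v2); last first.
  by move=> c c0 w' b; rewrite slow_gain_upd.
have leW := Pr_walk_down y n w u201 v201 p01 th01 zm.
rewrite /Pr -(@Ex_sweep _ u2 v2 p m n) ?uniq_sites // in leW; last first.
  move=> [i j]; rewrite mem_bsites => ij w' b; congr (nat_of_bool _)%:R.
  apply: eq_has => k; cbv beta.
  suff -> : (\sum_(l < k) upd w' (i, j) b ((m - l.+1).+1, 0%N))%N =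
            (\sum_(l < k) w' ((m - l.+1).+1, 0%N))%N by [].
  apply: eq_bigr => l _.
  by rewrite updE ifF // xpair_eqE; clear - ij; lia.
apply: le_trans _ (lerD (lexx _) leW) => {leW}.
apply: (@Pr_union _ _ _ _ _ _ _
  ((fun w => has (fun k => (\sum_(i < k) w ((m - i.+1).+1, 0%N))%N%:R <=
                            k%:R * u2 - y) (iota 0 z.+1)) \o sweep m n)).
  exact: unit_interval_param.
move=> w' /hasP[k kz drop]; have [//|lt_HV] := leqP.
rewrite orFb; apply/hasP; exists k => //.
rewrite mem_iota in kz; have {}kz : (k <= z)%N by clear - kz; lia.
have km := leq_trans kz zm.
have eV : lppHV w' n m = lppV w' n m.
  by move: lt_HV; rewrite lppHV_max; clear; lia.
have le_V : (lppV w' n (m - k) <= lppHV w' n (m - k))%N.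
  by rewrite lppHV_max leq_maxr.
(* The times [lppHV] and [lppV] agree at column [m], and [lppHV] dominates at column [m - k]. So the
   stationary gain is at most that of [lppV], hence at most that of [lppG]. *)
have := lppV_lppG_increment w' n km; have := lppHV_top w' n km.
rewrite eV; set N := (\sum_(i < k) _)%N => E1 E2.
have : (N + lppG w' n (m - k) <= lppG w' n m)%N by clear - E1 E2 le_V; lia.
rewrite -(ler_nat R) natrD => le_N.
have : k%:R * (a - u2) <= y'.
  apply: le_trans ya; apply: ler_wpM2r; first by rewrite subr_ge0.
  by rewrite ler_nat.
by clear - drop le_N; lra.
Qed.

Definition lppH_upto (z : nat) (w : env) (n m : nat) : nat :=
  lpp (fun i => hsum w (minn i z)) (fun=> 0%N) (bulk w) n m.

Lemma lppH_split z w n m : (z <= m)%N ->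
  (lppH w n m <=
   maxn (lppH_upto z w n m) (hsum w z + lppH (w \o shift_site z) n (m - z)))%N.
Proof.
move=> zm; rewrite -{1 2}(subnKC zm) /lppH.
apply: leq_trans (lpp_truncate _ z n (m - z) (leq_hsum w) (hsum0 w) _) _ => //.
rewrite geq_max leq_maxl /= leq_max; apply/orP; right.
rewrite -lpp_add; apply/eq_leq.
apply: (@lpp_eq _ _ _ _ _ _ (m - z) n) => // [i _|j _]; last by rewrite addn0.
exact: hsum_shift.
Qed.

Lemma lppH_upto_exit z w n m : (z <= m)%N -> exists2 k, (k <= z)%N &
  (lppH_upto z w n m <=
   hsum w k + bulk_lpp (fun i => bulk w (k + i)) n (m - k))%N.
Proof.
move=> zm; have hm i : (hsum w (minn i z) <= hsum w (minn i.+1 z))%N.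
  have [zi|iz] := leqP z i; first by rewrite (minn_idPr (leqW zi)).
  by rewrite (minn_idPl iz) leq_hsum.
have [k km] := lpp_exit (bulk w) n m hm.
rewrite min0n hsum0 -/(lppH_upto z w n m) => le_k.
have [kz|zk] := leqP k z; first by exists k; rewrite ?(minn_idPl kz) in le_k *.
(* The boundary is flat beyond [z], so a path leaving later may as well leave at [z]. *)
exists z => //; apply: leq_trans le_k _; rewrite (minn_idPr (ltnW zk)) leq_add2l.
have -> : (m - z = (k - z) + (m - k))%N by clear - zk km zm; lia.
rewrite lpp_shift; have -> : (fun i => bulk w (k + i)) =
    (fun i => bulk w (z + (k - z + i))).
  by apply/funext => i; congr bulk; clear - zk; lia.
exact: leq_lpp.
Qed.

(** One [t] pays for the upward fluctuation of the boundary walk, one for the downward fluctuation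
    of the comparison walk, one for the drift between the two densities. *)
Definition gap_bad (t : R) (z n m : nat) (w : env) : bool :=
  (lppG w n m)%:R + 3 * t <= (lppH_upto z w n m)%:R.

(* Read backwards, the bulk path that starts at column [k <= z] is [lppG] short
   of its last [k] columns: a head start [k] on the axis pays only if it beats
   the gain of [lppG] over these columns. *)
Lemma Pr_gap (u v u2 v2 t th : R) z m n w :
  0 <= u <= 1 -> 0 <= v <= 1 ->
  0 <= u2 <= 1 -> 0 <= v2 <= 1 -> u2 * v2 = (1 - u2) * (1 - v2) * p ->
  0 <= th <= 1 -> (z <= m)%N -> u2 <= u -> z%:R * (u - u2) <= t ->
  Pr (param u v p) (sites m n) (gap_bad t z n m) w <=
  Pr (param u2 v2 p) (sites m n) (fun w => (lppHV w n m <= lppH w n m)%N)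
    (w \o point_flip m n) + 2 * expR (2 * th ^+ 2 * z%:R - th * t).
Proof.
move=> u01 v01 u201 v201 st th01 zm u2u zt.
have q01 s : unit_interval_on (param u v p) s by exact: unit_interval_param.
have := Pr_slow_gain u v t n (w \o point_flip m n) u201 v201 st th01 zm u2u zt.
have := Pr_walk_up t n w u01 v01 p01 th01 zm.
set W := Pr _ _ _ w; set e := expR _; set S := Pr _ _ _ _ => leW leS.
suff le_WS : Pr (param u v p) (sites m n) (gap_bad t z n m) w <= W + S.
  by apply: le_trans le_WS _; clear - leW leS; lra.
have -> : S = Pr (param u v p) (sites m n)
    (fun w => slow_gain u (t + t) z n m (w \o point_flip m n)) w.
  rewrite /S /Pr [RHS](Ex_perm _ _ _ (uniq_sites m n) (perm_flip m n)).
  rewrite (Ex_relabel _ _ (fun w => (slow_gain u (t + t) z n m w)%:R)).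
    apply: eq_Ex_param => -[i j] _; rewrite /param /= /point_flip /=.
    case: (boolP ((0 < i <= m) && (0 < j <= n))%N) => //= ij.
    have [-> -> -> ->] : [/\ (n.+1 - j == 0)%N = false,
      (m.+1 - i == 0)%N = false, (j == 0)%N = false & (i == 0)%N = false].
      by clear - ij; split; lia.
    by [].
  exact: can_inj (@point_flipK m n).
apply: Pr_union => // w' bad.
have [k kz le_k] := lppH_upto_exit w' n zm.
have km := leq_trans kz zm.
rewrite lppG_flip // in le_k.
have kin : k \in iota 0 z.+1 by rewrite mem_iota; clear - kz; lia.
have [le1|lt1] := leP (k%:R * u + t) (hsum w' k)%:R.
  by apply/orP; left; apply/hasP; exists k.
apply/orP; right; apply/hasP; exists k => //.
have eG : lppG w' n m = lppG (w' \o point_flip m n) n m.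
  by have := lppG_flip w' n (leq0n m); rewrite subn0.
rewrite /gap_bad eG in bad; move: le_k; rewrite -(ler_nat R) natrD => le_k.
by clear - bad le_k lt1; lra.
Qed.

Definition hor_bad (t : R) (z n m : nat) (w : env) : bool :=
  exit_after z n m w || gap_bad t z n m w.

(** Deterministic: on the axis where the optimal path starts, either it leaves late, or its early
    part gains too much over [lppG]. The vertical axis is handled by transposition. *)
Lemma lppG_lower (c t : R) z z' n m w : (z <= m)%N -> (z' <= n)%N ->
  (lppG w n m)%:R <= c ->
  [|| (lppHV w n m)%:R <= c + 3 * t, hor_bad t z n m w
    | hor_bad t z' m n (w \o swap_site)].
Proof.
move=> zm z'n Gc.
have [//|/= lt_c] := leP (lppHV w n m)%:R (c + 3 * t).
have key k a b (w1 : env) : (k <= a)%N -> lppG w1 b a = lppG w n m ->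
    lppHV w1 b a = lppHV w n m -> lppHV w1 b a = lppH w1 b a -> hor_bad t k b a w1.
  move=> ka eG eHV eH; rewrite /hor_bad /exit_after /gap_bad eG.
  have := lppH_split w1 b ka; rewrite -eH leq_max orbC => /orP[->//|le_up].
  apply/orP; right; rewrite eHV -(ler_nat R) in le_up.
  by clear - le_up lt_c Gc; lra.
have [HV|HV] := leqP (lppV w n m) (lppH w n m).
  by apply/orP; left; apply: key => //; rewrite lppHV_max (maxn_idPl HV).
apply/orP; right; apply: key => //; rewrite ?lppG_swap ?lppHV_swap //.
have -> : lppH (w \o swap_site) m n = lppV w n m.
  by rewrite [RHS]lpp_transpose // vsum0.
by rewrite lppHV_max (maxn_idPr (ltnW HV)).
Qed.

(** Only [v <= v1] is required: weight on the vertical axis makes a late horizontal exit less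
    likely, and [gap_bad] does not see that axis. *)
Lemma Pr_hor_bad (u v v1 u2 v2 t th e1 e2 : R) z m n w :
  0 <= u <= 1 -> 0 <= v <= v1 -> v1 <= 1 ->
  u * v = (1 - u) * (1 - v) * p ->
  0 <= u2 <= 1 -> 0 <= v2 <= 1 -> u2 * v2 = (1 - u2) * (1 - v2) * p ->
  0 <= th <= 1 -> (z <= m)%N -> u2 <= u -> z%:R * (u - u2) <= t ->
  (forall w, Pr (param u v p) (sites (m - z) n)
    (fun w => (lppHV w n (m - z) <= lppH w n (m - z))%N) w <= e1) ->
  (forall w, Pr (param u2 v2 p) (sites m n)
    (fun w => (lppHV w n m <= lppH w n m)%N) w <= e2) ->
  Pr (param u v1 p) (sites m n) (hor_bad t z n m) w <=
  e1 + e2 + 2 * expR (2 * th ^+ 2 * z%:R - th * t).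
Proof.
move=> u01 /andP[v0 vv1] v11 st u201 v201 st2 th01 zm u2u zt E1 E2.
have v01 : 0 <= v <= 1 by rewrite v0 (le_trans vv1).
have v101 : 0 <= v1 <= 1 by rewrite (le_trans v0 vv1).
have q01 s : unit_interval_on (param u v1 p) s by exact: unit_interval_param.
apply: le_trans (Pr_union (q01 _) _ (B := exit_after z n m)
  (C := gap_bad t z n m) _) _ => //.
rewrite -addrA; apply: lerD; last first.
  apply: le_trans (Pr_gap n w u01 v101 u201 v201 st2 th01 zm u2u zt) _.
  exact: lerD.
apply: le_trans _ (E1 (w \o shift_site z)).
rewrite -Pr_exit_after //; apply: Ex_monotone => //.
  exact: unit_interval_param.
move=> [i j] w' _; rewrite /param /=.
have [->|j0] := eqVneq j 0%N; first by rewrite subrr mul0r.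
have [->|i0] := eqVneq i 0%N; last by rewrite subrr mul0r.
apply: mulr_le0; first by rewrite subr_le0.
rewrite subr_le0 ler_nat /exit_after.
have imp (a b : bool) : (a -> b) -> (a <= b)%N by case: a b => [] [] //= /(_ isT).
have eS b : hsum (upd w' (0%N, j) b) z = hsum w' z.
  by rewrite hsum_upd // mem_hsites.
have eH b : lppH (upd w' (0%N, j) b \o shift_site z) n (m - z) =
    lppH (w' \o shift_site z) n (m - z).
  rewrite (_ : upd w' (0%N, j) b \o _ = upd (w' \o shift_site z) (0%N, j) b).
    by rewrite lppH_upd.
  apply/funext => c; rewrite /= !updE -[(0%N, j)]/(shift_site z (0%N, j)).
  by rewrite (inj_eq (@shift_site_inj z)).
apply: imp; rewrite !eS !eH; apply: leq_trans.
rewrite /lppHV !bulk_upd_axis //; apply: leq_lpp => k; last exact: vsum_monotone.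
by rewrite !hsum_upd // mem_hsites.
Qed.

End Gap.

(** * Moment generating functions *)

(* The pairs [(hpar rho, vpar p rho)] parametrize the stationary boundaries, see
   [par_stationary]. *)
Definition hpar (R : realFieldType) (rho : R) : R := rho / (1 + rho).
Definition vpar (R : realFieldType) (p rho : R) : R := p / (p + rho).

Section Densities.
Context (R : realType) (p : R).
Hypotheses (p0 : 0 < p) (p1 : p < 1).

Lemma hpar_itv (rho : R) : 0 < rho -> 0 <= hpar rho <= 1.
Proof.
move=> r0; have d0 : 0 < 1 + rho by lra.
by rewrite divr_ge0 ?ler_pdivrMr //; lra.
Qed.

Lemma vpar_itv (rho : R) : 0 < rho -> 0 <= vpar p rho <= 1.
Proof.
move=> r0; have d0 : 0 < p + rho by rewrite addr_gt0.
by rewrite divr_ge0 ?ler_pdivrMr ?mul1r ?lerDl ?ltW.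
Qed.

Lemma par_stationary (rho : R) : 0 < rho ->
  hpar rho * vpar p rho = (1 - hpar rho) * (1 - vpar p rho) * p.
Proof.
move=> r0; have d0 : 1 + rho != 0 by apply: lt0r_neq0; lra.
have d1 : p + rho != 0 by apply: lt0r_neq0; rewrite addr_gt0.
by rewrite /hpar /vpar; field; rewrite d0 d1.
Qed.

Lemma le_hpar (r1 r2 : R) : 0 < r1 -> r1 <= r2 -> hpar r1 <= hpar r2.
Proof.
move=> r0 r12; have d0 : 0 < 1 + r1 by lra.
have d1 : 0 < 1 + r2 by lra.
by rewrite /hpar ler_pdivrMr // mulrAC ler_pdivlMr //; lra.
Qed.

Lemma le_vpar (r1 r2 : R) : 0 < r1 -> r1 <= r2 -> vpar p r2 <= vpar p r1.
Proof.
move=> r0 r12; have d0 : 0 < p + r1 by rewrite addr_gt0.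
have d1 : 0 < p + r2 by rewrite addr_gt0 //; lra.
by rewrite /vpar ler_pM2l // lef_pV2 ?posrE //; lra.
Qed.

(** The odds of [vpar p rho] are [p / rho], and a tilt by [t] multiplies odds by [t]. *)
Lemma vpar_tilt (rho t : R) : 0 < rho -> 0 < t ->
  vpar p rho * (1 - vpar p (rho * t) + vpar p (rho * t) * t) =
  vpar p (rho * t) * t.
Proof.
move=> r0 t0; have rt : 0 < rho * t by rewrite mulr_gt0.
rewrite /vpar; field.
by apply/andP; split; apply: lt0r_neq0; rewrite addr_gt0.
Qed.

Lemma hpar_sub (r1 r2 : R) : 0 < r1 -> r1 <= r2 -> hpar r2 - hpar r1 <= 1 - r1 / r2.
Proof.
move=> r0 r12; have r20 : 0 < r2 by lra.
have d0 : 0 < 1 + r1 by lra.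
have d1 : 0 < 1 + r2 by lra.
rewrite -subr_ge0 (_ : _ - _ = (r2 - r1) * (1 + r1 + r1 * r2) /
   (r2 * (1 + r1) * (1 + r2))).
  rewrite divr_ge0 //; last by rewrite !mulr_ge0 ?ltW.
  by rewrite mulr_ge0 ?subr_ge0 // addr_ge0 ?mulr_ge0 ?ltW.
by rewrite /hpar; field; rewrite !gt_eqF.
Qed.

Lemma inv1D_le_expR (y : R) : 0 <= y -> (1 + y)^-1 <= expR (- y + y ^+ 2).
Proof.
move=> y0; apply: le_trans (expR_ge1Dx _).
rewrite -[leLHS]mul1r ler_pdivrMr; last by lra.
suff : 0 <= y ^+ 3 by nra.
exact: exprn_ge0.
Qed.

(** [exit_bound] is used at the larger density [r], whose tilt leads back to [rho]. A parameter [a]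
    gives [(1 - a + a * t) * (1 - a + a / t) = 1 + a * (1 - a) * k], so the exponent measures how
    far [(m, n)] is from the direction characteristic for [r]. *)
Lemma exit_estimate (rho t r k : R) m n w : 0 < rho -> 1 <= t ->
  r = rho * t -> k = t + t^-1 - 2 ->
  Pr (param (hpar rho) (vpar p rho) p) (sites m n)
    (fun w => (lppHV w n m <= lppH w n m)%N) w ^+ 2
  <= expR (k * (r / (1 + r) ^+ 2) *
       (m%:R - n%:R * (p * (1 + r) ^+ 2 / (p + r) ^+ 2)) + n%:R * k ^+ 2).
Proof.
move=> r0 t1 Er Ek; have t0 : 0 < t by lra.
have rr : 0 < r by rewrite Er mulr_gt0.
have d1 : 0 < 1 + r by lra.
have d2 : 0 < p + r by rewrite addr_gt0.
have k0 : 0 <= k.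
  have -> : k = (t - 1) ^+ 2 / t by rewrite Ek; field; rewrite gt_eqF.
  by rewrite divr_ge0 ?sqr_ge0 // ltW.
set A := r / (1 + r) ^+ 2; set B := p * r / (p + r) ^+ 2.
have A0 : 0 <= A by rewrite divr_ge0 ?sqr_ge0 // ltW.
have B0 : 0 <= B by rewrite divr_ge0 ?sqr_ge0 // mulr_ge0 ?ltW.
have B1 : B <= 1.
  rewrite ler_pdivrMr ?exprn_gt0 // mul1r.
  by have := sqr_ge0 p; have := sqr_ge0 r; have := mulr_gt0 p0 rr; nra.
have rho_r : rho <= r by rewrite Er ler_peMr // ltW.
have le_h : 0 <= hpar rho <= hpar r.
  by rewrite le_hpar // andbT; case/andP: (hpar_itv r0).
have p01 : 0 <= p <= 1 by rewrite !ltW.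
have vt : vpar p rho * (1 - vpar p r + vpar p r * t) = vpar p r * t.
  by rewrite Er vpar_tilt.
have := @exit_bound R (hpar r) (hpar rho) (vpar p r) (vpar p rho) p t m n w
  (hpar_itv rr) le_h (vpar_itv rr) (vpar_itv r0) p01 t1 (par_stationary rr)
  vt.
have -> : (1 - hpar r + hpar r * t) * (1 - hpar r + hpar r * t^-1) = 1 + A * k.
  by rewrite /A Ek /hpar; field; rewrite !gt_eqF.
have -> : (1 - vpar p r + vpar p r * t) * (1 - vpar p r + vpar p r * t^-1)
    = 1 + B * k.
  by rewrite /B Ek /vpar; field; rewrite !gt_eqF.
set P := Pr _ _ _ _ => le_P.
have Bk0 : 0 <= B * k by rewrite mulr_ge0.
have dB : 0 < 1 + B * k by lra.
apply: (@le_trans _ _ ((1 + A * k) ^+ m * (1 + B * k)^-1 ^+ n)).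
  by rewrite exprVn ler_pdivlMr ?exprn_gt0.
apply: (@le_trans _ _ (expR (A * k) ^+ m * expR (- (B * k) + (B * k) ^+ 2) ^+ n)).
  apply: ler_pM.
  - by apply: exprn_ge0; rewrite addr_ge0 // mulr_ge0.
  - by apply: exprn_ge0; rewrite invr_ge0 ltW.
  - by rewrite lerXn2r ?nnegrE ?expR_ge0 ?expR_ge1Dx // addr_ge0 // mulr_ge0.
  - by rewrite lerXn2r ?nnegrE ?expR_ge0 ?inv1D_le_expR // invr_ge0 ltW.
rewrite -!expRM_natl -expRD ler_expR.
have -> : k * A * (m%:R - n%:R * (p * (1 + r) ^+ 2 / (p + r) ^+ 2)) =
    m%:R * (A * k) - n%:R * (B * k).
  by rewrite /A /B; field; rewrite !gt_eqF.
have : n%:R * (B * k) ^+ 2 <= n%:R * k ^+ 2.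
  apply: ler_wpM2l => //; rewrite exprMn -[leRHS]mul1r.
  by apply: ler_wpM2r; rewrite ?sqr_ge0 // expr_le1.
by lra.
Qed.

End Densities.

(** * Expansions of hyperbolic functions *)

Lemma is_derive_sinh (R : realType) (x : R) :
  is_derive x 1 (fun h : R => expR h - expR (- h) - 2 * h)
    (expR x + expR (- x) - 2).
Proof.
have H : is_derive x (1 : R) (expR \o (-%R : R -> R)) (- expR (- x)).
  by apply: is_derive_eq; rewrite /GRing.scale /= mulrN1.
have -> : (fun h : R => expR h - expR (- h) - 2 * h) =
  ((expR : R -> R) - (expR \o -%R)) - (2 *: (id : R -> R)).
  exact/funext.
apply: is_derive_eq; rewrite /= opprK; congr (_ + _ - _).
by rewrite /GRing.scale /= mulr1.
Qed.

Lemma sinh_mvt (R : realType) (h : R) : 0 < h -> exists2 c, 0 < c < h &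
  expR h - expR (- h) - 2 * h = (expR c + expR (- c) - 2) * h.
Proof.
move=> h0; pose f (h : R) := expR h - expR (- h) - 2 * h.
have [||c] := @MVT R f (fun x => expR x + expR (- x) - 2) 0 h h0.
- by move=> x _; apply: is_derive_sinh.
- apply: derivable_within_continuous => x _.
  by have [] := is_derive_sinh x.
have f0 : f 0 = 0 by rewrite /f oppr0 expR0 subrr mulr0 subr0.
by rewrite in_itv /= f0 !subr0 => ch E; exists c.
Qed.

(** The right side is the square of [expR (h / 2) - expR (- (h / 2))], which is at least [h] by the
    mean value theorem. *)
Lemma cosh_ge (R : realType) (h : R) : 0 <= h -> h ^+ 2 <= expR h + expR (- h) - 2.
Proof.
have nn (c : R) : 0 <= expR c + expR (- c) - 2.
  have E : expR (- c) = (expR c)^-1 by rewrite expRN.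
  have c0 := expR_gt0 c; rewrite E.
  have -> : expR c + (expR c)^-1 - 2 = (expR c - 1) ^+ 2 / expR c.
    by field; rewrite gt_eqF.
  by rewrite divr_ge0 ?sqr_ge0 // ltW.
rewrite le_eqVlt => /predU1P[<-|h0]; first by rewrite expr0n.
have h2 : 0 < h / 2 by lra.
have [c _ E] := sinh_mvt h2.
have ge_h : h <= expR (h / 2) - expR (- (h / 2)).
  have : 0 <= expR (h / 2) - expR (- (h / 2)) - 2 * (h / 2).
    by rewrite E mulr_ge0 // ltW.
  lra.
have -> : expR h + expR (- h) - 2 = (expR (h / 2) - expR (- (h / 2))) ^+ 2.
  have Ei : expR (h / 2) * expR (- (h / 2)) = 1 by rewrite -expRD subrr expR0.
  have -> : expR h = expR (h / 2) ^+ 2.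
    by rewrite expr2 -expRD; congr expR; lra.
  have -> : expR (- h) = expR (- (h / 2)) ^+ 2.
    by rewrite expr2 -expRD; congr expR; lra.
  by rewrite sqrrB Ei; ring.
by rewrite ler_pXn2r ?nnegrE //; lra.
Qed.

Lemma cosh_le (R : realType) (h : R) : 0 <= h <= 1 ->
  expR h + expR (- h) - 2 <= 4 * h ^+ 2.
Proof.
move=> /andP[h0 h1]; have := expR_le_quadratic h1.
have : expR (- h) <= 1 + - h + 2 * (- h) ^+ 2 by apply: expR_le_quadratic; lra.
by rewrite sqrrN; lra.
Qed.

Lemma sinh_bounds (R : realType) (h : R) : 0 <= h <= 1 ->
  2 * h <= expR h - expR (- h) <= 2 * h + 4 * h ^+ 3.
Proof.
move=> /andP[]; rewrite le_eqVlt => /predU1P[<- _|h0 h1].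
  by rewrite oppr0 subrr !mulr0 expr0n /= mulr0 addr0 lexx.
have [c /andP[c0 ch] E] := sinh_mvt h0.
have c2 := cosh_ge (ltW c0); have c4 : expR c + expR (- c) - 2 <= 4 * c ^+ 2.
  by apply: cosh_le; lra.
set k := expR c + expR (- c) - 2 in E c2 c4.
have k0 : 0 <= k by apply: le_trans c2; apply: sqr_ge0.
have kh : k <= 4 * h ^+ 2.
  apply: le_trans c4 _; rewrite ler_pM2l // ler_pXn2r ?nnegrE ?ltW //.
have h3 : 4 * h ^+ 3 = 4 * h ^+ 2 * h by ring.
have := ler_wpM2r (ltW h0) kh; have := mulr_ge0 k0 (ltW h0).
by rewrite -E h3; lra.
Qed.

(* The logarithm of [M h / M (- h)] is odd in [h], hence has no second order
   term. *)
Lemma mgf_ratio_le (R : realType) (a h : R) : 0 <= a <= 1 -> 0 <= h <= 1 ->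
  let M x := (1 - a) * expR (- (a * x)) + a * expR ((1 - a) * x) in
  [/\ 1 <= M h, 1 <= M (- h), M h <= expR (4 * h ^+ 3) * M (- h) &
   M (- h) <= expR (4 * h ^+ 3) * M h].
Proof.
move=> /andP[a0 a1] /andP[h0 h1] M.
have M1 x : 1 <= M x.
  have := expR_ge1Dx (- (a * x)); have := expR_ge1Dx ((1 - a) * x).
  by rewrite /M; nra.
have h30 : 0 <= h ^+ 3 by apply: exprn_ge0.
have key (x y : R) : 1 <= y -> x <= y + 4 * h ^+ 3 -> x <= expR (4 * h ^+ 3) * y.
  move=> y1 xy; have := expR_ge1Dx (4 * h ^+ 3).
  by move: (expR _) => e; nra.
have A : 2 * (a * h) <= expR (a * h) - expR (- (a * h)) <= 2 * (a * h) + 4 * (a * h) ^+ 3.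
  by apply: sinh_bounds; nra.
have B : 2 * ((1 - a) * h) <= expR ((1 - a) * h) - expR (- ((1 - a) * h)) <=
   2 * ((1 - a) * h) + 4 * ((1 - a) * h) ^+ 3.
  by apply: sinh_bounds; nra.
have cube (x : R) : 0 <= x <= 1 -> (x * h) ^+ 3 <= h ^+ 3.
  move=> /andP[x0 x1]; rewrite lerXn2r ?nnegrE ?mulr_ge0 //.
  by rewrite ler_piMl.
have ca := cube a; have cb := cube (1 - a).
have {}ca : (a * h) ^+ 3 <= h ^+ 3 by apply: ca; lra.
have {}cb : ((1 - a) * h) ^+ 3 <= h ^+ 3 by apply: cb; lra.
case/andP: A => A1 A2; case/andP: B => B1 B2.
have a1' : 0 <= 1 - a by rewrite subr_ge0.
have h4 : 0 <= 4 * h ^+ 3 by apply: mulr_ge0.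
(* Both differences have linear part [2 * a * (1 - a) * h]; these cancel in [M h - M (- h)]. *)
have lo1 := ler_wpM2l a1' A1; have lo2 := ler_wpM2l a0 B1.
have up1 : (1 - a) * (expR (a * h) - expR (- (a * h))) <=
    (1 - a) * (2 * (a * h)) + 4 * h ^+ 3.
  have : (1 - a) * (4 * h ^+ 3) <= 4 * h ^+ 3 by rewrite ler_piMl //; lra.
  have := ler_wpM2l a1' A2; rewrite mulrDr.
  have : (1 - a) * (4 * (a * h) ^+ 3) <= (1 - a) * (4 * h ^+ 3).
    by rewrite ler_wpM2l // ler_pM2l.
  lra.
have up2 : a * (expR ((1 - a) * h) - expR (- ((1 - a) * h))) <=
    a * (2 * ((1 - a) * h)) + 4 * h ^+ 3.
  have : a * (4 * h ^+ 3) <= 4 * h ^+ 3 by rewrite ler_piMl.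
  have := ler_wpM2l a0 B2; rewrite [leRHS]mulrDr.
  have : a * (4 * ((1 - a) * h) ^+ 3) <= a * (4 * h ^+ 3).
    by rewrite ler_wpM2l // ler_pM2l.
  lra.
split => //; apply: key => //; rewrite /M !mulrN opprK; lra.
Qed.

Lemma one_le_expR (R : realType) (x : R) : 0 <= x -> 1 <= expR x.
Proof. by have := expR_ge1Dx x; lra. Qed.

(* [odds_ratio r h] is the expectation of [expR (2 * h * X)] for a Bernoulli
   variable [X] of parameter [hpar (r * expR (- h))]. *)
Definition odds_ratio (R : realType) (r h : R) : R :=
  (1 + r * expR h) / (1 + r * expR (- h)).

(** Factoring the mean [hpar r] out of [1 + r * expR x] leaves the centred function [M x], and the
    ratio [M h / M (- h)] has only a cubic error. *)
Lemma odds_ratio_bounds (R : realType) (r h : R) : 0 < r -> 0 <= h <= 1 ->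
  expR (2 * h * hpar r - 4 * h ^+ 3) <= odds_ratio r h
  <= expR (2 * h * hpar r + 4 * h ^+ 3).
Proof.
move=> r0 h01; have a01 := hpar_itv r0; set a := hpar r in a01 *.
pose M x := (1 - a) * expR (- (a * x)) + a * expR ((1 - a) * x).
have [M1 M2 M3 M4] : [/\ 1 <= M h, 1 <= M (- h),
  M h <= expR (4 * h ^+ 3) * M (- h) & M (- h) <= expR (4 * h ^+ 3) * M h].
  exact: mgf_ratio_le.
have d0 : 1 + r != 0 by rewrite gt_eqF // addr_gt0.
have EM x : 1 + r * expR x = (1 + r) * expR (a * x) * M x.
  have -> : M x = expR (- (a * x)) * ((1 - a) + a * expR x).
    rewrite /M (_ : (1 - a) * x = - (a * x) + x); last by ring.
    by rewrite expRD; ring.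
  transitivity ((1 + r) * (1 - a + a * expR x) * (expR (a * x) * expR (- (a * x)))).
    by rewrite -expRD subrr expR0 mulr1 /a /hpar; field.
  by ring.
have Mh0 : 0 < M h by apply: lt_le_trans M1.
have MNh0 : 0 < M (- h) by apply: lt_le_trans M2.
have -> : odds_ratio r h = expR (2 * h * a) * (M h / M (- h)).
  rewrite /odds_ratio !EM mulrN.
  rewrite [expR (- _)]expRN (_ : 2 * h * a = a * h + a * h); last by ring.
  rewrite expRD; field; rewrite d0 !gt_eqF ?expR_gt0 //.
by rewrite !expRD; apply/andP; split; apply: ler_wpM2l; rewrite ?expR_ge0 //
  ?ler_pdivrMr // expRN ler_pdivlMr // mulrC ler_pdivrMr ?expR_gt0 // mulrC.
Qed.

Lemma odds_ratio_gt0 (R : realType) (r h : R) : 0 < r -> 0 < odds_ratio r h.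
Proof. by move=> r0; rewrite divr_gt0 // addr_gt0 // mulr_gt0 ?expR_gt0. Qed.

(** * Exponential tail bounds centred at a density [rho] *)

Section Chernoff.
Context (R : realType) (p rho h : R) (m n : nat).
Hypotheses (p0 : 0 < p) (p1 : p < 1) (r0 : 0 < rho) (h01 : 0 <= h <= 1).
Let e1 : expR h * expR (- h) = 1. Proof. by rewrite -expRD subrr expR0. Qed.
Let p01 : 0 <= p <= 1. Proof. by rewrite !ltW. Qed.
Let T := expR (2 * h).
Let T0 : 0 < T. Proof. exact: expR_gt0. Qed.
Let ET : T = expR h * expR h.
Proof. by rewrite /T -expRD; congr expR; ring. Qed.
Let q0 : 0 < p / rho. Proof. exact: divr_gt0. Qed.
Let rp : 0 < rho * expR h. Proof. by rewrite mulr_gt0 ?expR_gt0. Qed.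
Let rm : 0 < rho * expR (- h). Proof. by rewrite mulr_gt0 ?expR_gt0. Qed.

(** The stationary model is taken at [rho * expR (- h)] and tilted by [expR (2 * h)], so that the
    factors are odds ratios symmetric about [rho]. *)
Lemma lppG_right_tail u v c w : 0 <= u <= 1 -> 0 <= v <= 1 ->
  Pr (param u v p) (sites m n) (fun w => c <= (lppG w n m)%:R) w <=
  expR (- (2 * h * c) + m%:R * (2 * h * hpar rho + 4 * h ^+ 3) +
    n%:R * (2 * h * hpar (p / rho) + 4 * h ^+ 3)).
Proof.
move=> u01 v01; have h0 : 0 <= h by case/andP: h01.
have eh := expR_gt0 h; have enh := expR_gt0 (- h).
set r := rho * expR (- h); have rr : 0 < r by exact: rm.
have T1 : 1 <= T by apply: one_le_expR; rewrite mulr_ge0.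
apply: (@le_trans _ _ (Ex (param u v p) (sites m n)
   (fun w => expR (- (2 * h * c)) * T ^+ lppG w n m) w)).
  apply: le_Ex => [|w' _]; first exact: unit_interval_param.
  have [le_c|_] /= := leP c (lppG w' n m)%:R; last first.
    by apply: mulr_ge0; [exact: expR_ge0 | rewrite exprn_ge0 // ltW].
  rewrite /T -expRM_natl -expRD; apply: one_le_expR.
  by have := ler_wpM2l (mulr_ge0 (ler0n R 2) h0) le_c; lra.
rewrite ExZ (@Ex_bulk _ u v (hpar r) (vpar p r)); last first.
  by move=> z z0 w' b; rewrite lppG_upd.
rewrite -addrA expRD ler_wpM2l ?expR_ge0 //.
have := @Ex_lppH_le R (hpar r) (vpar p r) p m n (hpar_itv rr) (vpar_itv p0 rr)
  p01 (par_stationary p0 rr) T w T1.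
have -> : 1 - hpar r + hpar r * T = odds_ratio rho h.
  rewrite /odds_ratio -/r.
  have -> : rho * expR h = r * T by rewrite /r ET expRN; field; rewrite gt_eqF.
  by rewrite /hpar; field; rewrite gt_eqF // addr_gt0.
have -> : 1 - vpar p r + vpar p r * T^-1 = (odds_ratio (p / rho) h)^-1.
  rewrite /odds_ratio invf_div /vpar /r ET expRN; field.
  by rewrite !gt_eqF ?addr_gt0 ?mulr_gt0.
rewrite exprVn ler_pdivrMr ?exprn_gt0 ?odds_ratio_gt0 // => leH.
apply: le_trans (le_trans _ leH) _.
  apply: le_Ex => [|w' _].
    by apply: unit_interval_param => //; [apply: hpar_itv|apply: vpar_itv].
  by apply: ler_weXn2l => //; apply: leq_lpp.
have key r1 k : 0 < r1 ->
    odds_ratio r1 h ^+ k <= expR (k%:R * (2 * h * hpar r1 + 4 * h ^+ 3)).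
  move=> r10; have o0 := odds_ratio_gt0 h r10.
  rewrite expRM_natl; apply: lerXn2r; rewrite ?nnegrE ?expR_ge0 ?(ltW o0) //.
  by case/andP: (odds_ratio_bounds r10 h01).
have o0 r1 k : 0 < r1 -> 0 <= odds_ratio r1 h ^+ k.
  by move=> r10; apply/exprn_ge0/ltW/odds_ratio_gt0.
by rewrite expRD; apply: ler_pM; [exact: o0|exact: o0|exact: key|exact: key].
Qed.

(** Tilting the stationary pair at [rho * expR h] by [expR (2 * h)] moves only the vertical
    parameter, to that of [rho * expR (- h)]. *)
Lemma lppHV_lower_tail c w :
  Pr (param (hpar (rho * expR h)) (vpar p (rho * expR (- h))) p) (sites m n)
    (fun w => (lppHV w n m)%:R <= c) w <=
  expR (2 * h * c - m%:R * (2 * h * hpar rho - 4 * h ^+ 3) -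
    n%:R * (2 * h * hpar (p / rho) - 4 * h ^+ 3)).
Proof.
have h0 : 0 <= h by case/andP: h01.
have eh := expR_gt0 h; have enh := expR_gt0 (- h).
set r := rho * expR h; have rr : 0 < r by exact: rp.
set r' := rho * expR (- h); have rr' : 0 < r' by exact: rm.
have Er : r = r' * T.
  by rewrite /r /r' ET expRN; field; rewrite gt_eqF.
apply: (@le_trans _ _ (Ex (param (hpar r) (vpar p r') p) (sites m n)
   (fun w => expR (2 * h * c) * T^-1 ^+ lppHV w n m) w)).
  apply: le_Ex => [|w' _].
    by apply: unit_interval_param => //; [apply: hpar_itv|apply: vpar_itv].
  have [le_c|_] /= := leP (lppHV w' n m)%:R c; last first.
    by apply: mulr_ge0; [exact: expR_ge0 | rewrite exprn_ge0 // invr_ge0 ltW].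
  rewrite /T -expRN -expRM_natl -expRD; apply: one_le_expR.
  by have := ler_wpM2l (mulr_ge0 (ler0n R 2) h0) le_c; lra.
rewrite ExZ -!addrA expRD ler_wpM2l ?expR_ge0 //.
have vt : vpar p r' * (1 - vpar p r + vpar p r * T) = vpar p r * T.
  by rewrite Er vpar_tilt.
have := @Ex_lppHV_tilt R (hpar r) (vpar p r) p m n (hpar_itv rr) (vpar_itv p0 rr)
  p01 (par_stationary p0 rr) (vpar p r') T w T0 vt.
set E := Ex _ _ _ _.
have -> : 1 - hpar r + hpar r * T^-1 = (odds_ratio rho h)^-1.
  rewrite /odds_ratio invf_div /hpar /r ET expRN; field.
  by rewrite !gt_eqF ?addr_gt0 ?mulr_gt0.
have -> : 1 - vpar p r + vpar p r * T = odds_ratio (p / rho) h.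
  rewrite /odds_ratio /vpar /r ET expRN; field.
  by rewrite !gt_eqF ?addr_gt0 ?mulr_gt0.
have o1 := odds_ratio_gt0 h r0; have o2 := odds_ratio_gt0 h q0.
have oo : odds_ratio (p / rho) h ^+ n != 0 by rewrite gt_eqF // exprn_gt0.
move=> /(canRL (mulfK oo)) ->; rewrite expRD -exprVn.
have key r1 k : 0 < r1 -> (odds_ratio r1 h)^-1 ^+ k <=
    expR (- (k%:R * (2 * h * hpar r1 - 4 * h ^+ 3))).
  move=> r10; have o0 := odds_ratio_gt0 h r10.
  rewrite -mulrN expRM_natl; apply: lerXn2r.
  - by rewrite nnegrE invr_ge0 ltW.
  - by rewrite nnegrE expR_ge0.
  rewrite expRN lef_pV2 ?posrE ?expR_gt0 //.
  by case/andP: (odds_ratio_bounds r10 h01).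
have o0 r1 k : 0 < r1 -> 0 <= (odds_ratio r1 h)^-1 ^+ k.
  by move=> r10; apply: exprn_ge0; rewrite invr_ge0; apply/ltW/odds_ratio_gt0.
by apply: ler_pM; [exact: o0|exact: o0|exact: key|exact: key].
Qed.

End Chernoff.

Lemma expRN_le (R : realType) (k : nat) (y : R) : 0 < y -> (0 < k)%N ->
  expR (- y) <= (k%:R / y) ^+ k.
Proof.
move=> y0 k0; have kp : 0 < k%:R :> R by rewrite ltr0n.
have yk : 0 < y / k%:R by rewrite divr_gt0.
have : (y / k%:R) ^+ k <= expR y.
  have {2}-> : y = k%:R * (y / k%:R) by rewrite mulrC divfK // gt_eqF.
  rewrite expRM_natl; apply: lerXn2r; rewrite ?nnegrE ?expR_ge0 ?(ltW yk) //.
  by have := expR_ge1Dx (y / k%:R); lra.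
have pk : 0 < (y / k%:R) ^+ k by rewrite exprn_gt0.
by rewrite expRN -[_ / y]invf_div exprVn lef_pV2 ?posrE ?expR_gt0.
Qed.

(** * Exit point estimates *)

(* The characteristic direction: from the origin, the exit point of the
   stationary model of parameter [rho] is of smaller order than [m] when
   [m = n * slope p rho]. *)
Definition slope (R : realFieldType) (p rho : R) : R :=
  p * (1 + rho) ^+ 2 / (p + rho) ^+ 2.

(** A quarter of the logarithmic derivative of [slope p (rho * expR (- s))] at [s = 0]; the slack
    lets [slope_down] hold for all [s] up to [1]. *)
Definition slope_rate (R : realFieldType) (p rho : R) : R :=
  (1 - p) * rho / (2 * (p + rho) * (1 + rho)).

Section Slope.
Context (R : realType) (p rho : R).
Hypotheses (p0 : 0 < p) (p1 : p < 1) (r0 : 0 < rho).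

Lemma slope_gt0 : 0 < slope p rho.
Proof. by rewrite divr_gt0 ?mulr_gt0 ?exprn_gt0 ?addr_gt0. Qed.

Lemma slope_rate_gt0 : 0 < slope_rate p rho.
Proof.
by rewrite divr_gt0 // mulr_gt0 ?subr_gt0 // ?mulr_gt0 // addr_gt0.
Qed.

Lemma slope_ge (r c : R) : 0 < r -> 0 <= c ->
  c * ((1 + rho) * (p + r)) <= (1 + r) * (p + rho) ->
  slope p rho * c ^+ 2 <= slope p r.
Proof.
move=> rr c0 H; have d1 : 0 < p + rho by rewrite addr_gt0.
have d2 : 0 < p + r by rewrite addr_gt0.
rewrite /slope ler_pdivlMr ?exprn_gt0 //.
rewrite [leLHS](_ : _ = p * ((c * ((1 + rho) * (p + r))) ^+ 2) / (p + rho) ^+ 2).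
  rewrite ler_pdivrMr ?exprn_gt0 // -mulrA -exprMn ler_pM2l //.
  have d3 : 0 < 1 + rho by rewrite addr_gt0.
  have d4 : 0 < 1 + r by rewrite addr_gt0.
  by apply: lerXn2r => //; rewrite nnegrE mulr_ge0 ?(ltW d4) ?(ltW d1) //
    mulr_ge0 ?(ltW d3) ?(ltW d2).
by field; rewrite gt_eqF.
Qed.

Lemma slope_up (s : R) : 0 <= s <= 1 ->
  slope p rho * (1 - 2 * s) <= slope p (rho * expR s).
Proof.
move=> /andP[s0 s1]; set r := rho * expR s.
have rr : 0 < r by rewrite mulr_gt0 ?expR_gt0.
have le_r : r * (1 - s) <= rho.
  have := expR_ge1Dx (- s); rewrite expRN => le_s.
  have : expR s * (1 - s) <= 1.
    by rewrite mulrC -ler_pdivlMr ?expR_gt0 // mul1r.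
  by rewrite /r -mulrA; move/(ler_wpM2l (ltW r0)); rewrite mulr1.
have rho_r : rho <= r by rewrite /r ler_peMr ?(ltW r0) // one_le_expR.
apply: le_trans (@slope_ge r (1 - s) rr _ _); last 2 first.
- by rewrite subr_ge0.
- rewrite -subr_ge0 (_ : _ - _ = s * ((1 + rho) * (p + r)) - (1 - p) * (r - rho)).
    have : (1 - p) * (r - rho) <= r - rho by rewrite ler_piMl ?subr_ge0 // gerBl ltW.
    have : s * r <= s * ((1 + rho) * (p + r)).
      apply: ler_wpM2l => //; have := mulr_gt0 r0 p0; have := mulr_gt0 r0 rr.
      by move: p0; nra.
    by move: le_r; lra.
  by ring.
apply: ler_wpM2l; first exact/ltW/slope_gt0.
by have := sqr_ge0 s; nra.
Qed.

Lemma slope_down (s : R) : 0 <= s <= 1 ->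
  slope p rho * (1 + slope_rate p rho * s) <= slope p (rho * expR (- s)).
Proof.
move=> /andP[s0 s1]; set c := slope_rate p rho; set r := rho * expR (- s).
have d1 : 0 < p + rho by rewrite addr_gt0.
have d3 : 0 < 1 + rho by rewrite addr_gt0.
have rr : 0 < r by rewrite mulr_gt0 ?expR_gt0.
have c0 : 0 <= c by apply/ltW/slope_rate_gt0.
have es := one_le_expR s0.
have le_r : r <= rho.
  by rewrite /r expRN ler_pdivrMr ?expR_gt0 // ler_peMr // ltW.
have ge_r : rho * s / 2 <= rho - r.
  have : expR (- s) <= 1 - s / 2.
    rewrite expRN -[leLHS]mul1r ler_pdivrMr ?expR_gt0 //.
    by have := expR_ge1Dx s; nra.
  by move/(ler_wpM2l (ltW r0)); rewrite -/r; lra.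
have cs0 : 0 <= c * s by rewrite mulr_ge0.
apply: le_trans (@slope_ge r (1 + c * s) rr _ _); last 2 first.
- by rewrite addr_ge0.
- rewrite -subr_ge0 (_ : _ - _ = (1 - p) * (rho - r) -
     c * s * ((1 + rho) * (p + r))); last by ring.
  rewrite subr_ge0; apply: (@le_trans _ _ (c * s * ((1 + rho) * (p + rho)))).
    by rewrite ler_wpM2l // ler_pM2l // lerD2l.
  rewrite (_ : c * s * _ = (1 - p) * (rho * s / 2)).
    by rewrite ler_wpM2l // subr_ge0 ltW.
  by rewrite /c /slope_rate; field; rewrite !gt_eqF.
apply: ler_wpM2l; first exact/ltW/slope_gt0.
by have := sqr_ge0 (c * s); nra.
Qed.

(** For [t = expR eta], [k] lies between [eta ^+ 2] and [4 * eta ^+ 2], which gives the main and the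
    error term; the final half comes from the square in [exit_estimate]. *)
Lemma exit_small (eta c0 d : R) m n w : 0 <= eta <= 1 -> 0 <= c0 -> 0 <= d ->
  let r := rho * expR eta in
  c0 <= r / (1 + r) ^+ 2 -> m%:R - n%:R * slope p r <= - d ->
  Pr (param (hpar rho) (vpar p rho) p) (sites m n)
    (fun w => (lppHV w n m <= lppH w n m)%N) w
  <= expR ((- (eta ^+ 2 * c0 * d) + 16 * n%:R * eta ^+ 4) / 2).
Proof.
move=> /andP[e0 e1] c00 d0 r cr dr.
set P := Pr _ _ _ _; have P0 : 0 <= P.
  apply: Pr_ge0; apply: unit_interval_param; rewrite ?hpar_itv ?vpar_itv //.
  by rewrite !ltW.
rewrite -(@ler_pXn2r _ 2) ?nnegrE ?expR_ge0 // -expRM_natl.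
apply: le_trans (exit_estimate p0 p1 m n w r0 (one_le_expR e0) erefl erefl) _.
rewrite -expRN -/r -/(slope p r) ler_expR.
have k1 := cosh_ge e0; have k2 : expR eta + expR (- eta) - 2 <= 4 * eta ^+ 2.
  by apply: cosh_le; rewrite e0.
set k := _ + _ - 2 in k1 k2 *; set A := r / _ in cr *.
have e2 := sqr_ge0 eta.
have k0 : 0 <= k by apply: le_trans k1.
have kk : k ^+ 2 <= 16 * eta ^+ 4.
  have -> : 16 * eta ^+ 4 = (4 * eta ^+ 2) ^+ 2 by ring.
  by apply: lerXn2r; rewrite ?nnegrE ?mulr_ge0.
have A1 : eta ^+ 2 * c0 <= k * A by apply: ler_pM.
have A2 : k * A * (m%:R - n%:R * slope p r) <= - (eta ^+ 2 * c0 * d).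
  apply: (@le_trans _ _ (k * A * - d)).
    by apply: ler_wpM2l => //; apply: mulr_ge0 => //; apply: le_trans cr.
  by rewrite mulrN lerN2; apply: ler_wpM2r.
have := ler_wpM2l (ler0n R n) kk.
by move: A2; lra.
Qed.

End Slope.

Ltac nneg := by repeat first [ done | by apply: ltW | apply: mulr_ge0
  | rewrite invr_ge0 | apply: addr_ge0 | apply: exprn_ge0 ].

(** With [eta = s / a] the main term is of order [s ^+ 3] and the error of order [s ^+ 4 / a], at
    most half of it when [s / a] is small. *)
Lemma exit_exponent (R : realType) (a s y C1 c0 c3 d n : R) :
  0 < a -> 0 < s -> 0 <= y -> 0 <= n -> n <= a ^+ 3 * y -> s <= C1 * a ->
  32 * y * C1 <= c3 -> c3 * s * a ^+ 2 <= c0 * d ->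
  (- ((s / a) ^+ 2 * c0 * d) + 16 * n * (s / a) ^+ 4) / 2 <= - (s ^+ 3 * c3 / 4).
Proof.
move=> a0 s0 y0 n0 ny sC yC cd.
have e0 : 0 < s / a by rewrite divr_gt0.
have H1 : s ^+ 3 * c3 <= (s / a) ^+ 2 * c0 * d.
  have -> : s ^+ 3 * c3 = (s / a) ^+ 2 * (c3 * s * a ^+ 2) by field; rewrite gt_eqF.
  by rewrite -[leRHS]mulrA; apply: ler_wpM2l; rewrite ?sqr_ge0.
have H2 : 16 * n * (s / a) ^+ 4 <= s ^+ 3 * c3 / 2.
  apply: (@le_trans _ _ (16 * (a ^+ 3 * y) * (s / a) ^+ 4)).
    by apply: ler_wpM2r; [rewrite exprn_ge0 // ltW | rewrite ler_pM2l].
  have -> : 16 * (a ^+ 3 * y) * (s / a) ^+ 4 = s ^+ 3 * (16 * y * (s / a)).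
    by field; rewrite gt_eqF.
  rewrite -[leRHS]mulrA; apply: ler_wpM2l; first by rewrite exprn_ge0 // ltW.
  have : s / a <= C1 by rewrite ler_pdivrMr.
  move=> /(ler_wpM2l y0); by move: yC; lra.
by move: H1 H2; lra.
Qed.

Lemma expRN_cube (R : realType) (b c : R) : 0 < b -> 0 < c ->
  expR (- (b ^+ 3 * c)) <= (2 / c) ^+ 2 / b ^+ 6.
Proof.
move=> b0 c0; apply: le_trans (@expRN_le _ 2 _ _ _) _ => //.
  by rewrite mulr_gt0 ?exprn_gt0.
by rewrite le_eqVlt; apply/orP; left; apply/eqP; field; rewrite !gt_eqF.
Qed.

Lemma expRN_square (R : realType) (b c : R) : 0 < b -> 0 < c ->
  expR (- (b ^+ 2 * c)) <= (3 / c) ^+ 3 / b ^+ 6.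
Proof.
move=> b0 c0; apply: le_trans (@expRN_le _ 3 _ _ _) _ => //.
  by rewrite mulr_gt0 ?exprn_gt0.
by rewrite le_eqVlt; apply/orP; left; apply/eqP; field; rewrite !gt_eqF.
Qed.

Definition exit_rate (R : realType) (rho : R) : R :=
  rho / expR 1 / (1 + rho * expR 1) ^+ 2.

Lemma exit_rate_gt0 (R : realType) (rho : R) : 0 < rho -> 0 < exit_rate rho.
Proof.
move=> r0; rewrite !divr_gt0 ?expR_gt0 ?exprn_gt0 // addr_gt0 //.
by rewrite mulr_gt0 ?expR_gt0.
Qed.

Lemma exit_rate_le (R : realType) (rho s : R) : 0 < rho -> `|s| <= 1 ->
  exit_rate rho <= rho * expR s / (1 + rho * expR s) ^+ 2.
Proof.
move=> r0; rewrite ler_norml => /andP[s1 s2].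
have h1 : (expR 1)^-1 <= expR s by rewrite -expRN ler_expR.
have h2 : expR s <= expR 1 by rewrite ler_expR.
have es := expR_gt0 s; have e0 := expR_gt0 (1 : R).
have d0 : 0 < 1 + rho * expR s by rewrite addr_gt0 // mulr_gt0.
have d1 : 0 < 1 + rho * expR 1 by rewrite addr_gt0 // mulr_gt0.
apply: ler_pM.
- by nneg.
- by nneg.
- by rewrite ler_pM2l.
rewrite lef_pV2 ?posrE ?exprn_gt0 //; apply: lerXn2r.
- by rewrite nnegrE ltW.
- by rewrite nnegrE ltW.
by rewrite lerD2l ler_pM2l.
Qed.

(** The window [z] is of order [s * a ^+ 2], with [s] a small multiple of [b]. The exit events then
    cost [exp(- c b^3)] and the walks [exp(- c b^2)]. *)
Lemma hor_bad_estimate (R : realType) (p x y rho C1 : R) :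
  0 < p -> p < 1 -> 0 < x -> 0 < y -> 0 < rho -> 0 < C1 ->
  slope p rho = x / y -> exists C : R, 0 < C /\
  forall (a b : R) (m n : nat), C <= b -> b <= C1 * a ->
  a ^+ 3 * x - 2 <= m%:R <= a ^+ 3 * x -> a ^+ 3 * y - 2 <= n%:R <= a ^+ 3 * y ->
  exists2 z, (z <= m)%N & forall v1 w, vpar p (rho * expR a^-1) <= v1 <= 1 ->
  Pr (param (hpar (rho * expR a^-1)) v1 p) (sites m n)
    (hor_bad (b ^+ 2 * a / 6) z n m) w <= C / b ^+ 6.
Proof.
move=> p0 p1 x0 y0 r0 C10 critical.
have p01 : 0 <= p <= 1 by rewrite !ltW.
pose c0 := exit_rate rho; have c0_gt0 : 0 < c0 by apply: exit_rate_gt0.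
have c0_le s : `|s| <= 1 -> c0 <= rho * expR s / (1 + rho * expR s) ^+ 2.
  exact: exit_rate_le.
pose c2 := slope_rate p rho; have c2_gt0 : 0 < c2 by apply: slope_rate_gt0.
(* Raising the density by [s / a] costs [2 * x * s * a ^+ 2] in the characteristic column; the other
   [2 * s * a ^+ 2] leave a margin [s * a ^+ 2] after lower order terms. *)
pose M := 2 + 2 * x.
have M0 : 0 < M by rewrite addr_gt0 // mulr_gt0.
(* The two entries are the margins, in units of [s * a ^+ 2], of the two exit estimates [E1] and
   [E2]. *)
pose c3 := c0 * Num.min 1 (c2 * x / 2).
have c30 : 0 < c3.
  by rewrite mulr_gt0 // lt_min ltr01 divr_gt0 // mulr_gt0.
have c31 : c3 <= c0 by rewrite ger_pMr // ge_min lexx.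
have c32 : c3 <= c0 * (c2 * x / 2) by rewrite ler_pM2l // ge_min lexx orbT.
(* The summands make [dl = D^-1] small enough, in turn, for [s / a <= 4^-1], for [z <= m], for the
   drift and walk bounds, and for [exit_exponent]. *)
pose D := 4 * C1 + 2 * M * C1 / x + 24 * M + 32 * y * C1 / c3 + 1.
have [D1 D2 D3 D4] : [/\ 4 * C1 <= D, 2 * M * C1 / x <= D, 24 * M <= D &
   32 * y * C1 / c3 <= D].
  have h1 : 0 <= 4 * C1 by nneg.
  have h2 : 0 <= 2 * M * C1 / x by nneg.
  have h3 : 0 <= 24 * M by nneg.
  have h4 : 0 <= 32 * y * C1 / c3 by nneg.
  by rewrite /D; split; move: h1 h2 h3 h4; clear; lra.
have D1' : 1 <= D.
  have h1 : 0 <= 4 * C1 by nneg.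
  have h2 : 0 <= 2 * M * C1 / x by nneg.
  have h3 : 0 <= 24 * M by nneg.
  have h4 : 0 <= 32 * y * C1 / c3 by nneg.
  by rewrite /D; move: h1 h2 h3 h4; clear; lra.
have D0 : 0 < D by apply: lt_le_trans D1'.
pose dl := D^-1.
have dl0 : 0 < dl by rewrite invr_gt0.
have dl1 : dl <= 1 by rewrite invf_le1.
have {}D1 : 4 * C1 * dl <= 1 by rewrite ler_pdivrMr // mul1r.
have {}D2 : 2 * M * C1 * dl <= x.
  by rewrite ler_pdivrMr // [x * D]mulrC -ler_pdivrMr.
have {}D3 : 24 * M * dl <= 1 by rewrite ler_pdivrMr // mul1r.
have {}D4 : 32 * y * (dl * C1) <= c3.
  rewrite [dl * C1]mulrC mulrA ler_pdivrMr // [c3 * D]mulrC.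
  by move: D4; rewrite ler_pdivrMr.
pose K1 := (2 / (dl ^+ 3 * c3 / 4)) ^+ 2 * 2 + 2 * (3 / 12^-1) ^+ 3.
(* Large [b] forces [a] to be large through [b <= C1 * a], and makes [s] absorb all rounding
   errors. *)
pose K2 := 2 * C1 + (2 * x + 2 * x / y + 1) / dl +
  4 * (1 + c2) / (dl * c2 * y) + 24 * M + 4 * C1 / x.
have K10 : 0 <= K1 by rewrite /K1; nneg.
have K2_ge : [/\ 2 * C1 <= K2, (2 * x + 2 * x / y + 1) / dl <= K2,
    4 * (1 + c2) / (dl * c2 * y) <= K2 & 4 * C1 / x <= K2].
  have h1 : 0 <= 2 * C1 by nneg.
  have h2 : 0 <= (2 * x + 2 * x / y + 1) / dl.
    by nneg.
  have h3 : 0 <= 4 * (1 + c2) / (dl * c2 * y).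
    by nneg.
  have h4 : 0 <= 24 * M by nneg.
  have h5 : 0 <= 4 * C1 / x by nneg.
  by rewrite /K2; split; move: h1 h2 h3 h4 h5; clear; lra.
have K20 : 0 < K2.
  by case: K2_ge => h _ _ _; apply: lt_le_trans h; rewrite mulr_gt0.
exists (K1 + K2); split; first exact: ltr_wpDl.
move=> a b m n Kb bC /andP[m1 m2] /andP[n1 n2].
have Kb2 : K2 <= b by apply: le_trans Kb; rewrite lerDr.
have b0 : 0 < b by apply: lt_le_trans Kb2.
case: K2_ge => /le_trans/(_ Kb2) B1 /le_trans/(_ Kb2) B2 /le_trans/(_ Kb2) B3
  /le_trans/(_ Kb2) B5.
have a2 : 2 <= a by rewrite -(ler_pM2l C10) mulrC; apply: le_trans bC.
have a0 : 0 < a by apply: lt_le_trans a2.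
have a1 : 1 <= a by move: a2; clear; lra.
pose s := dl * b.
rewrite ler_pdivrMr // [b * dl]mulrC -/s in B2.
have xy0 : 0 <= 2 * x / y by nneg.
have s1 : 1 <= s by move: B2 xy0 x0; clear; lra.
have s0 : 0 < s by apply: lt_le_trans s1.
have b1 : 1 <= b.
  by apply: le_trans s1 _; rewrite /s ler_piMl // ltW.
have {}B3 : 2 * x / y * (1 + c2) <= c2 * x / 2 * s.
  have : 4 * (1 + c2) / (dl * c2 * y) * (dl * c2 * x / 2) <= b * (dl * c2 * x / 2).
    by apply: ler_wpM2r => //; nneg.
  have -> : 4 * (1 + c2) / (dl * c2 * y) * (dl * c2 * x / 2) = 2 * x / y * (1 + c2).
    by field; rewrite !gt_eqF.
  by rewrite /s; clear; lra.
have {}B5 : 2 <= a ^+ 3 * x / 2.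
  have : 4 / x <= a.
    rewrite -(ler_pM2l C10); apply: le_trans bC.
    by rewrite mulrCA mulrA.
  rewrite ler_pdivrMr // => h.
  have : a * x <= a ^+ 3 * x.
    by apply: ler_wpM2r; rewrite ?(ltW x0) // -{1}[a]expr1 ler_weXn2l.
  by move: h; clear; lra.
pose z := Num.truncn (M * s * a ^+ 2).
have Msa0 : 0 <= M * s * a ^+ 2.
  by nneg.
have /andP[z1 z2] : z%:R <= M * s * a ^+ 2 < z.+1%:R by apply: truncn_itv.
have {}z2 : M * s * a ^+ 2 - 1 <= z%:R.
  by move: z2; rewrite -natr1; clear; lra.
have sC : s <= dl * C1 * a by rewrite /s -mulrA ler_pM2l.
have zm' : M * s * a ^+ 2 <= a ^+ 3 * x / 2.
  apply: (@le_trans _ _ (M * (dl * C1 * a) * a ^+ 2)).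
    by rewrite ler_wpM2r ?sqr_ge0 // ler_pM2l.
  have -> : M * (dl * C1 * a) * a ^+ 2 = a ^+ 3 * (2 * M * C1 * dl) / 2 by field.
  by rewrite ler_pM2r ?invr_gt0 // ler_pM2l ?exprn_gt0.
have zm : (z <= m)%N.
  by rewrite -(ler_nat R); move: z1 zm' B5 m1; clear; lra.
exists z => // v1 w /andP[v1_ge v1_le].
have sa0 : 0 < s / a by rewrite divr_gt0.
have dlC : dl * C1 <= 4^-1 by move: D1; clear; lra.
have sa1 : s / a <= 4^-1.
  rewrite ler_pdivrMr //; apply: le_trans sC _.
  by rewrite ler_pM2r.
have ia : 0 < a^-1 <= 2^-1.
  by rewrite invr_gt0 a0 lef_pV2 ?posrE.
case/andP: ia => ia0 ia1.
have a2sq : 1 <= a ^+ 2 by rewrite expr_ge1 // ltW.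
set rp := rho * expR a^-1 in v1_ge *.
have rp0 : 0 < rp by rewrite mulr_gt0 ?expR_gt0.
(* The factor [2] leaves room for the auxiliary density [rm * expR (s / a)], which must still lie
   below [rho] by a factor [expR (- (s / a))]. *)
pose rm := rho * expR (- (2 * (s / a))).
have rm0 : 0 < rm by rewrite mulr_gt0 ?expR_gt0.
pose E := expR (- (s ^+ 3 * c3 / 4)).
have n0 : 0 <= n%:R :> R by [].
have E1 w' : Pr (param (hpar rp) (vpar p rp) p) (sites (m - z) n)
    (fun w => (lppHV w n (m - z) <= lppH w n (m - z))%N) w' <= E.
  pose sg := a^-1 + s / a.
  have sg0 : 0 < sg by rewrite addr_gt0.
  have sg1 : sg <= 1 by rewrite /sg; move: ia1 sa1; clear; lra.
  have Er : rp * expR (s / a) = rho * expR sg by rewrite /rp -mulrA -expRD.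
  apply: le_trans (@exit_small R p rp p0 p1 rp0 (s / a) c0 (s * a ^+ 2) _ n w' _ _ _ _ _) _.
  - by rewrite ltW //= (le_trans sa1) // invf_le1 // ler1n.
  - exact: ltW.
  - by nneg.
  - by rewrite Er; apply: c0_le; rewrite ger0_norm // ltW.
  - rewrite Er natrB //.
    have sgI : 0 <= sg <= 1 by rewrite ltW.
    have := ler_wpM2l n0 (slope_up p0 r0 sgI); rewrite critical => le_sl.
    have H1 : x / y * (a ^+ 3 * y - 2 - 2 * (a ^+ 3 * y * sg)) <=
        n%:R * (x / y * (1 - 2 * sg)).
      rewrite [leRHS]mulrCA; apply: ler_wpM2l; first by rewrite divr_ge0 // ltW.
      have := ler_wpM2r (ltW sg0) n2; move: n1; clear; lra.
    have Ea : x / y * (a ^+ 3 * y - 2 - 2 * (a ^+ 3 * y * sg)) =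
        a ^+ 3 * x - 2 * x / y - 2 * x * (a ^+ 2 * (1 + s)).
      by rewrite /sg; field; rewrite !gt_eqF.
    rewrite Ea in H1.
    have H2 : 2 * x * a ^+ 2 + 2 * x / y + 1 <= s * a ^+ 2.
      have h1 : (2 * x + 2 * x / y + 1) * a ^+ 2 <= s * a ^+ 2.
        by apply: ler_wpM2r => //; apply: sqr_ge0.
      have h2 : (2 * x / y + 1) * 1 <= (2 * x / y + 1) * a ^+ 2.
        by apply: ler_wpM2l => //; apply: addr_ge0.
      by move: h1 h2; clear; lra.
    move: le_sl H1 H2 z2 m2; rewrite /M; clear; lra.
  rewrite /E ler_expR; apply: (@exit_exponent R a s y (dl * C1)) => //.
  - exact: ltW.
  - by rewrite -[leLHS]mulrA; apply: ler_wpM2r => //; nneg.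
have E2 w' : Pr (param (hpar rm) (vpar p rm) p) (sites m n)
    (fun w => (lppHV w n m <= lppH w n m)%N) w' <= E.
  have saI : 0 <= s / a <= 1.
    by rewrite ltW //= (le_trans sa1) // invf_le1 // ler1n.
  have Er : rm * expR (s / a) = rho * expR (- (s / a)).
    by rewrite /rm -mulrA -expRD; congr (_ * expR _); ring.
  apply: le_trans (@exit_small R p rm p0 p1 rm0 (s / a) c0
    (c2 * x / 2 * s * a ^+ 2) _ n w' _ _ _ _ _) _ => //.
  - exact: ltW.
  - by nneg.
  - by rewrite Er; apply: c0_le; rewrite normrN ger0_norm //; case/andP: saI.
  - rewrite Er.
    have := ler_wpM2l n0 (slope_down p0 p1 r0 saI); rewrite critical -/c2 => le_sl.
    have cs0 : 0 <= x / y * (1 + c2 * (s / a)).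
      by nneg.
    have := ler_wpM2r cs0 n1.
    have -> : (a ^+ 3 * y - 2) * (x / y * (1 + c2 * (s / a))) =
      a ^+ 3 * x + c2 * x * s * a ^+ 2 - 2 * x / y * (1 + c2 * (s / a)).
      by field; rewrite !gt_eqF.
    have h1 : 2 * x / y * (1 + c2 * (s / a)) <= 2 * x / y * (1 + c2).
      apply: ler_wpM2l => //; rewrite lerD2l ler_piMr ?(ltW c2_gt0) //.
      by case/andP: saI.
    have h2 : c2 * x / 2 * s <= c2 * x / 2 * s * a ^+ 2.
      by rewrite ler_peMr //; nneg.
    by move: h1 h2 B3 le_sl m2; clear; lra.
  rewrite /E ler_expR; apply: (@exit_exponent R a s y (dl * C1)) => //.
  - exact: ltW.
  - rewrite (_ : c0 * _ = c0 * (c2 * x / 2) * (s * a ^+ 2)); last by ring.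
    by rewrite -[leLHS]mulrA; apply: ler_wpM2r => //; nneg.
have rm_rp : rm <= rp.
  rewrite ler_pM2l // ler_expR; apply: (@le_trans _ _ 0); last exact: ltW.
  by rewrite oppr_le0 mulr_ge0 // ltW.
(* The drifts differ by order [s / a] per column, hence by [s ^+ 2 * a] over the window; this fixes
   the scale [b ^+ 2 * a]. *)
have small : z%:R * (hpar rp - hpar rm) <= b ^+ 2 * a / 6.
  have h1 : hpar rp - hpar rm <= a^-1 * (1 + 2 * s).
    apply: le_trans (hpar_sub rm0 rm_rp) _.
    have -> : rm / rp = expR (- (a^-1 * (1 + 2 * s))).
      rewrite /rm /rp -mulf_div divff ?gt_eqF // mul1r -expRN -expRD.
      by congr expR; field; rewrite gt_eqF.
    by have := expR_ge1Dx (- (a^-1 * (1 + 2 * s))); clear; lra.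
  have h2 : 0 <= hpar rp - hpar rm by rewrite subr_ge0 le_hpar.
  apply: le_trans (ler_pM (ler0n _ _) h2 z1 h1) _.
  have -> : M * s * a ^+ 2 * (a^-1 * (1 + 2 * s)) = M * s * (1 + 2 * s) * a.
    by field; rewrite gt_eqF.
  have -> : b ^+ 2 * a / 6 = b ^+ 2 / 6 * a by ring.
  apply: ler_wpM2r; first exact: ltW.
  have h3 : M * s * (1 + 2 * s) <= M * s * (3 * s).
    by apply: ler_wpM2l; [nneg | move: s1; clear; lra].
  apply: le_trans h3 _.
  have -> : M * s * (3 * s) = b ^+ 2 / 6 * (18 * M * dl * dl).
    by rewrite /s; field.
  rewrite ler_piMr ?divr_ge0 ?sqr_ge0 //.
  have h4 : 18 * M * dl <= 1.
    have h5 : 0 <= M * dl by nneg.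
    by move: D3 h5; clear; lra.
  by apply: mulr_ile1 => //; [nneg | exact: ltW].
have thI : 0 <= a^-1 <= 1.
  by rewrite ltW //= (le_trans ia1) // invf_le1 // ler1n.
have vrp : 0 <= vpar p rp <= v1.
  by rewrite v1_ge andbT; case/andP: (vpar_itv p0 rp0).
apply: le_trans (Pr_hor_bad p01 w (hpar_itv rp0) vrp v1_le (par_stationary p0 rp0)
  (hpar_itv rm0) (vpar_itv p0 rm0) (par_stationary p0 rm0) thI zm
  (le_hpar rm0 rm_rp) small E1 E2) _.
(* At [th = a^-1] the variance term is linear in [b], the gain quadratic. *)
have walk : expR (2 * a^-1 ^+ 2 * z%:R - a^-1 * (b ^+ 2 * a / 6)) <=
    expR (- (b ^+ 2 * 12^-1)).
  rewrite ler_expR.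
  have -> : a^-1 * (b ^+ 2 * a / 6) = b ^+ 2 / 6 by field; rewrite gt_eqF.
  have h1 : 2 * a^-1 ^+ 2 * z%:R <= 2 * M * s.
    have -> : 2 * M * s = 2 * a^-1 ^+ 2 * (M * s * a ^+ 2).
      by field; rewrite gt_eqF.
    by apply: ler_wpM2l => //; rewrite mulr_ge0 // sqr_ge0.
  have h2 : 2 * M * s <= b ^+ 2 / 12.
    have -> : 2 * M * s = (24 * M * dl) * b / 12 by rewrite /s; field.
    rewrite ler_pM2r ?invr_gt0 // expr2 ler_pM2r //.
    exact: le_trans b1.
  by move: h1 h2; clear; lra.
have {}walk : expR (2 * a^-1 ^+ 2 * z%:R - a^-1 * (b ^+ 2 * a / 6)) <=
    (3 / 12^-1) ^+ 3 / b ^+ 6.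
  by apply: le_trans walk (expRN_square b0 _); rewrite invr_gt0.
have le_E : E <= (2 / (dl ^+ 3 * c3 / 4)) ^+ 2 / b ^+ 6.
  have -> : E = expR (- (b ^+ 3 * (dl ^+ 3 * c3 / 4))).
    by rewrite /E /s; congr expR; ring.
  by apply: expRN_cube; rewrite // divr_gt0 // mulr_gt0 ?exprn_gt0.
apply: (@le_trans _ _ (K1 / b ^+ 6)).
  rewrite /K1; move: le_E walk; set A := (2 / _) ^+ 2; set B := (3 / _) ^+ 3.
  have -> : (A * 2 + 2 * B) / b ^+ 6 = 2 * (A / b ^+ 6) + 2 * (B / b ^+ 6) by ring.
  by clear; lra.
by rewrite ler_pM2r ?invr_gt0 ?exprn_gt0 // lerDl ltW.
Qed.

(** * Tail bounds *)

Lemma bulk_lpp_le (w : nat -> nat -> bool) j i : (bulk_lpp w j i <= i)%N.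
Proof.
elim: j i => [|j IHj] //; elim=> [|i IHi] //.
rewrite lppSS !geq_max IHj (leqW IHi) /= -addn1.
by apply: leq_add => //; apply: leq_b1.
Qed.

(** Transposing the model replaces [rho] by [p / rho], so vertical estimates are horizontal ones. *)
Lemma vpar_hpar (R : realFieldType) (p r : R) : 0 < p -> 0 < r ->
  vpar p r = hpar (p / r).
Proof.
move=> p0 r0; rewrite /vpar /hpar; field.
by rewrite !gt_eqF // addr_gt0.
Qed.

Lemma slope_inv (R : realFieldType) (p r : R) : 0 < p -> 0 < r ->
  slope p (p / r) = (slope p r)^-1.
Proof.
move=> p0 r0; rewrite /slope; field.
by rewrite !gt_eqF // ?addr_gt0 // ?mulr_gt0 // ?addr_gt0.
Qed.

(* [a] stands for [N ^ (1/3)], and the deviation in units of [a] is written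
   [b ^+ 2] to avoid square roots: the tail is of order [(b ^+ 2) ^- 3]. *)
Lemma finite_tail (R : realType) (p x y rho : R) :
  0 < p -> p < 1 -> 0 < x -> 0 < y -> 0 < rho -> slope p rho = x / y ->
  let g := x * hpar rho + y * hpar (p / rho) in
  exists C : R, 0 < C /\
  forall (a b : R) (m n : nat) w, 1 <= a -> C <= b ->
  a ^+ 3 * x - 2 <= m%:R <= a ^+ 3 * x -> a ^+ 3 * y - 2 <= n%:R <= a ^+ 3 * y ->
  Pr (fun=> p) (bsites m n)
    (fun w => b ^+ 2 * a <= `|(lppG w n m)%:R - a ^+ 3 * g|) w <= C / b ^+ 6.
Proof.
move=> p0 p1 x0 y0 r0 critical g.
have p01 : 0 <= p <= 1 by rewrite !ltW.
have q0 : 0 < p / rho by rewrite divr_gt0.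
have hu := hpar_itv r0; have hv := hpar_itv q0.
set u := hpar rho in hu g *; set v := hpar (p / rho) in hv g *.
have u0 : 0 <= u by case/andP: hu.
have v0 : 0 <= v by case/andP: hv.
have g0 : 0 <= g by rewrite /g; nneg.
pose C1 := 1 + x + g.
have C11 : 1 <= C1 by rewrite /C1; move: x0 g0; clear; lra.
have C10 : 0 < C1 by apply: lt_le_trans C11.
have [CH [CH0 Hhor]] := hor_bad_estimate p0 p1 x0 y0 r0 C10 critical.
have critical' : slope p (p / rho) = y / x.
  by rewrite slope_inv // critical invf_div.
have [CV [CV0 Hver]] := hor_bad_estimate p0 p1 y0 x0 q0 C10 critical'.
pose K := expR (8 + 4 * (x + y)) * 3 ^+ 3.
have K0 : 0 < K by rewrite mulr_gt0 ?expR_gt0 ?exprn_gt0.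
exists (CH + CV + K + K + 1); split; first by rewrite !addr_gt0.
move=> a b m n w a1 Cb mm nn.
have a0 : 0 < a by apply: lt_le_trans a1.
have bH : CH <= b by move: Cb CV0 K0; clear; lra.
have bV : CV <= b by move: Cb CH0 K0; clear; lra.
have b1 : 1 <= b by move: Cb CH0 CV0 K0; clear; lra.
have b0 : 0 < b by apply: lt_le_trans b1.
pose h := a^-1; have h0 : 0 < h by rewrite invr_gt0.
have hI : 0 <= h <= 1 by rewrite ltW //= invf_le1.
pose rp := rho * expR h; pose rm := rho * expR (- h).
have rp0 : 0 < rp by rewrite mulr_gt0 ?expR_gt0.
have rm0 : 0 < rm by rewrite mulr_gt0 ?expR_gt0.
have rmp : rm <= rp by rewrite ler_pM2l // ler_expR; move: h0; clear; lra.
(* [vm] exceeds [vpar p rp], the stationary partner of [up]; and [up] exceeds [hpar rm], the partner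
   of [vm]. Hence both uses of [hor_bad_estimate] apply. *)
pose up := hpar rp; pose vm := vpar p rm.
have up01 : 0 <= up <= 1 by apply: hpar_itv.
have vm01 : 0 <= vm <= 1 by apply: vpar_itv.
have qI s : unit_interval_on (param up vm p) s by exact: unit_interval_param.
have -> : Pr (fun=> p) (bsites m n)
    (fun w => b ^+ 2 * a <= `|(lppG w n m)%:R - a ^+ 3 * g|) w =
  Pr (param up vm p) (sites m n)
    (fun w => b ^+ 2 * a <= `|(lppG w n m)%:R - a ^+ 3 * g|) w.
  rewrite /Pr [RHS](@Ex_support _ _ _ (bsites m n)) ?uniq_sites ?uniq_bsites //.
  - apply: eq_Ex_param => -[i j]; rewrite mem_bsites.
    by case: i j => [|i] [|j]; rewrite ?andbF.
  - by move=> [i j]; rewrite mem_sites mem_bsites; clear; lia.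
  - by move=> c cs cb w' b'; rewrite lppG_upd // (mem_sites_axis cs cb).
(* Beyond this range the event is empty, because [lppG w n m <= m]. *)
have [bC|bC] := leP b (C1 * a); last first.
  rewrite (_ : Pr _ _ _ _ = 0); first by rewrite divr_ge0 ?exprn_ge0 ?ltW // !addr_gt0.
  rewrite /Pr -[RHS](Ex_cst (param up vm p) (sites m n) 0 w); apply: eq_Ex => w' _.
  suff /negbTE -> : ~~ (b ^+ 2 * a <= `|(lppG w' n m)%:R - a ^+ 3 * g|) by [].
  rewrite -ltNge; apply: (@le_lt_trans _ _ (a ^+ 3 * C1)).
    have G0 : 0 <= (lppG w' n m)%:R :> R by [].
    have Gm : (lppG w' n m)%:R <= a ^+ 3 * x.
      by case/andP: mm => _; apply: le_trans; rewrite ler_nat bulk_lpp_le.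
    have a3 : 0 <= a ^+ 3 by nneg.
    have ag : 0 <= a ^+ 3 * g by rewrite mulr_ge0.
    by rewrite ler_norml /C1; move: G0 Gm a3 ag; clear; lra.
  have -> : a ^+ 3 * C1 = C1 * a ^+ 2 * a by ring.
  rewrite ltr_pM2r //; apply: (@le_lt_trans _ _ ((C1 * a) ^+ 2)).
    rewrite exprMn ler_pM2r ?exprn_gt0 // expr2 ler_peMl // ltW //.
  by rewrite ltr_pXn2r ?nnegrE //; nneg.
pose c := a ^+ 3 * g - b ^+ 2 * a; pose c' := a ^+ 3 * g + b ^+ 2 * a.
(* Half of the deviation, [3 * t], is spent on the gap between [lppHV] and [lppG]; the other half
   remains for the lower tail of [lppHV]. *)
pose t := b ^+ 2 * a / 6.
have [zH zHm EH] := Hhor a b m n bH bC mm nn.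
have [zV zVn EV] := Hver a b n m bV bC nn mm.
have vmE : vm = hpar (p / rho * expR h).
  rewrite /vm vpar_hpar // /rm invfM -expRN opprK; congr hpar; ring.
have e3 : a ^+ 3 * h = a ^+ 2 by rewrite /h; field; rewrite gt_eqF.
have h3 : a ^+ 3 * h ^+ 3 = 1 by rewrite /h -exprMn divff ?gt_eqF // expr1n.
have ah : a * h = 1 by rewrite /h divff // gt_eqF.
case/andP: hu => _ u1; case/andP: hv => _ v1; have /andP[_ h1] := hI.
(* Since [a * h = 1], the cubic errors add up to the constant [4 * z], and rounding costs at most
   [4]. *)
have bnd k z q : a ^+ 3 * z - 2 <= k%:R <= a ^+ 3 * z -> 0 <= q -> q <= 1 ->
    2 * a ^+ 2 * z * q - 4 * z - 4 <= k%:R * (2 * h * q - 4 * h ^+ 3) /\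
    k%:R * (2 * h * q + 4 * h ^+ 3) <= 2 * a ^+ 2 * z * q + 4 * z.
  move=> /andP[k1 k2] qq0 qq1.
  have hq0 : 0 <= 2 * h * q by nneg.
  have hq1 : 2 * h * q <= 2.
    have : h * q <= 1 by apply: mulr_ile1; rewrite // ltW.
    by clear; lra.
  have h30 : 0 <= 4 * h ^+ 3 by nneg.
  have A1 := ler_wpM2r hq0 k1; have A2 := ler_wpM2r hq0 k2.
  have A3 := ler_wpM2r h30 k2.
  have E1 : a ^+ 3 * z * (2 * h * q) = 2 * a ^+ 2 * z * q by rewrite -e3; ring.
  have E2 : a ^+ 3 * z * (4 * h ^+ 3) = 4 * z.
    by rewrite -[RHS]mulr1 -h3; ring.
  rewrite mulrBl E1 in A1; rewrite E1 in A2; rewrite E2 in A3.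
  by split; move: A1 A2 A3 hq1; clear; lra.
have [m1 m2] := bnd m x u mm u0 u1; have [n1 n2] := bnd n y v nn v0 v1.
have tailK s : s <= 8 + 4 * (x + y) - b ^+ 2 -> expR s <= K / b ^+ 6.
  move=> sK; apply: (@le_trans _ _ (expR (8 + 4 * (x + y)) * expR (- b ^+ 2))).
    by rewrite -expRD ler_expR.
  rewrite /K -[leRHS]mulrA ler_pM2l ?expR_gt0 //.
  by have := expRN_square b0 ltr01; rewrite mulr1 divr1.
have right : Pr (param up vm p) (sites m n) (fun w => c' <= (lppG w n m)%:R) w
    <= K / b ^+ 6.
  apply: le_trans (lppG_right_tail m n p0 p1 r0 hI c' w up01 vm01) _.
  rewrite -/u -/v -/h; apply: tailK.
  have -> : 2 * h * c' = 2 * (a ^+ 2 * g + b ^+ 2).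
    transitivity (2 * (a ^+ 3 * h * g + b ^+ 2 * (a * h))).
      by rewrite /c'; ring.
    by rewrite e3 ah mulr1.
  have b2 : 0 <= b ^+ 2 by nneg.
  by rewrite /g; move: m2 n2 b2; clear; lra.
have left1 : Pr (param up vm p) (sites m n)
    (fun w => (lppHV w n m)%:R <= c + 3 * t) w <= K / b ^+ 6.
  apply: le_trans (lppHV_lower_tail m n p0 p1 r0 hI _ w) _.
  rewrite -/u -/v -/h; apply: tailK.
  have -> : 2 * h * (c + 3 * t) = 2 * (a ^+ 2 * g) - b ^+ 2.
    transitivity (2 * (a ^+ 3 * h * g) - b ^+ 2 * (a * h)).
      by rewrite /c /t; field.
    by rewrite e3 ah mulr1.
  by rewrite /g; move: m1 n1; clear; lra.
have left2 : Pr (param up vm p) (sites m n) (hor_bad t zH n m) w <= CH / b ^+ 6.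
  apply: EH; rewrite le_vpar //=; by case/andP: vm01.
have left3 : Pr (param up vm p) (sites m n)
    (fun w => hor_bad t zV m n (w \o swap_site)) w <= CV / b ^+ 6.
  rewrite Pr_swap vmE; apply: EV; case/andP: up01 => _ ->; rewrite andbT.
  rewrite vpar_hpar ?(mulr_gt0 q0) ?expR_gt0 //.
  rewrite (_ : p / (p / rho * expR a^-1) = rm); last first.
    by rewrite /rm expRN; field; rewrite !gt_eqF ?expR_gt0.
  exact: le_hpar.
have left : Pr (param up vm p) (sites m n) (fun w => (lppG w n m)%:R <= c) w <=
    K / b ^+ 6 + (CH / b ^+ 6 + CV / b ^+ 6).
  apply: le_trans (Pr_union (qI _) _ (B := fun w => (lppHV w n m)%:R <= c + 3 * t)
    (C := fun w => hor_bad t zH n m w || hor_bad t zV m n (w \o swap_site)) _) _.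
    by move=> w' /(lppG_lower t zHm zVn).
  apply: lerD => //; apply: le_trans (Pr_union (qI _) _ _) (lerD left2 left3).
  by [].
apply: le_trans (Pr_union (qI _) _ (B := fun w => (lppG w n m)%:R <= c)
  (C := fun w => c' <= (lppG w n m)%:R) _) _.
  move=> w'; rewrite ler_normr => /orP[dev|dev]; apply/orP; [right|left].
    by rewrite /c'; move: dev; clear; lra.
  by rewrite /c; move: dev; clear; lra.
apply: le_trans (lerD left right) _.
rewrite -!mulrDl ler_pM2r ?invr_gt0 ?exprn_gt0 //; clear; lra.
Qed.

(** * Admissible paths and the probability space *)

Lemma path_weight_rcons w u s v :
  path_weight w u (rcons s v) = (path_weight w u s + step_weight w (last u s) v)%N.
Proof.
by rewrite /path_weight -cats1 pairmap_cat sumn_cat /= addn0.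
Qed.

Lemma step_weight_right w u : step_weight w u (right_of u) = 0%N.
Proof.
rewrite /step_weight ifF // xpair_eqE /=; apply/negbTE.
by rewrite negb_and (ltn_eqF (ltnSn _)) orbT.
Qed.

Lemma step_weight_above w u : step_weight w u (above_of u) = 0%N.
Proof.
rewrite /step_weight ifF // xpair_eqE /=; apply/negbTE.
by rewrite negb_and (ltn_eqF (ltnSn _)).
Qed.

Lemma step_weight_diag w u : step_weight w u (diag_of u) = w (diag_of u).
Proof. by rewrite /step_weight eqxx. Qed.

(** Paths start at [(1, 1)], so cell [(i, j)] collects the weight at [(i.+2, j.+2)]: one unit comes
    from [bulk], the other from here. *)
Definition shift_diag (c : site) : site := (c.1.+1, c.2.+1).

Lemma path_weight_le (w : site -> bool) s i j :
  admissible (1%N, 1%N) (i.+1, j.+1) s ->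
  (path_weight w (1%N, 1%N) s <= lppG (w \o shift_diag) j i)%N.
Proof.
suff H : path step (1%N, 1%N) s -> exists i' j',
    last (1%N, 1%N) s = (i'.+1, j'.+1) /\
    (path_weight w (1%N, 1%N) s <= lppG (w \o shift_diag) j' i')%N.
  by move=> [/H[i' [j' [-> le_w]]] [<- <-]].
elim/last_ind: s => [|s v IH]; first by exists 0%N, 0%N.
rewrite rcons_path last_rcons path_weight_rcons => /andP[/IH[i' [j' [-> le_w]]]].
move=> /or3P[/eqP->|/eqP->|/eqP->].
- exists i'.+1, j'; split => //; rewrite step_weight_right addn0.
  by apply: leq_trans le_w _; apply: lpp_leq_row.
- exists i', j'.+1; split => //; rewrite step_weight_above addn0.
  by apply: leq_trans le_w _; apply: lpp_leq_col.
- exists i'.+1, j'.+1; split => //; rewrite step_weight_diag.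
  rewrite /lppG lppSS leq_max; apply/orP; right.
  by rewrite leq_add2r.
Qed.

Lemma path_weight_attained (w : site -> bool) i j : exists2 s,
  admissible (1%N, 1%N) (i.+1, j.+1) s &
  path_weight w (1%N, 1%N) s = lppG (w \o shift_diag) j i.
Proof.
have ext i' j' s v : admissible (1%N, 1%N) (i', j') s -> step (i', j') v ->
    admissible (1%N, 1%N) v (rcons s v) /\
    path_weight w (1%N, 1%N) (rcons s v) =
    (path_weight w (1%N, 1%N) s + step_weight w (i', j') v)%N.
  move=> [ps ls] st; split; last by rewrite path_weight_rcons ls.
  by split; rewrite ?last_rcons // rcons_path ps ls.
have right i' j' s := ext i' j' s (right_of (i', j')).
have above i' j' s := ext i' j' s (above_of (i', j')).
have diag i' j' s := ext i' j' s (diag_of (i', j')).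
have st_r u : step u (right_of u) by rewrite /step /= eqxx.
have st_a u : step u (above_of u) by rewrite /step /= eqxx orbT.
have st_d u : step u (diag_of u) by rewrite /step /= eqxx !orbT.
elim: j i => [|j IHj].
  elim=> [|i [s adm ws]]; first by exists [::].
  have [adm' ws'] := right _ _ _ adm (st_r _).
  by exists (rcons s (right_of (i.+1, 1%N))); rewrite // ws' step_weight_right ws.
elim=> [|i [s adm ws]].
  have [s adm ws] := IHj 0%N; have [adm' ws'] := above _ _ _ adm (st_a _).
  exists (rcons s (above_of (1%N, j.+1))); rewrite // ws' step_weight_above ws.
  by rewrite addn0; case: (j).
rewrite /lppG lppSS -/(lppG _ j.+1 i) -/(lppG _ j i.+1) -/(lppG _ j i).
case: leqP => [_|_].
  have [s' adm1 ws1] := IHj i; have [adm' ws'] := diag _ _ _ adm1 (st_d _).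
  by exists (rcons s' (diag_of (i.+1, j.+1))); rewrite // ws' step_weight_diag ws1.
case: leqP => [_|_].
  have [s' adm1 ws1] := IHj i.+1; have [adm' ws'] := above _ _ _ adm1 (st_a _).
  exists (rcons s' (above_of (i.+2, j.+1))); rewrite // ws' step_weight_above ws1.
  by rewrite addn0.
have [adm' ws'] := right _ _ _ adm (st_r _).
exists (rcons s (right_of (i.+1, j.+2))); rewrite // ws' step_weight_right ws.
by rewrite addn0.
Qed.

Lemma last_passageE (R : realType) (w : site -> bool) i j :
  last_passage R w (1%N, 1%N) (i.+1, j.+1) = (lppG (w \o shift_diag) j i)%:R.
Proof.
rewrite /last_passage; set S := (X in sup X); have [s adm ws] := path_weight_attained w i j.
have ub : ubound S (lppG (w \o shift_diag) j i)%:R.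
  by move=> _ [s' adm' <-]; rewrite ler_nat path_weight_le.
have inS : S (lppG (w \o shift_diag) j i)%:R by exists s => //; rewrite ws.
apply/eqP; rewrite eq_le; apply/andP; split.
  by apply: ge_sup => //; exists (lppG (w \o shift_diag) j i)%:R.
by apply: ub_le_sup => //; exists (lppG (w \o shift_diag) j i)%:R.
Qed.

Lemma bernoulli_set1 (R : realType) (p : R) (b : bool) : 0 <= p <= 1 ->
  bernoulli_prob p [set b] = (if b then p else 1 - p)%:E.
Proof.
move=> p01; rewrite /bernoulli_prob p01 fsbig_set1 /bernoulli_pmf.
by case: b.
Qed.

(* The environment [w0] is arbitrary, since [Q] only depends on the bits in [s]. *)
Lemma iid_bernoulli_prob d (T : measurableType d) (R : realType)
    (P : probability T R) (p : R) (omega : site -> {RV P >-> bool}) (s : seq site)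
    (Q : (site -> bool) -> bool) (w0 : site -> bool) :
  0 <= p <= 1 -> iid_bernoulli p omega -> uniq s -> (forall c, c \in s -> lattice c) ->
  (forall w w', {in s, w =1 w'} -> Q w = Q w') ->
  measurable [set t | Q (omega^~ t)] /\
  P [set t | Q (omega^~ t)] = (Pr (fun=> p) s Q w0)%:E.
Proof.
move=> p01 [law indep] us sl Qs.
pose B (r : seq site) (w : site -> bool) : set T :=
  \bigcap_(i in [set j | j \in r]) omega i @^-1` [set w i].
have mB r w : measurable (B r w).
  apply: fin_bigcap_measurable; first exact: finite_seq.
  by move=> i _; rewrite -[_ @^-1` _]setTI; apply: measurable_funPT.
(* Bits in [r] are fixed to their values in [w], those in [s'] still averaged. Independence is used
   only when all are fixed. *)
suff key (r s' : seq site) (w : site -> bool) : uniq (r ++ s') ->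
    (forall c, c \in r ++ s' -> lattice c) ->
    (forall w w', {in r ++ s', w =1 w'} -> Q w = Q w') ->
    measurable (B r w `&` [set t | Q (omega^~ t)]) /\
    P (B r w `&` [set t | Q (omega^~ t)]) =
    ((\prod_(i <- r) (if w i then p else 1 - p)) * Pr (fun=> p) s' Q w)%:E.
  have := key [::] s w0 us sl Qs; rewrite big_nil mul1r.
  have -> : B [::] w0 = setT by apply/seteqP; split => // t _ i.
  by rewrite setTI.
elim: s' r w {us sl Qs s w0} => [|i s IH] r w us sl Qs.
  rewrite cats0 in us sl Qs.
  have BQ t : B r w t -> Q (omega^~ t) = Q w.
    by move=> Bt; apply: Qs => j jr; apply: Bt.
  rewrite /Pr /=; have [Qw|Qw] := boolP (Q w).
    have -> : B r w `&` [set t | Q (omega^~ t)] = B r w.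
      by apply/seteqP; split => [t []//|t Bt]; split => //=; rewrite BQ.
    split => //; rewrite mulr1.
    rewrite [LHS](indep r (fun i => [set w i])) //.
    rewrite -prodEFin big_seq [RHS]big_seq; apply: eq_bigr => j jr.
    by rewrite -bernoulli_set1 // -(law j (sl j jr)).
  have -> : B r w `&` [set t | Q (omega^~ t)] = set0.
    apply/seteqP; split => // t [/BQ eQ /=]; rewrite eQ.
    by rewrite (negbTE Qw).
  by rewrite measure0 mulr0; split => //; apply: measurable0.
have us' : uniq ((i :: r) ++ s).
  by rewrite (perm_uniq (permEl (perm_catCA r [:: i] s))) in us.
have mem_eq c : (c \in r ++ i :: s) = (c \in (i :: r) ++ s).
  by rewrite !(mem_cat, inE) orbCA orbA.
have sl' c : c \in (i :: r) ++ s -> lattice c by rewrite -mem_eq; apply: sl.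
have Qs' w1 w2 : {in (i :: r) ++ s, w1 =1 w2} -> Q w1 = Q w2.
  by move=> e; apply: Qs => c; rewrite mem_eq; apply: e.
have ir : i \notin r by move: us' => /=; rewrite mem_cat negb_or => /andP[/andP[]].
have [m1 P1] := IH (i :: r) (upd w i true) us' sl' Qs'.
have [m0 P0] := IH (i :: r) (upd w i false) us' sl' Qs'.
have updr b c : c \in r -> upd w i b c = w c.
  by move=> cr; rewrite updE ifF //; apply: contraNF ir => /eqP <-.
have BE b : B (i :: r) (upd w i b) = B r w `&` omega i @^-1` [set b].
  apply/seteqP; split => t.
    move=> Bt; split; last by have := Bt i (mem_head _ _); rewrite /= updE eqxx.
    by move=> c cr; rewrite -(updr b c cr); apply: Bt; rewrite /= inE cr orbT.
  move=> [Bt ti] c; rewrite /= inE => /predU1P[->|cr]; first by rewrite updE eqxx.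
  by rewrite (updr b c cr); apply: Bt.
rewrite !BE in m1 m0 P1 P0.
have -> : B r w `&` [set t | Q (omega^~ t)] =
    (B r w `&` omega i @^-1` [set true] `&` [set t | Q (omega^~ t)]) `|`
    (B r w `&` omega i @^-1` [set false] `&` [set t | Q (omega^~ t)]).
  apply/seteqP; split => [t [Bt Qt]|t [[[Bt _] Qt]|[[Bt _] Qt]]] //.
  by case E : (omega i t); [left|right]; split.
split; first exact: measurableU.
rewrite measureU //; last first.
  by apply/seteqP; split => // t [[[_ /= ->] _] [[_ /=]]].
rewrite [X in (X + _)%E]P1 [X in (_ + X)%E]P0 -EFinD !big_cons !updE eqxx; congr _%:E.
have prodE b : \prod_(j <- r) (if upd w i b j then p else 1 - p) =
    \prod_(j <- r) (if w j then p else 1 - p).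
  by rewrite big_seq [RHS]big_seq; apply: eq_bigr => j jr; rewrite updr.
by rewrite !prodE /Pr /=; ring.
Qed.

(** * From tails to moments *)

Lemma Ex_sum (R : realDomainType) (I : eqType) (q : I -> R) (s : seq I)
    (J : Type) (l : seq J) (f : J -> (I -> bool) -> R) w :
  Ex q s (fun w => \sum_(k <- l) f k w) w = \sum_(k <- l) Ex q s (f k) w.
Proof.
elim: l => [|k l IH].
  rewrite big_nil -[RHS](Ex_cst q s 0 w); apply: eq_Ex => w' _.
  by rewrite big_nil.
rewrite big_cons -IH -ExD; apply: eq_Ex => w' _.
by rewrite big_cons.
Qed.

(** As [L] has finitely many values, the expectation is a finite combination of probabilities of
    level sets. *)
Lemma iid_bernoulli_expectation d (T : measurableType d) (R : realType)
    (P : probability T R) (p : R) (omega : site -> {RV P >-> bool}) (s : seq site)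
    (L : (site -> bool) -> nat) (K : nat) (phi : nat -> R) (w0 : site -> bool) :
  0 <= p <= 1 -> iid_bernoulli p omega -> uniq s -> (forall c, c \in s -> lattice c) ->
  (forall w w', {in s, w =1 w'} -> L w = L w') -> (forall w, (L w <= K)%N) ->
  (forall k, 0 <= phi k) ->
  ('E_P[fun t => phi (L (omega^~ t))] =
    (Ex (fun=> p) s (fun w => phi (L w)) w0)%:E)%E.
Proof.
move=> p01 iid us sl Ls LK phi0.
have decomp (w : site -> bool) :
    phi (L w) = \sum_(k < K.+1) phi k * (L w == k)%:R.
  have LK' : (L w < K.+1)%N by rewrite ltnS.
  rewrite (bigD1 (Ordinal LK')) //= eqxx mulr1 big1 ?addr0 // => k kL.
  case: eqP => [Lk|]; last by rewrite mulr0.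
  by case/eqP: kL; apply: val_inj.
have Ak (k : nat) := @iid_bernoulli_prob _ _ _ P p omega s
  (fun w => L w == k) w0 p01 iid us sl
  (fun w w' e => congr1 (fun l => l == k) (Ls w w' e)).
pose A k := [set t | L (omega^~ t) == k].
rewrite unlock.
transitivity (\int[P]_t (\sum_(k <- index_enum 'I_K.+1)
    ((phi k)%:E * (\1_(A k) t)%:E)))%E.
  apply: eq_integral => t _; rewrite decomp -sumEFin; apply: eq_bigr => k _.
  rewrite EFinM indicE; congr (_ * (_)%:R%:E)%E.
  by apply/esym; case: (boolP (L (omega^~ t) == k)) => h;
    [rewrite mem_set | rewrite memNset //; apply/negP].
rewrite ge0_integral_sum //; last 2 first.
- move=> k; apply: measurable_funeM; apply/measurable_EFinP.
  by apply: measurable_indic; case: (Ak k).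
- by move=> k t _; rewrite mule_ge0 // lee_fin.
have -> : (fun w => phi (L w)) =
    (fun w => \sum_(k <- index_enum 'I_K.+1) phi k * (L w == k)%:R).
  by apply/funext => w; rewrite decomp.
rewrite Ex_sum -sumEFin; apply: eq_bigr => k _.
case: (Ak k) => mA PA.
have mf : measurable_fun setT (EFin \o (\1_(A k) : T -> R)).
  by apply/measurable_EFinP; apply: measurable_indic.
rewrite ge0_integralZl_EFin //.
by rewrite integral_indic // setIT [X in (_ * X)%E]PA -EFinM ExZ.
Qed.

(** Discrete layer-cake formula: [X ^+ 2] is at most the sum of [2 * k + 1] over the integers
    [k <= X]. *)
Lemma second_moment_le (R : realType) (I : eqType) (q : I -> R) (s : seq I)
    (X : (I -> bool) -> R) (C B : R) (k0 : nat) w :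
  unit_interval_on q s -> 0 <= C -> (forall w, 0 <= X w <= B) -> (0 < k0)%N ->
  (forall k, (k0 <= k)%N -> Pr q s (fun w => k%:R <= X w) w <= C / k%:R ^+ 3) ->
  Ex q s (fun w => X w ^+ 2) w <= k0%:R ^+ 2 + 18 * C.
Proof.
move=> q01 C0 XB k00 tail.
pose K := (Num.truncn B).+1.
have XK w' : X w' < K%:R.
  by case/andP: (XB w') => _ /le_lt_trans; apply; apply: truncnS_gt.
pose S n := \sum_(0 <= k < n) (2 * k%:R + 1) * Pr q s (fun w => k%:R <= X w) w.
have le_S : Ex q s (fun w => X w ^+ 2) w <= S K.
  rewrite /S; under eq_bigr do rewrite -ExZ.
  rewrite -Ex_sum; apply: le_Ex => // w' _.
  have X0 : 0 <= X w' by case/andP: (XB w').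
  have sq n : \sum_(0 <= k < n) (2 * k%:R + 1) = n%:R ^+ 2 :> R.
    elim: n => [|n IH]; first by rewrite big_nil expr0n.
    by rewrite big_nat_recr //= IH -natr1; ring.
  pose n := (Num.truncn (X w')).+1.
  have nK : (n <= K)%N by rewrite ltnS truncn_le_nat //; apply: le_lt_trans (XK w').
  have Xn : X w' <= n%:R by rewrite ltW // truncnS_gt.
  apply: (@le_trans _ _ (n%:R ^+ 2)); first by rewrite lerXn2r ?nnegrE.
  rewrite -sq [leRHS](big_cat_nat (leq0n n) nK) /=.
  rewrite -[leLHS]addr0; apply: lerD; last first.
    by apply: sumr_ge0 => k _; rewrite mulr_ge0 // addr_ge0 // mulr_ge0.
  rewrite big_nat [leRHS]big_nat; apply: ler_sum => k /= kn.
  by rewrite (_ : (k%:R <= X w') = true) ?mulr1 // -truncn_ge_nat // -ltnS.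
apply: le_trans le_S _.
have Pr1 k := Pr_le1 q01 (fun w => k%:R <= X w) w.
have S1 n : (n <= k0)%N -> S n <= n%:R ^+ 2.
  elim: n => [|n IH] nk; first by rewrite /S big_nil expr0n.
  have h : (2 * n%:R + 1) * Pr q s (fun w => n%:R <= X w) w <= 2 * n%:R + 1.
    by apply: ler_piMr (Pr1 n); rewrite addr_ge0 // mulr_ge0.
  rewrite /S big_nat_recr //= -/(S n); apply: le_trans (lerD (IH (ltnW nk)) h) _.
  by rewrite -natr1; lra.
(* Telescoping: [(2 * k + 1) / k ^+ 3 <= 18 / ((k + 1) * (k + 2))], with equality at [k = 1]. *)
have S2 n : S n <= k0%:R ^+ 2 + 18 * C * (1 - n.+1%:R^-1).
  have c18 n' : 0 <= 18 * C * (1 - n'.+1%:R^-1).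
    by rewrite !mulr_ge0 // subr_ge0 invf_le1 // ler1n.
  elim: n => [|n IH].
    by rewrite /S big_nil addr_ge0 // sqr_ge0.
  have [nk|nk] := leqP n.+1 k0.
    rewrite -[leLHS]addr0; apply: lerD => //; apply: le_trans (S1 _ nk) _.
    by rewrite lerXn2r ?nnegrE // ler_nat.
  have n0 : (0 < n)%N by apply: leq_trans k00 _.
  have np : 1 <= n%:R :> R by rewrite ler1n.
  have h : (2 * n%:R + 1) * Pr q s (fun w => n%:R <= X w) w <=
      (2 * n%:R + 1) * (C / n%:R ^+ 3).
    by apply: ler_wpM2l; [rewrite addr_ge0 // mulr_ge0 | apply: tail].
  rewrite /S big_nat_recr //= -/(S n); apply: le_trans (lerD IH h) _.
  rewrite -addrA lerD2l -subr_ge0 -![in X in 0 <= X]natr1.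
  have n00 : n%:R != 0 :> R by rewrite gt_eqF // ltr0n.
  set v := n%:R in np n00 *.
  rewrite (_ : _ - _ = C * (18 * v ^+ 3 - (2 * v + 1) * (v + 1) * (v + 2)) /
     (v ^+ 3 * (v + 1) * (v + 2))); last first.
    by field; rewrite n00 !gt_eqF //; lra.
  rewrite divr_ge0 //; last by rewrite !mulr_ge0 ?exprn_ge0 //; lra.
  rewrite mulr_ge0 //.
  have -> : v = 1 + (v - 1) by ring.
  have : 0 <= v - 1 by rewrite subr_ge0.
  by move: (v - 1) => e e0; have := exprn_ge0 3 e0; have := exprn_ge0 2 e0; nra.
by apply: le_trans (S2 K) _; rewrite lerD2l ler_piMr ?mulr_ge0 // gerBl.
Qed.

Lemma lppG_local (w w' : site -> bool) m n :
  {in [seq shift_diag c | c <- bsites m n], w =1 w'} ->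
  lppG (w \o shift_diag) n m = lppG (w' \o shift_diag) n m.
Proof.
move=> ww'; apply: (@lpp_eq _ _ _ _ _ _ m n) => // i j im jn.
by apply: ww'; apply: map_f; rewrite mem_bsites; lia.
Qed.

Lemma shift_diag_inj : injective shift_diag.
Proof. by move=> [i j] [k l] [-> ->]. Qed.

Lemma centered_last_passageE (R : realType) (p x y : R) N (w : site -> bool) :
  1 <= N%:R * x -> 1 <= N%:R * y ->
  centered_last_passage p x y N w =
  (lppG (w \o shift_diag) (Num.truncn (N%:R * y)).-1
    (Num.truncn (N%:R * x)).-1)%:R - N%:R * g_pp p x y.
Proof.
move=> Nx Ny; rewrite /centered_last_passage -last_passageE !prednK // truncn_gt0 //.
Qed.

(** One unit is lost to the integer part, one to the starting site [(1, 1)]. *)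
Lemma truncn_pred_bounds (R : realType) (z : R) : 1 <= z ->
  z - 2 <= (Num.truncn z).-1%:R <= z.
Proof.
move=> z1; have /andP[t1 t2] := truncn_itv (le_trans ler01 z1).
have t0 : (0 < Num.truncn z)%N by rewrite truncn_gt0.
move: t1 t2; rewrite -(prednK t0) /= -!natr1 => t1 t2.
by apply/andP; split; lra.
Qed.

(** With [s = sqrt (p * y / x)], [slope p rho = x / y] reads [(p + rho) / (1 + rho) = s]. The
    solution is positive because [p < s < 1], which is the condition on [y / x]. *)
Lemma characteristic_density (R : realType) (p x y : R) :
  0 < p -> p < 1 -> 0 < x -> 0 < y -> p < y / x -> y / x < p^-1 ->
  exists rho : R, [/\ 0 < rho, slope p rho = x / y &
    x * hpar rho + y * hpar (p / rho) = g_pp p x y].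
Proof.
move=> p0 p1 x0 y0 hyx hyx'.
pose s := Num.sqrt (p * (y / x)).
have yx0 : 0 < y / x by rewrite divr_gt0.
have s2 : s ^+ 2 = p * (y / x) by rewrite sqr_sqrtr // mulr_ge0 // ltW.
have s0 : 0 < s by rewrite sqrtr_gt0 mulr_gt0.
have s1 : s < 1.
  rewrite -(@ltr_pXn2r _ 2) ?nnegrE ?ler01 ?(ltW s0) // s2 expr1n.
  by rewrite -ltr_pdivlMl // mulr1.
have ps : p < s.
  by rewrite -(@ltr_pXn2r _ 2) ?nnegrE ?(ltW s0) ?(ltW p0) // s2 expr2 ltr_pM2l.
have n1 : 1 - s != 0 by rewrite gt_eqF // subr_gt0.
have n2 : 1 - p != 0 by rewrite gt_eqF // subr_gt0.
have n3 : s - p != 0 by rewrite gt_eqF // subr_gt0.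
have n4 : s != 0 by rewrite gt_eqF.
have nx : x != 0 by rewrite gt_eqF.
have ny : y != 0 by rewrite gt_eqF.
exists ((s - p) / (1 - s)); split.
- by rewrite divr_gt0 // subr_gt0.
- rewrite /slope (_ : 1 + _ = (1 - p) / (1 - s)); last by field.
  rewrite (_ : p + _ = s * (1 - p) / (1 - s)); last by field.
  transitivity (p / s ^+ 2); first by field; rewrite n1 n2 n4.
  by rewrite s2; field; rewrite nx ny gt_eqF.
rewrite /g_pp ifF; last first.
  apply/negbTE; rewrite -ltNge ltr_pdivlMr //.
  by move: hyx'; rewrite ltr_pdivrMr // mulrC -ltr_pdivrMr ?invr_gt0 // invrK.
rewrite ifT; last by move: hyx; rewrite ltr_pdivlMr // => /ltW.
have -> : Num.sqrt (p * x * y) = x * s.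
  have -> : p * x * y = (x * s) ^+ 2 by rewrite exprMn s2; field.
  by rewrite sqrtr_sqr ger0_norm // mulr_ge0 // ltW.
have -> : hpar ((s - p) / (1 - s)) = (s - p) / (1 - p).
  by rewrite /hpar; field; rewrite n1 n2.
have -> : hpar (p / ((s - p) / (1 - s))) = (p / s ^+ 2) * (s - s ^+ 2) / (1 - p).
  rewrite /hpar; field; rewrite n1 n2 n3 n4 /=.
  rewrite (_ : s - p + p * (1 - s) = s * (1 - p)); last by ring.
  exact: mulf_neq0.
have -> : p / s ^+ 2 = x / y by rewrite s2; field; rewrite nx ny gt_eqF.
by rewrite s2; field; rewrite n2 nx ny.
Qed.

Theorem theorem2p6 (R : realType) (p x y : R)
    (hp0 : 0 < p) (hp1 : p < 1) (hx : 0 < x) (hy : 0 < y)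
    (hyx : p < y / x) (hyx' : y / x < p^-1) :
  exists (N0 : nat) (C : R), 0 < C /\
    (forall (d : measure_display) (T : measurableType d)
       (P : probability T R) (omega : site -> {RV P >-> bool}),
       iid_bernoulli p omega ->
       forall (b : R) (N : nat) (alpha : R),
         C <= b -> (N0 <= N)%N -> 0 < alpha -> alpha < 1 ->
         (P [set t | (b * N%:R `^ (3^-1)
                      <= `|centered_last_passage p x y N (omega^~ t)|)%R]
          <= (C * b `^ (- (3 * alpha / 2)))%:E)%E)
    /\
    (forall r : R, 1 <= r ->
       exists Cr : R,
         forall (d : measure_display) (T : measurableType d)
           (P : probability T R) (omega : site -> {RV P >-> bool}),
           iid_bernoulli p omega ->
           forall (alpha : R) (N : nat),
             0 < alpha -> alpha < 1 -> r < 3 * alpha / 2 -> (N0 < N)%N ->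
             ('E_P[fun t => (`|centered_last_passage p x y N (omega^~ t)
                               / N%:R `^ (3^-1)| `^ r)%R]
              <= Cr%:E)%E).
Proof.
have [rho [r0 critical eg]] := characteristic_density hp0 hp1 hx hy hyx hyx'.
have [C [C0 tail]] := finite_tail hp0 hp1 hx hy r0 critical.
rewrite eg in tail; set g := g_pp p x y in tail.
have p01 : 0 <= p <= 1 by rewrite !ltW.
pose N0 := (Num.truncn x^-1 + Num.truncn y^-1).+1.
have N0P (N : nat) : (N0 <= N)%N -> [/\ 1 <= N%:R * x, 1 <= N%:R * y & (0 < N)%N].
  move=> N0N; have big (z : R) : 0 < z -> (Num.truncn z^-1 < N)%N -> 1 <= N%:R * z.
    move=> z0 zN; rewrite -ler_pdivrMr // mul1r; apply: le_trans (ltW (truncnS_gt _)) _.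
    by rewrite ler_nat.
  by split; [apply: big => //|apply: big => //|]; move: N0N; rewrite /N0; clear; lia.
pose bits N := [seq shift_diag c | c <-
  bsites (Num.truncn (N%:R * x)).-1 (Num.truncn (N%:R * y)).-1].
pose G N (w : site -> bool) := lppG w (Num.truncn (N%:R * y)).-1
    (Num.truncn (N%:R * x)).-1.
pose a (N : nat) : R := N%:R `^ (3^-1).
have a3 N : a N ^+ 3 = N%:R.
  by rewrite -powR_mulrn ?powR_ge0 // -powRrM mulVf ?powRr1.
have a1 N : (0 < N)%N -> 1 <= a N.
  by move=> N1; rewrite -(powRr0 N%:R) /a; apply: ler_powR; rewrite ?ler1n.
have ubits N : uniq (bits N).
  by rewrite map_inj_uniq ?uniq_bsites //; apply: shift_diag_inj.
have lbits N c : c \in bits N -> lattice c.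
  by move=> /mapP[c' _ ->].
pose w0 : site -> bool := fun=> false.
have tailN N k : (N0 <= N)%N -> C ^+ 2 <= k ->
    Pr (fun=> p) (bits N)
      (fun w => k * a N <= `|(G N (w \o shift_diag))%:R - N%:R * g|) w0 <= C / k ^+ 3.
  move=> NN Ck; have [Nx Ny N1] := N0P N NN.
  have k0 : 0 < k by apply: lt_le_trans Ck; rewrite exprn_gt0.
  have sk : Num.sqrt k ^+ 2 = k by rewrite sqr_sqrtr // ltW.
  have Csk : C <= Num.sqrt k.
    by rewrite -(@ler_pXn2r _ 2) ?nnegrE ?sqrtr_ge0 ?(ltW C0) // sk.
  rewrite /Pr (Ex_relabel _ _ (fun w => (k * a N <= `|(G N w)%:R - N%:R * g|)%R%:R));
    last exact: shift_diag_inj.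
  have := tail (a N) (Num.sqrt k) (Num.truncn (N%:R * x)).-1 (Num.truncn (N%:R * y)).-1
    (w0 \o shift_diag) (a1 N N1) Csk.
  rewrite a3 !truncn_pred_bounds // sk => /(_ isT isT).
  by have -> : Num.sqrt k ^+ 6 = k ^+ 3 by rewrite -{2}sk -exprM.
have cE N w : (N0 <= N)%N -> centered_last_passage p x y N w =
    (G N (w \o shift_diag))%:R - N%:R * g.
  by move=> NN; have [Nx Ny _] := N0P N NN; rewrite centered_last_passageE.
have Gloc N (w w' : site -> bool) : {in bits N, w =1 w'} ->
    G N (w \o shift_diag) = G N (w' \o shift_diag) by exact: lppG_local.
(* [C ^+ 2 <= b] makes [finite_tail] applicable to the square root of [b], [C] is its prefactor, and
   [1 <= b] lets [b ^- 3] be weakened to the exponent [- (3 * alpha / 2)]. *)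
exists N0, (C ^+ 2 + C + 1); split; first by rewrite !addr_gt0 ?exprn_gt0.
split.
  move=> d T P omega iid b N alpha Cb NN al0 al1.
  have C20 : 0 <= C ^+ 2 by apply: sqr_ge0.
  have Cb2 : C ^+ 2 <= b by move: Cb C0; clear; lra.
  have b1 : 1 <= b by move: Cb C0 C20; clear; lra.
  have b0 : 0 < b by apply: lt_le_trans b1.
  pose Q (w : site -> bool) := b * a N <= `|(G N (w \o shift_diag))%:R - N%:R * g|.
  have Qloc w w' : {in bits N, w =1 w'} -> Q w = Q w'.
    by move=> /Gloc e; rewrite /Q e.
  have [_ PQ] := iid_bernoulli_prob w0 p01 iid (ubits N) (lbits N) Qloc.
  rewrite (_ : [set t | _] = [set t | Q (omega^~ t)]); last first.
    by apply/seteqP; split => t /=; rewrite /Q cE.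
  rewrite [leLHS]PQ lee_fin; apply: le_trans (tailN N b NN Cb2) _.
  apply: (@le_trans _ _ (C * b `^ (- (3 * alpha / 2)))).
    rewrite ler_pM2l // -powR_mulrn ?(ltW b0) // -powRN.
    by apply: ler_powR => //; move: al0 al1; clear; lra.
  by apply: ler_wpM2r; [apply: powR_ge0 | move: C0 C20; clear; lra].
move=> r r1; pose k0 := (Num.truncn (C ^+ 2)).+1.
exists (1 + (k0%:R ^+ 2 + 18 * C)) => d T P omega iid alpha N al0 al1 ral N0N.
have NN : (N0 <= N)%N by apply: ltnW.
have [Nx Ny N1] := N0P N NN; have aN0 : 0 < a N by apply: lt_le_trans (a1 N N1).
pose phi (k : nat) : R := `|(k%:R - N%:R * g) / a N| `^ r.
have -> : (fun t => `|centered_last_passage p x y N (omega^~ t) / N%:R `^ 3^-1| `^ r) =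
    (fun t => phi (G N ((omega^~ t) \o shift_diag))).
  by apply/funext => t; rewrite cE.
rewrite (@iid_bernoulli_expectation _ _ _ P p omega (bits N)
  (fun w => G N (w \o shift_diag)) (Num.truncn (N%:R * x)).-1 phi w0) //; last 4 first.
- exact: lbits.
- exact: Gloc.
- by move=> w; apply: bulk_lpp_le.
- by move=> k; apply: powR_ge0.
rewrite lee_fin.
pose X (w : site -> bool) := `|((G N (w \o shift_diag))%:R - N%:R * g) / a N|.
have q01 : unit_interval_on (fun=> p) (bits N) by [].
(* Here [r < 2], so the power is at most [1] or at most the square; the constant is thus free of [r]
   and [alpha]. *)
apply: (@le_trans _ _ (Ex (fun=> p) (bits N) (fun w => 1 + X w ^+ 2) w0)).
  apply: le_Ex => // w _; rewrite /phi -/(X w).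
  have X0 : 0 <= X w by apply: normr_ge0.
  have X2 : 0 <= X w ^+ 2 by apply: sqr_ge0.
  have [X1|X1] := leP (X w) 1.
    apply: (@le_trans _ _ 1); last by rewrite lerDl.
    rewrite -[leRHS](_ : 1 `^ r = 1); last by rewrite powR1.
    apply: ge0_ler_powR; rewrite ?nnegrE //.
    by apply: le_trans r1.
  apply: (@le_trans _ _ (X w ^+ 2)); last by rewrite lerDr.
  rewrite -powR_mulrn //; apply: ler_powR; first exact: ltW.
  by move: ral al1; clear; lra.
rewrite (ExD (fun=> p) (bits N) (fun=> 1) (fun w => X w ^+ 2)) Ex_cst lerD2l.
apply: (@second_moment_le _ _ _ _ X C
  (((Num.truncn (N%:R * x)).-1%:R + `|N%:R * g|) / a N)) => //.
- exact: ltW.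
- move=> w; rewrite normr_ge0 /= /X normrM [`|(a N)^-1|]gtr0_norm ?invr_gt0 //.
  rewrite ler_pM2r ?invr_gt0 //; apply: le_trans (ler_normB _ _) _.
  by rewrite lerD2r normr_nat ler_nat bulk_lpp_le.
move=> k k0k; have Ck : C ^+ 2 <= k%:R.
  by apply: le_trans (ltW (truncnS_gt _)) _; rewrite ler_nat.
apply: le_trans (tailN N k%:R NN Ck); apply: le_Pr => // w.
by rewrite /X normrM [`|(a N)^-1|]gtr0_norm ?invr_gt0 // ler_pdivlMr.
Qed.
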